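(* For $n\ge1$ let $K^n$ be the $n$-step transition kernel of the Markov chain $(\Delta_n)_{n\ge0}$. Then $K^n(r',r)=K^n(-r',-r)$. For $r\geq0$ the values $K^n(r',r)$ are given by $$\begin{cases} \displaystyle\sum_{p,q=0}^n a_{p,q}^n e^{pr'-(q+2)r} & r'\leq 0,\\[6pt] \displaystyle\frac{(-1)^{n-1}e^{r'-(n+1)r}}{(n-1)^!}+\sum_{p=0}^{n-2}\frac{(-1)^n r' e^{-p(r'-r)-nr}}{(p)^!\,(n-p-2)^!}+\sum_{p,q=0}^n b_{p,q}^n e^{-pr'-(q+2)r} & 0<r'\leq r,\\[6pt] \displaystyle\frac{(-1)^{n-1}e^{-(n-1)r'-r}}{(n-1)^!}+\sum_{p=0}^{n-2}\frac{(-1)^n r e^{-p(r'-r)-nr}}{(p)^!\,(n-p-2)^!}+\sum_{p,q=0}^n c_{p,q}^n e^{-pr'-(q+2)r} & r'>r, \end{cases}$$ where the coefficients $a^n_{p,q}$, $b^n_{p,q}$, $c^n_{p,q}$ are determined by their generating functions as follows. i) The generating functions $A_{p,q}(z)=\sum_{n=1}^\infty a^n_{p,q}z^n$, $p,q\ge0$, are given by $$A_{1,q}(z)=\frac{(-z)^q}{(q)^!}\alpha(z),\qquad A_{p,q}(z)=\frac{2(-z)^{p-1}}{(p)^!}A_{1,q}(z)\ \ (p\ge2),\qquad A_{0,q}(z)=\frac{S^2(z)}{1-z}A_{1,q}(z).$$ ii) The generating functions $B_{p,q}(z)=\sum_{n=1}^\infty b^n_{p,q}z^n$, $p,q\ge0$,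 are given by $$B_{1,q}(z)=\frac{(-z)^q}{(q)^!}G(z)-A_{1,q}(z),$$ $$B_{p,q}(z)=\frac{2(-z)^{p-1}}{(p)^!}B_{1,q}(z)+\frac{(-z)^{p+q+2}}{(p)^!(q)^!}\sum_{k=2}^p\frac{2k+1}{k(k+1)}\ \ (p\ge2),$$ $$B_{0,q}(z)=\frac{S^2(z)}{1-z}B_{1,q}(z)+\frac{(-z)^q}{(q)^!}H(z).$$ iii) The generating functions $C_{p,q}(z)=\sum_{n=1}^\infty c^n_{p,q}z^n$, $p,q\ge0$, are given by $$C_{0,q}(z)=d_qz^{q+2}+B_{0,q}(z)-\frac{(-z)^{q+2}}{(q)^!},$$ $$C_{1,q}(z)=\left[S^1(z)+\frac{zS^2(z)}{2(1-z)}\right]A_{1,q}(z)-\frac z2C_{0,q}(z),\qquad C_{p,q}(z)=\frac{2(-z)^{p-1}}{(p)^!}C_{1,q}(z)\ \ (p\ge2),$$ and the numbers $d_q$ are determined by their generating function $D(z)=\sum_{q=0}^\infty d_qz^q$ given by $$D(z)=\frac1z\left[\sqrt z\,J_1(2\sqrt z)\left(2\gamma+\log z\right)-\pi\sqrt z\,Y_1(2\sqrt z)-1\right].$$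
   Context: Markov chain. Consider the ladder graph with vertex set $\mathbb N\times\{0,1\}$, $\mathbb{N}=\{0,1,2,\dots\}$, with edges joining vertices at Euclidean distance one and independent mean-one exponential edge weights: $X_i$ on the edge between $(i-1,0)$ and $(i,0)$, $Y_i$ on the edge between $(i-1,1)$ and $(i,1)$, and $Z_i$ on the rung between $(i,0)$ and $(i,1)$. Let $l_n$, $l_n'$ be the first-passage times (minimal total weight of a path) from $(0,0)$ to $(n,0)$, resp. $(n,1)$, in the subgraph $G_n$ induced on $\{0,\dots,n\}\times\{0,1\}$, and $\Delta_n=l'_n-l_n$. Then $$\Delta_n=\min\{\Delta_{n-1}+Y_n,\,X_n+Z_n\}-\min\{\Delta_{n-1}+Y_n+Z_n,\,X_n\},$$ a time-homogeneous Markov chain on $\mathbb R$, considered for arbitrary starting points. Its $n$-step transition kernel $K^n:\mathbb R\times\mathbb R\to\mathbb R_+$ is defined by $K^n(r',r)\,\mathrm dr=\mathbb P(\Delta_n\in\mathrm dr\mid\Delta_0=r')$; being a density, it is understood up to Lebesgue-null sets in $r$. Notation. $(k)^!:=k!\,(k+1)!$ for integers $k\ge 0$; $\gamma$ is the Euler–Mascheroni constant; $J_\nu$ and $Y_\nu$ are the Bessel functions of the first and second kind of order $\nu$; superscripts on $S^1,S^2$ are labels, not powers; empty sums are zero. Define $$S^1(z)=\frac{z-2J_2(2\sqrt z)}{z},\qquad S^2(z)=\frac{2(z-1)+2J_0(2\sqrt z)}{z},$$ $$G(z)=-\frac{z^3}{4}\left[5-4\gamma+2\pi\frac{Y_2(2\sqrt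 z)}{J_2(2\sqrt z)}-2\log z\right],$$ $$\alpha(z)=\frac{z^4}{4\sqrt z\,J_2(2\sqrt z)\left[\sqrt z\,J_0(2\sqrt z)+(z-1)J_1(2\sqrt z)\right]},$$ $$H(z)=\frac{z^2}{2(1-z)}\left[3z-3+2\pi Y_0(2\sqrt z)+J_0(2\sqrt z)\left(5-4\gamma-2\log z\right)\right].$$ All generating functions are understood as power series around $z=0$ (the logarithmic terms cancel and the singularities at $0$ are removable). *)

(* Defs.v *)
From HB Require Import structures.
From mathcomp Require Import all_boot all_order all_algebra.
From mathcomp Require Import all_classical all_reals all_analysis.

Set Implicit Arguments.
Unset Strict Implicit.
Unset Printing Implicit Defensive.

Import Order.TTheory GRing.Theory Num.Theory.
Import numFieldNormedType.Exports.

Local Open Scope classical_set_scope.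
Local Open Scope ring_scope.

Section ladder_chain.
Context {R : realType} {d : measure_display} {T : measurableType d}.
Variable P : probability T R.

Definition mutually_independent (I : eqType) (W : I -> {RV P >-> R}) : Prop :=
  forall (s : seq I) (A : I -> set R), uniq s ->
    (forall i, measurable (A i)) ->
    P (\bigcap_(i in [set` s]) (W i @^-1` A i)) =
    (\prod_(i <- s) P (W i @^-1` A i))%E.

Variables X Y Z : nat -> {RV P >-> R}.

(* [X i], [Y i], [Z i] are the weights of the edges with index i + 1: the
   horizontal edges from (i, 0) to (i + 1, 0) and from (i, 1) to (i + 1, 1), and
   the rung between (i + 1, 0) and (i + 1, 1). The rung at 0 only enters the
   value of the chain at time 0, which is arbitrary here. *)
Definition edge_weight (e : nat + (nat + nat)) : {RV P >-> R} :=
  match e with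
  | inl i => X i
  | inr (inl i) => Y i
  | inr (inr i) => Z i
  end.

Definition iid_exponential_weights : Prop :=
  mutually_independent edge_weight /\
  forall e (A : set R), measurable A ->
    distribution P (edge_weight e) A = exponential_prob 1 A.

Fixpoint Delta (r' : R) (n : nat) (w : T) : R :=
  if n is m.+1 then
    Num.min (Delta r' m w + Y m w) (X m w + Z m w)
    - Num.min (Delta r' m w + Y m w + Z m w) (X m w)
  else r'.

(* K is a version of the n-step transition density; it is only determined up to
   a Lebesgue-null set of second arguments. *)
Definition is_transition_kernel (n : nat) (K : R -> R -> R) : Prop :=
  forall r' : R,
    [/\ measurable_fun [set: R] (K r'),
        forall r, 0 <= K r' r
      & forall A : set R, measurable A ->
          P (Delta r' n @^-1` A) =
          (\int[lebesgue_measure]_(r in A) (K r' r)%:E)%E].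

End ladder_chain.

Section bessel.
Context {R : realType}.
Implicit Types (n k : nat) (x : R).

Definition harmonic_number k : R := \sum_(1 <= j < k.+1) j%:R^-1.

Definition euler_gamma : R :=
  limn (fun m : nat => harmonic_number m - ln (m%:R : R)).

Definition digamma_succ k : R := harmonic_number k - euler_gamma.

Definition besselJ n x : R :=
  limn (series (fun k =>
    (-1) ^+ k / (k`! * (n + k)`!)%:R * (x / 2) ^+ (2 * k + n))).

(* The Bessel function of the second kind (Weber's function) of integer order
   n, for x > 0, by its classical expansion (DLMF 10.8.1, Abramowitz-Stegun
   9.1.11); [digamma_succ k] is the value of the digamma function at k + 1. *)
Definition besselY n x : R :=
  2 / pi * ln (x / 2) * besselJ n x
  - pi^-1 * (\sum_(0 <= k < n)
      (n - k - 1)`!%:R / k`!%:R * (x / 2) ^+ (2 * k) / (x / 2) ^+ n)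
  - pi^-1 * limn (series (fun k =>
      (digamma_succ k + digamma_succ (n + k)) *
      ((-1) ^+ k / (k`! * (n + k)`!)%:R * (x / 2) ^+ (2 * k + n)))).

End bessel.

Section generating_functions.
Context {R : realType}.
Implicit Types (p q n : nat) (z : R).

(* [sfact k] is written (k)^! in the literature on this chain. *)
Definition sfact n : R := (n`! * n.+1`!)%:R.

(* f is given, for all small z > 0, by the convergent power series with
   coefficients u m, u m.+1, ...; since the functions below are not defined at
   z = 0 and involve square roots and logarithms, expansion "around 0" is
   expressed on a right neighbourhood of 0, which determines the coefficients. *)
Definition has_genfun (m : nat) (u : nat -> R) (f : R -> R) : Prop :=
  \forall z \near 0^'+,
    series (fun k => u (m + k)%N * z ^+ (m + k)) @ \oo --> f z.

Definition S1 z : R := (z - 2 * besselJ 2 (2 * Num.sqrt z)) / z.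

Definition S2 z : R := (2 * (z - 1) + 2 * besselJ 0 (2 * Num.sqrt z)) / z.

Definition genG z : R :=
  - (z ^+ 3 / 4) *
  (5 - 4 * euler_gamma
   + 2 * pi * (besselY 2 (2 * Num.sqrt z) / besselJ 2 (2 * Num.sqrt z))
   - 2 * ln z).

Definition genalpha z : R :=
  z ^+ 4 /
  (4 * Num.sqrt z * besselJ 2 (2 * Num.sqrt z) *
   (Num.sqrt z * besselJ 0 (2 * Num.sqrt z)
    + (z - 1) * besselJ 1 (2 * Num.sqrt z))).

Definition genH z : R :=
  z ^+ 2 / (2 * (1 - z)) *
  (3 * z - 3 + 2 * pi * besselY 0 (2 * Num.sqrt z)
   + besselJ 0 (2 * Num.sqrt z) * (5 - 4 * euler_gamma - 2 * ln z)).

Definition genD z : R :=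
  z^-1 *
  (Num.sqrt z * besselJ 1 (2 * Num.sqrt z) * (2 * euler_gamma + ln z)
   - pi * Num.sqrt z * besselY 1 (2 * Num.sqrt z) - 1).

Definition genA1 q z : R := (- z) ^+ q / sfact q * genalpha z.

Definition genA p q z : R :=
  match p with
  | 0 => S2 z / (1 - z) * genA1 q z
  | 1 => genA1 q z
  | _ => 2 * (- z) ^+ p.-1 / sfact p * genA1 q z
  end.

Definition genB1 q z : R := (- z) ^+ q / sfact q * genG z - genA1 q z.

Definition genB p q z : R :=
  match p with
  | 0 => S2 z / (1 - z) * genB1 q z + (- z) ^+ q / sfact q * genH z
  | 1 => genB1 q z
  | _ => 2 * (- z) ^+ p.-1 / sfact p * genB1 q z
         + (- z) ^+ (p + q + 2) / (sfact p * sfact q) *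
           \sum_(2 <= k < p.+1) ((2 * k + 1)%:R / (k * k.+1)%:R)
  end.

Definition genC0 (dq : nat -> R) q z : R :=
  dq q * z ^+ (q + 2) + genB 0 q z - (- z) ^+ (q + 2) / sfact q.

Definition genC1 (dq : nat -> R) q z : R :=
  (S1 z + z * S2 z / (2 * (1 - z))) * genA1 q z - z / 2 * genC0 dq q z.

Definition genC (dq : nat -> R) p q z : R :=
  match p with
  | 0 => genC0 dq q z
  | 1 => genC1 dq q z
  | _ => 2 * (- z) ^+ p.-1 / sfact p * genC1 dq q z
  end.

Definition kernel_coefficients (a b c : nat -> nat -> nat -> R)
    (dq : nat -> R) : Prop :=
  [/\ forall p q, has_genfun 1 (fun n => a n p q) (genA p q),
      forall p q, has_genfun 1 (fun n => b n p q) (genB p q),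
      forall p q, has_genfun 1 (fun n => c n p q) (genC dq p q)
    & has_genfun 0 dq genD].

(* The value of the n-step kernel at (r', r) for n >= 1 and r >= 0. The sums
   over p < n.-1 are those over 0 <= p <= n - 2, empty for n = 1. *)
Definition kernel_formula (a b c : nat -> nat -> nat -> R) (n : nat)
    (r' r : R) : R :=
  if r' <= 0 then
    \sum_(p < n.+1) \sum_(q < n.+1)
      a n p q * expR (p%:R * r' - (q + 2)%:R * r)
  else if r' <= r then
    (-1) ^+ n.-1 * expR (r' - n.+1%:R * r) / sfact n.-1
    + \sum_(p < n.-1)
        (-1) ^+ n * r' * expR (- p%:R * (r' - r) - n%:R * r)
        / (sfact p * sfact (n - p - 2))
    + \sum_(p < n.+1) \sum_(q < n.+1)
        b n p q * expR (- p%:R * r' - (q + 2)%:R * r)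
  else
    (-1) ^+ n.-1 * expR (- n.-1%:R * r' - r) / sfact n.-1
    + \sum_(p < n.-1)
        (-1) ^+ n * r * expR (- p%:R * (r' - r) - n%:R * r)
        / (sfact p * sfact (n - p - 2))
    + \sum_(p < n.+1) \sum_(q < n.+1)
        c n p q * expR (- p%:R * r' - (q + 2)%:R * r).

End generating_functions.

(* Main.v *)
Require Import Defs.
From HB Require Import structures.
From mathcomp Require Import all_boot all_order all_algebra.
From mathcomp Require Import all_classical all_reals all_analysis.
From mathcomp Require Import measurable_realfun.
From mathcomp Require Import ring lra zify.

Set Implicit Arguments.
Unset Strict Implicit.
Unset Printing Implicit Defensive.

Import Order.TTheory GRing.Theory Num.Theory.
Import numFieldNormedType.Exports.

Local Open Scope classical_set_scope.
Local Open Scope ring_scope.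

(* From position t, one step lands at x >= 0 with density
   k t x = e^{-x} min(1, e^{t-x}), and at -x with density k (-t) x; so the
   (n+1)-step density is the integral of the n-step one against k, split into
   two half-line integrals. On a half-line such an integral is explicit: if
   f'' - f' = (2c - g) e^{-x} and f' = o(e^x), two integrations by parts give
   the integral of g * k t in terms of f t, f 0, f' 0 and c. The candidate
   kernel, split at 0 and at the diagonal, solves this differential equation
   from n to n + 1 coefficient by coefficient, and the initial conditions at 0
   become four identities between the generating functions. These reduce to the
   recurrences and the Wronskian of the Bessel functions, written for the entire
   series jf n z = J_n (2 sqrt z) / sqrt z ^ n and for the logarithm-free part
   yf n of Y_n (2 sqrt z). *)

(** * Generating functions near 0 *)

(** The dependence on r is passive: A_{p,q} and B_{p,q} carry the factor (-z)^q / (q)^!, so for r'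
    <= r the kernel is a convolution in n of (-1)^q / (q)^! e^{-(q+2)r} with functions of the
    starting point alone. The differential equation and the conditions at 0 are checked for those
    functions. Only the correction above the diagonal mixes r' and r. It also tames the growth: the
    expression for r' <= r contains e^{r'}, which would violate f' = o(e^x), and the correction
    cancels exactly this term. The one-step density arises because a step sends t to t + Y - X
    clamped to [-Z, Z]. The chain is built by appending a last step, whereas the differential
    equation lives in the starting point and prepends a first one; the iterates of the one-step
    operator mediate between the two. Nonnegativity of the kernel, invisible in the alternating
    sums, follows from the backward equation by induction. Finally, a power series that vanishes on
    a right neighbourhood of 0 has zero coefficients, so any coefficients with the prescribed
    generating functions agree with the ones constructed here. *)

Section power_series.
Context {R : realType}.
Implicit Types (u v : nat -> R) (f g : R -> R) (z : R).

Lemma near_right0P (Q : R -> Prop) :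
  (\forall z \near 0^'+, Q z) <->
  exists2 e : R, 0 < e & forall z, 0 < z -> z < e -> Q z.
Proof.
split.
- move=> [/= e e0 H]; exists e => // z z0 ze; apply: H => //=.
  by rewrite sub0r normrN gtr0_norm.
- move=> [e e0 H]; near=> z; apply: H; first by near: z; exact: nbhs_right_gt.
  by near: z; exact: nbhs_right_lt.
Unshelve. all: by end_near. Qed.

(** This encodes a positive radius of convergence. With the exponent [n.+1] a single constant bounds
    the term of index 0 as well; [geo_boundedW] absorbs a separate factor. *)
Definition geo_bounded u := exists2 M : R, 0 < M & forall n, `|u n| <= M ^+ n.+1.

Lemma geo_boundedW u (M C : R) : 0 <= M -> 0 <= C ->
  (forall n, `|u n| <= C * M ^+ n) -> geo_bounded u.
Proof.
move=> M0 C0 H; exists (M + C + 1); first by lra.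
move=> n; apply: (le_trans (H n)); rewrite exprS.
apply: ler_pM => //; [exact: exprn_ge0|lra|].
by apply: lerXn2r; rewrite ?nnegrE; lra.
Qed.

Lemma geo_cvg u (M z : R) : 0 < M -> (forall n, `|u n| <= M ^+ n.+1) ->
  `|z| < M^-1 -> cvgn (series (fun k => u k * z ^+ k)).
Proof.
move=> M0 H zM; apply: normed_cvg.
apply: (@series_le_cvg _ _ (geometric M (M * `|z|))).
- by move=> n /=.
- by move=> n; rewrite /= mulr_ge0 ?exprn_ge0 ?mulr_ge0 // ltW.
- move=> n /=; rewrite normrM normrX exprMn mulrA -exprS.
  by apply: ler_wpM2r; rewrite ?exprn_ge0.
- apply: is_cvg_geometric_series.
  by rewrite ger0_norm ?mulr_ge0 ?(ltW M0) // mulrC -ltr_pdivlMr // div1r.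
Qed.

Lemma geo_genfun u : geo_bounded u ->
  has_genfun 0 u (fun z => limn (series (fun k => u k * z ^+ k))).
Proof.
move=> [M M0 H]; apply/near_right0P; exists M^-1; first by rewrite invr_gt0.
by move=> z z0 zM; apply: (geo_cvg M0 H); rewrite gtr0_norm.
Qed.

(** Convergence at one point z > 0 bounds the terms u n z^n, hence u n is O(z^-n). *)
Lemma genfun_geo u f : has_genfun 0 u f -> geo_bounded u.
Proof.
move=> /near_right0P[e e0 H].
have [z z0 ze] : exists2 z : R, 0 < z & z < e by exists (e / 2); lra.
have cz := H z z0 ze.
have [K _ HK] : exists2 K : R, 0 < K & forall n, `|u n * z ^+ n| <= K.
  have := cvg_series_cvg_0 (cvgP _ cz).
  move=> /cvgP cz0.
  have [K [Kr HK]] : bounded_fun (fun n => u (0 + n)%N * z ^+ (0 + n)).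
    exact: cvg_seq_bounded cz0.
  exists (`|K| + 1); first by have := normr_ge0 K; lra.
  by move=> n; apply: (HK (`|K| + 1)) => //; have := ler_norm K; lra.
have z'0 : 0 <= z^-1 by rewrite invr_ge0 ltW.
apply: (@geo_boundedW _ z^-1 `|K|) => // n.
rewrite exprVn ler_pdivlMr ?exprn_gt0 //.
have := HK n; rewrite normrM (ger0_norm (exprn_ge0 _ (ltW z0))) => h.
by apply: (le_trans h); exact: ler_norm.
Qed.

Lemma eq_genfun m u v f g : (forall k, u (m + k)%N = v (m + k)%N) ->
  (\forall z \near 0^'+, f z = g z) ->
  has_genfun m u f -> has_genfun m v g.
Proof.
move=> uv; apply: filterS2 => z -> H.
rewrite (_ : (fun k => _) = (fun k => u (m + k)%N * z ^+ (m + k))) //.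
by apply/funext => k; rewrite uv.
Qed.

(** The generating functions of the theorem start at index 1, while the algebra below starts at
    index 0; a zero constant term reconciles the two. *)
Lemma genfun1 u f : u 0 = 0 -> has_genfun 1 u f <-> has_genfun 0 u f.
Proof.
move=> u0; rewrite /has_genfun.
have E z : series (fun k => u (0 + k)%N * z ^+ (0 + k)) \o S =
    series (fun k => u (1 + k)%N * z ^+ (1 + k)).
  apply/funext => n /=; rewrite /series /= big_nat_recl // add0n u0 mul0r add0r.
  by [].
split; apply: filterS => z H.
- by rewrite -cvg_shiftS; rewrite -E in H; exact: H.
- by rewrite -E; rewrite -cvg_shiftS in H; exact: H.
Qed.

Lemma genfunD u v f g : has_genfun 0 u f -> has_genfun 0 v g ->
  has_genfun 0 (fun n => u n + v n) (fun z => f z + g z).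
Proof.
apply: filterS2 => z Hu Hv.
rewrite (_ : series _ = series (fun k => u (0 + k)%N * z ^+ (0 + k)) +
   series (fun k => v (0 + k)%N * z ^+ (0 + k))); first exact: cvgD.
rewrite -seriesD; congr series; apply/funext => k; rewrite mulrDl.
by [].
Qed.

Lemma genfunZ c u f : has_genfun 0 u f ->
  has_genfun 0 (fun n => c * u n) (fun z => c * f z).
Proof.
apply: filterS => z Hu.
rewrite (_ : series _ = c *: series (fun k => u (0 + k)%N * z ^+ (0 + k))).
  exact: cvgZr.
by rewrite -seriesZ; congr series; apply/funext => k; rewrite -mulrA.
Qed.

Lemma genfunB u v f g : has_genfun 0 u f -> has_genfun 0 v g ->
  has_genfun 0 (fun n => u n - v n) (fun z => f z - g z).
Proof.
move=> Hu /(genfunZ (-1)) Hv; apply: eq_genfun (genfunD Hu Hv).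
  by move=> k; rewrite mulN1r.
by apply: nearW => z; rewrite mulN1r.
Qed.

Definition shift_seq (m : nat) u (n : nat) := if (m <= n)%N then u (n - m)%N else 0.

Lemma genfun_shift m u f : has_genfun 0 u f ->
  has_genfun 0 (shift_seq m u) (fun z => z ^+ m * f z).
Proof.
apply: filterS => z Hu; rewrite -(cvg_shiftn m).
rewrite (_ : (fun n => _) = z ^+ m *: series (fun k => u (0 + k)%N * z ^+ (0 + k))).
  exact: cvgZr.
apply/funext => n; rewrite /series /= (addnC n) (big_cat_nat (n := m)) ?leq_addr //=.
rewrite big_nat_cond big1 ?add0r; last first.
  by move=> i; rewrite andbT /shift_seq leq0n add0n /= ltnNge => /negbTE ->; rewrite mul0r.
rewrite -{1}(add0n m) big_addn addKn fctE /GRing.scale /= mulr_sumr.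
apply: eq_bigr => i _; rewrite /shift_seq !add0n leq_addl addnK exprD; ring.
Qed.

Definition delta_seq (m n : nat) : R := (n == m)%:R.

Lemma genfun_delta0 : has_genfun 0 (delta_seq 0) (fun=> 1).
Proof.
apply: nearW => z; rewrite -cvg_shiftS.
rewrite (_ : (fun n => _) = cst 1); first exact: cvg_cst.
apply/funext => n; rewrite /series /= big_nat_recl // big1 ?addr0.
  by rewrite /delta_seq add0n eqxx mul1r expr0.
by move=> i _; rewrite /delta_seq add0n mul0r.
Qed.

Lemma genfun_delta m : has_genfun 0 (delta_seq m) (fun z => z ^+ m).
Proof.
apply: eq_genfun (genfun_shift m genfun_delta0).
  move=> k; rewrite /shift_seq /delta_seq add0n.
  case: leqP => [mk|km]; first by rewrite subn_eq0 eqn_leq mk andbT.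
  by rewrite ltn_eqF.
by apply: nearW => z; rewrite mulr1.
Qed.

(** If z <= 1/(2M), the terms of positive index add up to at most 2 M^2 z. Choosing z below eps / (2
    M^2) bounds |u 0| by eps, without any appeal to continuity of f at 0. *)
Lemma genfun_head u f : has_genfun 0 u f -> (\forall z \near 0^'+, f z = 0) -> u 0 = 0.
Proof.
move=> Hu f0; have [M M0 HM] := genfun_geo Hu.
apply/eqP; rewrite -normr_le0; apply/ler_addgt0Pl => eps eps0; rewrite addr0.
have M20 : 0 < (2 * M)^-1 by rewrite invr_gt0; lra.
have Me0 : 0 < eps / (2 * M ^+ 2).
  by rewrite divr_gt0 // mulr_gt0 // exprn_gt0.
have [z [c0 [fz0 [z0 [zM zeps]]]]] := filter_ex (filterI Hu (filterI f0
  (filterI (nbhs_right_gt 0) (filterI (nbhs_right_lt M20) (nbhs_right_lt Me0))))).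
rewrite fz0 in c0; move/ltW: zeps.
rewrite ler_pdivlMr ?mulr_gt0 ?exprn_gt0 // mulrC => {}zeps.
move/ltW: zM; rewrite invfM ler_pdivlMr // mulrC => {}zM.
suff H : forall n, `|series (fun k => u (0 + k)%N * z ^+ (0 + k)) n.+1 - u 0| <= eps.
  have : (fun n => series (fun k => u (0 + k)%N * z ^+ (0 + k)) n.+1 - u 0) @ \oo --> 0 - u 0.
    by apply: cvgB; [rewrite (cvg_shiftS (series _))|exact: cvg_cst].
  move=> /cvg_norm; rewrite sub0r normrN => H1.
  rewrite -(cvg_lim (@Rhausdorff R) H1).
  apply: limr_le; first by apply/cvg_ex; eexists; exact: H1.
  by apply: nearW => n; exact: H.
move=> n; rewrite /series /= big_nat_recl // !addn0 expr0 mulr1 addrAC subrr add0r.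
apply: le_trans zeps; apply: (le_trans (ler_norm_sum _ _ _)).
have B i : `|u (0 + i.+1)%N * z ^+ (0 + i.+1)| <= M ^+2 * z * 2^-1 ^+ i.
  rewrite !add0n normrM normrX (gtr0_norm z0) exprSr.
  apply: (@le_trans _ _ (M ^+ i.+2 * (z ^+ i * z))).
    by rewrite ler_wpM2r // mulr_ge0 ?exprn_ge0 // ltW.
  rewrite (_ : M ^+ i.+2 * _ = M ^+ 2 * z * (M * z) ^+ i); last first.
    by rewrite exprMn -addn2 exprD; ring.
  rewrite ler_wpM2l ?mulr_ge0 ?exprn_ge0 // ?(ltW z0) ?(ltW M0) //.
  by apply: lerXn2r; rewrite // nnegrE ?mulr_ge0 ?(ltW z0) ?(ltW M0) // invr_ge0.
apply: (le_trans (ler_sum _ (fun i _ => B i))).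
rewrite -mulr_sumr (_ : 2 * M ^+ 2 * z = M ^+ 2 * z * 2); last by ring.
apply: ler_wpM2l.
  by rewrite mulr_ge0 ?exprn_ge0 // ltW.
have ne : (2^-1 : R) != 1 by lra.
have := congr1 (fun h => h n) (geometric_seriesE 1 ne); rewrite /series /= => E'.
rewrite (eq_bigr (fun k => 1 * 2^-1 ^+ k)); last by move=> i _; rewrite mul1r.
rewrite E' (_ : 1 - 2^-1 = 2^-1); last by lra.
rewrite invrK mul1r; have : 0 <= (2^-1 : R) ^+ n by rewrite exprn_ge0 // invr_ge0.
set x := _ ^+ n; lra.
Qed.

Lemma genfun_tail u f : has_genfun 0 u f -> u 0 = 0 ->
  has_genfun 0 (fun n => u n.+1) (fun z => z^-1 * f z).
Proof.
move=> Hu u0; have := (genfun1 f u0).2 Hu; apply: filterS2 _ _ (nbhs_right_gt 0) => z z0 H.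
rewrite (_ : series _ = z^-1 *: series (fun k => u (1 + k)%N * z ^+ (1 + k))).
  exact: cvgZr.
rewrite -seriesZ; congr series; apply/funext => k /=.
rewrite /GRing.scale /= add0n add1n exprS.
by rewrite -[RHS]/(z^-1 * _); field; rewrite gt_eqF.
Qed.

(** Once the constant term is known to vanish, division by z lowers every index by one. *)
Lemma genfun_eq0 u f : has_genfun 0 u f -> (\forall z \near 0^'+, f z = 0) ->
  forall n, u n = 0.
Proof.
move=> Hu f0 n; elim: n u f Hu f0 => [|n IH] u f Hu f0.
  exact: genfun_head f0.
apply: (IH (fun k => u k.+1) _ (genfun_tail Hu (genfun_head Hu f0))).
by apply: filterS f0 => z ->; rewrite mulr0.
Qed.

Lemma genfun_uniq u v f g : has_genfun 0 u f -> has_genfun 0 v g ->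
  (\forall z \near 0^'+, f z = g z) -> forall n, u n = v n.
Proof.
move=> Hu Hv fg n; apply/eqP; rewrite -subr_eq0; apply/eqP.
apply: (genfun_eq0 (genfunB Hu Hv)).
by apply: filterS fg => z ->; rewrite subrr.
Qed.

End power_series.

(** * Cauchy products and reciprocals of power series *)

Section power_series_product.
Context {R : realType}.
Implicit Types (u v : nat -> R) (f g : R -> R) (z : R).

Definition conv_seq u v n : R := \sum_(i < n.+1) u i * v (n - i)%N.

(** The partial sums are values at 1 of truncating polynomials. Their product has the Cauchy
    coefficients in degrees below n, so only the degrees from n to 2n - 1 remain. *)
Lemma series_conv_diff u v n :
  series u n * series v n - series (conv_seq u v) n =
  \sum_(n <= m < n + n) \sum_(i < m.+1)
    (if (i < n)%N then u i else 0) * (if (m - i < n)%N then v (m - i)%N else 0).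
Proof.
pose p := \poly_(i < n) u i; pose q := \poly_(i < n) v i.
have E w : series w n = (\poly_(i < n) w i).[1].
  rewrite horner_poly /series /= big_mkord.
  by apply: eq_bigr => i _; rewrite expr1n mulr1.
rewrite 2!E -/p -/q -hornerM (@horner_coef_wide _ (n + n)); last first.
  apply: (leq_trans (size_polyMleq p q)).
  have := size_poly n u; have := size_poly n v; rewrite -/p -/q; lia.
rewrite -(big_mkord xpredT (fun i => (p * q)`_i * 1 ^+ i)).
rewrite (big_cat_nat (n := n)) ?leq_addr //= addrAC.
rewrite [X in X - _](_ : _ = series (conv_seq u v) n).
  rewrite subrr add0r; apply: eq_bigr => m _; rewrite expr1n mulr1 coefM.
  by apply: eq_bigr => i _; rewrite !coef_poly.
rewrite /series /= !big_nat; apply: eq_bigr => m /= mn; rewrite expr1n mulr1 coefM.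
apply: eq_bigr => i _; rewrite !coef_poly.
by rewrite !(leq_ltn_trans _ mn) // ?leq_subr // -ltnS.
Qed.

(** For K z <= 1/8 the leftover of [series_conv_diff] has n coefficients, each at most K^2 2n 8^-n.
    Two uses of n <= 2^n turn the total into 2 K^2 2^-n, which is why 1/8 is the threshold. *)
Lemma genfunM u v f g : has_genfun 0 u f -> has_genfun 0 v g ->
  has_genfun 0 (conv_seq u v) (fun z => f z * g z).
Proof.
move=> Hu Hv; have [M M0 HM] := genfun_geo Hu; have [N N0 HN] := genfun_geo Hv.
pose K := M + N; have K0 : 0 < K by rewrite addr_gt0.
have HM' k : `|u k| <= K ^+ k.+1.
  by apply: (le_trans (HM k)); apply: lerXn2r; rewrite ?nnegrE /K; lra.
have HN' k : `|v k| <= K ^+ k.+1.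
  by apply: (le_trans (HN k)); apply: lerXn2r; rewrite ?nnegrE /K; lra.
have K8 : 0 < (8 * K)^-1 by rewrite invr_gt0; lra.
apply: filterS3 Hu Hv (filterI (nbhs_right_gt 0) (nbhs_right_lt K8)).
move=> z cu cv [z0 zK].
have {}zK : K * z <= 8^-1.
  by move/ltW: zK; rewrite invfM ler_pdivlMr // mulrC.
set a := fun k => u (0 + k)%N * z ^+ (0 + k) in cu.
set b := fun k => v (0 + k)%N * z ^+ (0 + k) in cv.
have Ec : (fun k => conv_seq u v (0 + k)%N * z ^+ (0 + k)) = conv_seq a b.
  apply/funext => k; rewrite /conv_seq add0n mulr_suml; apply: eq_bigr => i _.
  rewrite /a /b !add0n -[in z ^+ k](subnKC (_ : i <= k)%N) -1?ltnS // exprD; ring.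
rewrite Ec.
have Kz0 : 0 <= K * z by rewrite mulr_ge0 // ltW.
have Ba k : `|a k| <= K * (K * z) ^+ k.
  rewrite /a !add0n normrM normrX (gtr0_norm z0) exprMn mulrA -exprS.
  by rewrite ler_wpM2r // exprn_ge0 // ltW.
have Bb k : `|b k| <= K * (K * z) ^+ k.
  rewrite /b !add0n normrM normrX (gtr0_norm z0) exprMn mulrA -exprS.
  by rewrite ler_wpM2r // exprn_ge0 // ltW.
have D : (fun n => series a n * series b n - series (conv_seq a b) n) @ \oo --> (0 : R).
  have G := @cvg_geometric R (2 * K ^+ 2) 2^-1 _.
  have h2 : `|2^-1 : R| < 1 by rewrite gtr0_norm; lra.
  apply/cvgr0Pnorm_lt => eps eps0.
  move/cvgr0Pnorm_lt : (G h2) => /(_ eps eps0); apply: filterS => n.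
  apply: le_lt_trans; rewrite series_conv_diff.
  have T m : (n <= m < n + n)%N -> `|\sum_(i < m.+1)
    (if (i < n)%N then a i else 0) * (if (m - i < n)%N then b (m - i)%N else 0)| <=
     K ^+ 2 * (2 * n%:R) * 8^-1 ^+ n.
    move=> /andP[nm mn]; apply: (le_trans (ler_norm_sum _ _ _)).
    apply: (@le_trans _ _ (\sum_(i < m.+1) K ^+ 2 * 8^-1 ^+ n)).
      apply: ler_sum => i _; rewrite normrM.
      apply: (@le_trans _ _ ((K * (K * z) ^+ i) * (K * (K * z) ^+ (m - i)))).
        apply: ler_pM => //; case: ifP => // _; rewrite normr0.
          by rewrite mulr_ge0 ?exprn_ge0 // ltW.
        by rewrite mulr_ge0 ?exprn_ge0 // ltW.
      rewrite mulrACA -expr2 -exprD subnKC -1?ltnS //.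
      apply: ler_wpM2l; first by rewrite exprn_ge0 // ltW.
      rewrite -(subnKC nm) exprD -[leRHS]mulr1.
      apply: ler_pM; rewrite ?exprn_ge0 //.
        by apply: lerXn2r; rewrite // nnegrE ?invr_ge0.
      by apply: exprn_ile1 => //; lra.
    rewrite sumr_const card_ord -[leLHS]mulr_natr mulrAC.
    apply: ler_wpM2r; first by rewrite exprn_ge0 // invr_ge0.
    apply: ler_wpM2l; first by rewrite exprn_ge0 // ltW.
    by rewrite -natrM ler_nat; lia.
  apply: (le_trans (ler_norm_sum _ _ _)).
  rewrite big_nat; apply: (le_trans (ler_sum _ T)).
  rewrite -big_nat sumr_const_nat addKn /geometric /= normrM normrX.
  rewrite (ger0_norm (_ : 0 <= 2 * K ^+ 2)); last by rewrite mulr_ge0 ?exprn_ge0 // ltW.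
  rewrite (gtr0_norm (_ : 0 < (2^-1 : R))) ?invr_gt0 // -[leLHS]mulr_natr.
  have n2 : (n%:R : R) <= 2 ^+ n by rewrite -natrX ler_nat ltnW // ltn_expl.
  rewrite [leLHS](_ : _ = 2 * K ^+ 2 * (n%:R * n%:R * 8^-1 ^+ n)); last by ring.
  apply: ler_wpM2l; first by rewrite mulr_ge0 ?exprn_ge0 // ltW.
  apply: (@le_trans _ _ (2 ^+ n * 2 ^+ n * 8^-1 ^+ n)).
    apply: ler_wpM2r; first by rewrite exprn_ge0 // invr_ge0.
    by apply: ler_pM.
  rewrite -!exprMn (_ : 2 * 2 * 8^-1 = 2^-1 :> R) //; lra.
rewrite (_ : series _ = (fun n => series a n * series b n -
    (series a n * series b n - series (conv_seq a b) n))); last first.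
  by apply/funext => n; rewrite opprB addrC subrK.
rewrite -[X in _ --> X]subr0; apply: cvgB D.
exact: cvgM cu cv.
Qed.

(** Each coefficient of the reciprocal depends on all earlier ones; carrying the list of them makes
    this recursion structural. *)
Fixpoint inv_seq_rec u n : seq R :=
  if n is m.+1 then
    let s := inv_seq_rec u m in
    rcons s ((u 0)^-1 * ((m == 0%N)%:R - \sum_(i < m) u (m - i)%N * s`_i))
  else [::].

Definition inv_seq u n := (inv_seq_rec u n.+1)`_n.

Lemma size_inv_seq_rec u n : size (inv_seq_rec u n) = n.
Proof. by elim: n => //= n IH; rewrite size_rcons IH. Qed.

Lemma nth_inv_seq_rec u n i : (i < n)%N -> (inv_seq_rec u n)`_i = inv_seq u i.
Proof.
elim: n => // n IH; rewrite ltnS leq_eqVlt => /predU1P[->//|ni].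
by rewrite /= nth_rcons size_inv_seq_rec ni IH.
Qed.

Lemma inv_seqE u n : inv_seq u n =
  (u 0)^-1 * ((n == 0%N)%:R - \sum_(i < n) u (n - i)%N * inv_seq u i).
Proof.
rewrite {1}/inv_seq /= nth_rcons size_inv_seq_rec ltnn eqxx.
by congr (_ * (_ - _)); apply: eq_bigr => i _; rewrite (@nth_inv_seq_rec u n).
Qed.

Lemma conv_inv_seq u : u 0 != 0 -> conv_seq (inv_seq u) u =1 delta_seq 0.
Proof.
move=> u0 n; rewrite /conv_seq big_ord_recr /= subnn inv_seqE mulrAC mulVf // mul1r.
rewrite [X in X + _](eq_bigr (fun i : 'I_n => u (n - i)%N * inv_seq u i)).
  by rewrite addrC subrK.
by move=> i _; rewrite mulrC.
Qed.

(** The bound c N^n with c = 1/|u 0| reproduces itself: M <= N/2 makes the recurrence sum a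
    geometric one of ratio 1/2, and 2 c M^2 <= N absorbs its value. The choice of N is the sum of
    these two requirements. *)
Lemma geo_inv_seq u : u 0 != 0 -> geo_bounded u -> geo_bounded (inv_seq u).
Proof.
move=> u0 [M M0 HM]; pose c := `|u 0|^-1; have c0 : 0 < c by rewrite invr_gt0 normr_gt0.
pose N := 2 * M + 2 * M ^+ 2 * c.
have M20 : 0 < M ^+ 2 by rewrite exprn_gt0.
have N0 : 0 < N by rewrite /N addr_gt0 // ?mulr_gt0.
apply: (@geo_boundedW _ _ N c); [exact: ltW|exact: ltW|].
elim/ltn_ind => n IH; rewrite inv_seqE normrM normfV -/c.
apply: ler_wpM2l; first exact: ltW.
case: n IH => [|n] IH; first by rewrite big_ord0 subr0 expr0 normr1.
rewrite sub0r normrN; apply: (le_trans (ler_norm_sum _ _ _)).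
apply: (@le_trans _ _ (\sum_(i < n.+1) (c * M ^+ 2 * N ^+ n) * 2^-1 ^+ (n - i))).
  apply: ler_sum => i _; rewrite normrM.
  apply: (@le_trans _ _ (M ^+ (n.+1 - i).+1 * (c * N ^+ i))).
    by apply: ler_pM => //; exact: IH.
  have ni : (i <= n)%N by rewrite -ltnS.
  rewrite subSn // -[in N ^+ n](subnK ni) exprD.
  rewrite [leLHS](_ : _ = c * M ^+ 2 * N ^+ i * M ^+ (n - i)); last first.
    by rewrite -(addn2 (n - i)) exprD; ring.
  rewrite [leRHS](_ : _ = c * M ^+ 2 * N ^+ i * (N / 2) ^+ (n - i)); last first.
    by rewrite exprMn; ring.
  apply: ler_wpM2l.
    by rewrite ?mulr_ge0 ?exprn_ge0 // ltW.
  have : 0 < M ^+ 2 * c by rewrite mulr_gt0.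
  by move=> ?; apply: lerXn2r; rewrite ?nnegrE /N; lra.
rewrite -mulr_sumr (reindex_inj rev_ord_inj) /=.
rewrite (eq_bigr (fun i : 'I_n.+1 => 2^-1 ^+ i)); last first.
  by move=> i _; rewrite subSS subKn // -ltnS.
have ne : (2^-1 : R) != 1 by lra.
have := congr1 (fun h => h n.+1) (geometric_seriesE 1 ne); rewrite /series /= big_mkord => E'.
rewrite (eq_bigr (fun k : 'I_n.+1 => 1 * 2^-1 ^+ k)); last by move=> i _; rewrite mul1r.
rewrite E' (_ : 1 - 2^-1 = 2^-1); last by lra.
rewrite invrK mul1r [in leRHS]exprS -[leLHS]mulrA (mulrC (N ^+ n)) mulrA.
apply: ler_wpM2r; first by rewrite exprn_ge0 // ltW.
apply: (@le_trans _ _ (c * M ^+ 2 * 2)); last by rewrite /N; lra.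
apply: ler_wpM2l; first by rewrite mulr_ge0 // ltW.
have : 0 <= (2^-1 : R) ^+ n.+1 by rewrite exprn_ge0 // invr_ge0.
set x := _ ^+ _; lra.
Qed.

Lemma near_genfun_inv u f : has_genfun 0 u f -> u 0 != 0 ->
  \forall z \near 0^'+, limn (series (fun k => inv_seq u k * z ^+ k)) * f z = 1.
Proof.
move=> Hu u0; have Hv := geo_genfun (geo_inv_seq u0 (genfun_geo Hu)).
have HM := genfunM Hv Hu; rewrite (funext (conv_inv_seq u0)) in HM.
apply: filterS2 HM (@genfun_delta0 R) => z H1 H2.
by rewrite -(cvg_lim (@Rhausdorff R) H1) -(cvg_lim (@Rhausdorff R) H2).
Qed.

Lemma near_genfun_neq0 u f : has_genfun 0 u f -> u 0 != 0 ->
  \forall z \near 0^'+, f z != 0.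
Proof.
move=> Hu u0; apply: filterS (near_genfun_inv Hu u0) => z V1.
by apply/eqP => fz; move: V1; rewrite fz mulr0; lra.
Qed.

Lemma genfunV u f : has_genfun 0 u f -> u 0 != 0 ->
  has_genfun 0 (inv_seq u) (fun z => (f z)^-1).
Proof.
move=> Hu u0; have Hv := geo_genfun (geo_inv_seq u0 (genfun_geo Hu)).
apply: eq_genfun Hv => //.
apply: filterS2 (near_genfun_inv Hu u0) (near_genfun_neq0 Hu u0) => z V1 fz.
by rewrite -[LHS](mulfK fz) V1 div1r.
Qed.

End power_series_product.

(** * Bessel series *)

Section wronskian.
Context {R : realType}.

(** This is the harmonic factor in the series of Y_1, that is, the sum of the digamma values at k +
    1 and k + 2 without Euler's constant. *)
Definition hsum k : R := harmonic_number k + harmonic_number k.+1.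

Lemma harmonic_numberS k :
  harmonic_number k.+1 = harmonic_number k + k.+1%:R^-1 :> R.
Proof. by rewrite /harmonic_number big_nat_recr. Qed.

Lemma harmonic_number0 : harmonic_number 0 = 0 :> R.
Proof. by rewrite /harmonic_number big_geq. Qed.

Lemma hsumS k : hsum k.+1 = hsum k + k.+1%:R^-1 + k.+2%:R^-1.
Proof. by rewrite /hsum !harmonic_numberS; ring. Qed.

Lemma factr_neq0 n : n`!%:R != 0 :> R.
Proof. by rewrite pnatr_eq0 -lt0n fact_gt0. Qed.

Lemma sfact_gt0 n : 0 < sfact n :> R.
Proof. by rewrite ltr0n muln_gt0 !fact_gt0. Qed.

Lemma sfact_neq0 n : sfact n != 0 :> R.
Proof. by rewrite gt_eqF ?sfact_gt0. Qed.

Lemma sfactS n : sfact n.+1 = n.+1%:R * n.+2%:R * sfact n :> R.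
Proof. by rewrite /sfact (factS n.+1) (factS n) -!natrM; congr _%:R; ring. Qed.

Lemma sfact0 : sfact 0 = 1 :> R.
Proof. by []. Qed.

Lemma big_antisym (F : nat -> nat -> R) m : (forall p q, F q p = - F p q) ->
  \sum_(p < m.+1) F p (m - p)%N = 0.
Proof.
move=> H; set S := \sum_(p < _) _.
have : S = - S.
  rewrite {1}/S (reindex_inj rev_ord_inj) /= -sumrN; apply: eq_bigr => p _.
  by rewrite subSS subKn -1?ltnS // H.
lra.
Qed.

(** Up to the sign (-1)^m, this compares coefficients of z^(m+1) in the Wronskian relation
    [near_wronskian]. It also makes the diagonal correction differentiable, see [rhoS1_at0]. *)
Lemma wronskian_sum m :
  \sum_(p < m.+1) (1 + p%:R * (hsum (m - p) - hsum p)) / (sfact p * sfact (m - p))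
  = (m.+1`!%:R ^+ 2)^-1 :> R.
Proof.
pose F p q := (hsum q - hsum p) / (sfact p * sfact q).
have FN p q : F q p = - F p q by rewrite /F mulrC [sfact q * _]mulrC mulrC -mulNr opprB.
pose S1 : R := \sum_(p < m.+1) p%:R * F p (m - p)%N.
pose S0 : R := \sum_(p < m.+1) (sfact p * sfact (m - p))^-1.
(* The sum of p (p + 1) F p (m - p) is computed twice: by symmetrizing p and m - p
   (E1), and by shifting p (E2). *)
have E1 : \sum_(p < m.+1) (p * p.+1)%:R * F p (m - p)%N = m.+1%:R * S1.
  pose G (p q : nat) : R := ((p * p.+1)%:R - p%:R * (p + q).+1%:R) * F p q.
  have GN p q : G q p = - G p q.
    by rewrite /G FN !natrM -!natr1 natrD; ring.
  have := big_antisym m GN.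
  rewrite /S1 mulr_sumr => /eqP; rewrite /G.
  under eq_bigr do rewrite mulrBl.
  rewrite sumrB subr_eq0 => /eqP ->; apply: eq_bigr => p _.
  by rewrite subnKC -1?ltnS // mulrA [_ * m.+1%:R]mulrC.
have E2 : \sum_(p < m.+1) (p * p.+1)%:R * F p (m - p)%N =
    - \sum_(p < m.+1) (2 * p + 1)%:R / (sfact p * sfact (m - p)) + (sfact m)^-1.
  rewrite !big_ord_recl /= mul0n mul0r add0r muln0 subn0 sfact0 mul1r div1r opprD addrAC addNr add0r.
  case: m {S1 S0 E1} => [|m]; first by rewrite !big_ord0 oppr0.
  have := big_antisym m FN => F0.
  rewrite -[LHS]subr0 -[X in _ - X = _]F0 -sumrB -sumrN; apply: eq_bigr => p _.
  rewrite /bump /= add1n subSS /F hsumS sfactS natrM.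
  have := sfact_neq0 p; have := sfact_neq0 (m - p).
  have : p.+1%:R != 0 :> R by rewrite pnatr_eq0.
  have : p.+2%:R != 0 :> R by rewrite pnatr_eq0.
  rewrite natrD natrM -(natr1 p.+1) -(natr1 p).
  by move=> h1 h2 h3 h4; field; rewrite !factr_neq0 h1 h2.
(* The weight is symmetric and p, m - p have mean m/2, so 2p + 1 may be replaced by m + 1. *)
have E3 : \sum_(p < m.+1) (2 * p + 1)%:R / (sfact p * sfact (m - p)) = m.+1%:R * S0.
  pose G (p q : nat) : R := ((2 * p + 1)%:R - (p + q).+1%:R) / (sfact p * sfact q).
  have GN p q : G q p = - G p q.
    by rewrite /G [sfact q * _]mulrC -mulNr; congr (_ / _); rewrite -[(q + p).+1]addn1 -[(p + q).+1]addn1 !natrD ?natrM; ring.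
  have := big_antisym m GN.
  rewrite /S0 mulr_sumr => /eqP; rewrite /G.
  under eq_bigr do rewrite mulrBl.
  rewrite sumrB subr_eq0 => /eqP ->; apply: eq_bigr => p _.
  by rewrite subnKC -1?ltnS.
rewrite [LHS](_ : _ = S0 + S1); last first.
  rewrite /S0 /S1 -big_split; apply: eq_bigr => p _ /=.
  by rewrite mulrDl div1r mulrA.
have m1 : m.+1%:R != 0 :> R by rewrite pnatr_eq0.
apply: (mulfI m1); rewrite mulrDr -E1 E2 E3 addrA subrr add0r.
rewrite /sfact factS !natrM; have : m`!%:R != 0 :> R by rewrite pnatr_eq0 -lt0n fact_gt0.
by rewrite -(natr1 m) in m1 * => h; field; rewrite h m1.
Qed.

End wronskian.

Section bessel_series.
Context {R : realType}.

Definition fj n k : R := (-1) ^+ k / (k`! * (n + k)`!)%:R.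
(** Euler's constant is left out of the digamma values; in [besselY_sqrt] it joins the logarithm as
    a multiple of [jf n]. *)
Definition fy n k : R := (harmonic_number k + harmonic_number (n + k)) * fj n k.

Lemma fj1E k : fj 1 k = (-1) ^+ k / sfact k.
Proof. by []. Qed.

Lemma fy1E k : fy 1 k = hsum k * fj 1 k.
Proof. by []. Qed.

Lemma harmonic_number_ge0 k : 0 <= harmonic_number k :> R.
Proof. by apply: sumr_ge0 => i _. Qed.

Lemma harmonic_number_le k : harmonic_number k <= k%:R :> R.
Proof.
elim: k => [|k IH]; first by rewrite harmonic_number0.
by rewrite harmonic_numberS -[leRHS]natr1; apply: lerD; rewrite ?invf_le1 ?ler1n ?ltr0n.
Qed.

Lemma fj_le1 n k : `|fj n k| <= 1.
Proof.
rewrite normrM normrX normrN1 expr1n mul1r normfV ger0_norm //.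
by rewrite invf_le1 ?ltr0n ?ler1n ?muln_gt0 ?fact_gt0.
Qed.

Lemma geo_fj n : geo_bounded (fj n).
Proof. by apply: (@geo_boundedW _ _ 1 1) => // k; rewrite expr1n mulr1 fj_le1. Qed.

Lemma geo_fy n : geo_bounded (fy n).
Proof.
apply: (@geo_boundedW _ _ 2 n.+2%:R) => // k.
rewrite normrM -[leRHS]mulr1; apply: ler_pM => //; last exact: fj_le1.
rewrite ger0_norm ?addr_ge0 ?harmonic_number_ge0 //.
apply: (le_trans (lerD (harmonic_number_le k) (harmonic_number_le _))).
rewrite -natrD -natrX -natrM ler_nat.
have : (k < 2 ^ k)%N by exact: ltn_expl.
by nia.
Qed.

Definition jf n z : R := limn (series (fun k => fj n k * z ^+ k)).
Definition yf n z : R := limn (series (fun k => fy n k * z ^+ k)).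

Lemma genfun_fj n : has_genfun 0 (fj n) (jf n).
Proof. exact: geo_genfun (geo_fj n). Qed.

Lemma genfun_fy n : has_genfun 0 (fy n) (yf n).
Proof. exact: geo_genfun (geo_fy n). Qed.

Lemma natrS_neq0 n : n%:R + 1 != 0 :> R.
Proof. by rewrite natr1 pnatr_eq0. Qed.

(** This is J_0 + J_2 = (2/x) J_1 at x = 2 sqrt z, read on coefficients. *)
Lemma fj0E k : fj 0 k = fj 1 k - shift_seq 1 (fj 2) k.
Proof.
rewrite /fj /shift_seq; case: k => [|k]; first by rewrite subr0.
rewrite /= subSS subn0 add0n !addSn add0n !factS !natrM exprS -!natr1.
have := factr_neq0 k; have := natrS_neq0 k; have := natrS_neq0 k.+1; rewrite -!natr1.
by move=> h1 h2 h3; field; rewrite h1 h2 h3.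
Qed.

(** The same recurrence for Y; the extra 1 is what the polar parts of Y_1 and Y_2 leave behind. *)
Lemma fy0E k : fy 0 k = fy 1 k - shift_seq 1 (fy 2) k - delta_seq 0 k.
Proof.
rewrite /fy /fj /shift_seq /delta_seq; case: k => [|k].
  rewrite /= harmonic_numberS harmonic_number0.
  by have -> : (0`! * (1 + 0)`!)%:R = 1 :> R by []; rewrite divr1 expr0 invr1; ring.
rewrite /= subSS subn0 add0n !addSn add0n !factS !natrM exprS !harmonic_numberS -!natr1.
have := factr_neq0 k; have := natrS_neq0 k; have := natrS_neq0 k.+1; rewrite -!natr1.
by move=> h1 h2 h3; field; rewrite h1 h2 h3.
Qed.

(** Multiplication by k is z d/dz, so this is the derivative rule (J_1/x)' = - J_2/x. *)
Lemma fj1_mul k : k%:R * fj 1 k = - shift_seq 1 (fj 2) k.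
Proof.
rewrite /fj /shift_seq; case: k => [|k]; first by rewrite mul0r oppr0.
rewrite /= subSS subn0 !addSn add0n !factS !natrM exprS -!natr1.
have := factr_neq0 k; have := natrS_neq0 k; have := natrS_neq0 k.+1; rewrite -!natr1.
by move=> h1 h2 h3; field; rewrite h1 h2 h3.
Qed.

(** The same rule for Y_1: differentiating the logarithm contributes [fj 1], and the polar parts
    contribute the constant. *)
Lemma fy1_mul k : k%:R * fy 1 k = fj 1 k - delta_seq 0 k - shift_seq 1 (fy 2) k.
Proof.
rewrite /fy /fj /shift_seq /delta_seq; case: k => [|k].
  by rewrite /=; have -> : (0`! * (1 + 0)`!)%:R = 1 :> R by []; rewrite divr1 expr0; ring.
rewrite /= subSS subn0 !addSn add0n !factS !natrM exprS !harmonic_numberS -!natr1.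
have := factr_neq0 k; have := natrS_neq0 k; have := natrS_neq0 k.+1; rewrite -!natr1.
by move=> h1 h2 h3; field; rewrite h1 h2 h3.
Qed.

Lemma near_jf0 : \forall z \near 0^'+, jf 0 z = jf 1 z - z * jf 2 z.
Proof.
have H := genfunB (genfun_fj 1) (genfun_shift 1 (genfun_fj 2)).
rewrite -(funext fj0E) in H.
apply: filterS2 H (genfun_fj 0) => z H1 H2; rewrite -[z * _]/(z ^+ 1 * _).
by rewrite -(cvg_lim (@Rhausdorff R) H1) -(cvg_lim (@Rhausdorff R) H2).
Qed.

Lemma near_yf0 : \forall z \near 0^'+, yf 0 z = yf 1 z - z * yf 2 z - 1.
Proof.
have H := genfunB (genfunB (genfun_fy 1) (genfun_shift 1 (genfun_fy 2))) genfun_delta0.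
rewrite -(funext fy0E) in H.
apply: filterS2 H (genfun_fy 0) => z H1 H2; rewrite -[z * _]/(z ^+ 1 * _).
by rewrite -(cvg_lim (@Rhausdorff R) H1) -(cvg_lim (@Rhausdorff R) H2).
Qed.

Lemma genfun_fj1_mul :
  has_genfun 0 (fun k => k%:R * fj 1 k) (fun z => - (z * jf 2 z)).
Proof.
apply: eq_genfun (genfunZ (-1) (genfun_shift 1 (genfun_fj 2))).
  by move=> k; rewrite add0n fj1_mul mulN1r.
by apply: nearW => z; rewrite mulN1r.
Qed.

Lemma genfun_fy1_mul :
  has_genfun 0 (fun k => k%:R * fy 1 k) (fun z => jf 1 z - 1 - z * yf 2 z).
Proof.
rewrite (funext fy1_mul).
exact: genfunB (genfunB (genfun_fj 1) genfun_delta0) (genfun_shift 1 (genfun_fy 2)).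
Qed.

(* The classical J_1 Y_2 - J_2 Y_1 with the logarithms and poles removed. *)
Lemma near_wronskian : \forall z \near 0^'+,
  1 = jf 0 z + z * jf 1 z + z ^+ 2 * (jf 1 z * yf 2 z - jf 2 z * yf 1 z).
Proof.
have Hj := genfun_fj1_mul; have Hy := genfun_fy1_mul.
have H := genfunD (genfunM (genfun_fj 1) (genfun_fj 1))
  (genfunB (genfunM Hj (genfun_fy 1)) (genfunM Hy (genfun_fj 1))).
have H0 := genfunB (genfun_delta0 (R := R)) (genfun_fj 0).
have E n : delta_seq 0 n - fj 0 n =
   shift_seq 1 (fun n => conv_seq (fj 1) (fj 1) n + (conv_seq (fun k => k%:R * fj 1 k) (fy 1) n -
        conv_seq (fun k => k%:R * fy 1 k) (fj 1) n)) n.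
  case: n => [|n]; first by rewrite /delta_seq /fj /shift_seq /= divr1 subrr.
  rewrite /delta_seq /shift_seq /= sub0r subSS subn0 /conv_seq -sumrB -big_split /=.
  rewrite (_ : - _ = (-1) ^+ n * (n.+1`!%:R ^+ 2)^-1); last first.
    by rewrite /fj exprS add0n natrM expr2 !mulN1r mulNr opprK.
  rewrite -wronskian_sum mulr_sumr; apply: eq_bigr => p _.
  have pn : (p <= n)%N by rewrite -ltnS.
  rewrite !fy1E !fj1E -[in (-1) ^+ n](subnKC pn) exprD.
  by field; rewrite !factr_neq0.
have H1 := genfun_shift 1 H; rewrite -(funext E) in H1.
apply: filterS2 H1 H0 => z H1 H2.
have := cvg_unique (@Rhausdorff R) H1 H2.
move=> h; have : jf 0 z + (1 - jf 0 z) = 1 by ring.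
by rewrite -h => <-; ring.
Qed.

End bessel_series.

(** * Cancellation of logarithms and square roots near 0 *)

Section bessel_near0.
Context {R : realType}.
Implicit Types (z : R).

Lemma besselJ_sqrt n z : 0 < z -> cvgn (series (fun k => fj n k * z ^+ k)) ->
  besselJ n (2 * Num.sqrt z) = Num.sqrt z ^+ n * jf n z.
Proof.
move=> z0 cj; rewrite /jf -[RHS]/(_ *: _) -lim_seriesZ //.
congr (limn (series _)); apply/funext => k.
have s2 : 2 * Num.sqrt z / 2 = Num.sqrt z by field.
rewrite fctE /= -[RHS]/(_ * _) /fj s2.
by rewrite exprD exprM sqr_sqrtr ?(ltW z0) //; ring.
Qed.

(** The logarithm and Euler's constant only enter as a multiple of [jf n z], which is what lets them
    cancel in G, H and D. The last sum is the polar part. *)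
Lemma besselY_sqrt n z : 0 < z -> cvgn (series (fun k => fj n k * z ^+ k)) ->
  cvgn (series (fun k => fy n k * z ^+ k)) ->
  pi * besselY n (2 * Num.sqrt z) =
  Num.sqrt z ^+ n * ((ln z + 2 * euler_gamma) * jf n z - yf n z)
  - \sum_(0 <= k < n) (n - k - 1)`!%:R / k`!%:R * z ^+ k / Num.sqrt z ^+ n.
Proof.
move=> z0 cj cy; rewrite /besselY besselJ_sqrt //.
have s2 : 2 * Num.sqrt z / 2 = Num.sqrt z by field.
have lz : ln z = 2 * ln (Num.sqrt z).
  by rewrite -{1}(sqr_sqrtr (ltW z0)) lnXn ?sqrtr_gt0 // mulr_natl.
rewrite !s2 [in RHS]lz.
have -> : limn (series (fun k => (digamma_succ k + digamma_succ (n + k)) *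
      ((-1) ^+ k / (k`! * (n + k)`!)%:R * Num.sqrt z ^+ (2 * k + n)))) =
    Num.sqrt z ^+ n * (yf n z - 2 * euler_gamma * jf n z).
  rewrite /yf /jf -[2 * _ * _]/(_ *: _) -lim_seriesZ // -lim_seriesB //; last first.
    exact: is_cvg_seriesZ.
  rewrite -[RHS]/(_ *: _) -lim_seriesZ; last first.
    by apply: is_cvg_seriesB => //; exact: is_cvg_seriesZ.
  congr (limn (series _)); apply/funext => k.
  rewrite !fctE /= -[RHS]/(_ * (_ - _ * _)) /fy /fj /digamma_succ.
  by rewrite exprD exprM sqr_sqrtr ?(ltW z0) //; ring.
have p0 : (pi : R) != 0 by rewrite gt_eqF // pi_gt0.
rewrite (eq_bigr (fun k => (n - k - 1)`!%:R / k`!%:R * z ^+ k / Num.sqrt z ^+ n)); last first.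
  by move=> k _; rewrite exprM sqr_sqrtr // ltW.
by set S := \sum_(_ <= _ < _) _; move: (pi : R) p0 => q q0; field.
Qed.

Lemma genfun_cvg u (f : R -> R) : has_genfun 0 u f ->
  \forall z \near (0:R)^'+, cvgn (series (fun k => u k * z ^+ k)).
Proof. by apply: filterS => z /cvgP. Qed.

Lemma near_sqrtM : \forall z \near (0:R)^'+, [/\ (0 : R) < z, z < 1, Num.sqrt z ^+ 2 = z & Num.sqrt z != 0].
Proof.
apply: filterS2 (nbhs_right_gt 0) (nbhs_right_lt ltr01) => z z0 z1; split => //.
  by rewrite sqr_sqrtr // ltW.
by rewrite gt_eqF // sqrtr_gt0.
Qed.

Lemma fj_head n : fj n 0 != 0 :> R.
Proof. by rewrite /fj expr0 mul1r invr_eq0 natrM mulf_neq0 ?factr_neq0. Qed.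

(** By [near_jf0] the bracket in the denominator of alpha is z sqrt z (jf 1 z - jf 2 z). This
    difference has constant term 1/2, so it can be inverted. *)
Definition fj12 k : R := fj 1 k - fj 2 k.

Lemma fj12_head : fj12 0 != 0.
Proof.
rewrite /fj12 /fj expr0 !div1r (_ : (0`! * (1 + 0)`!)%N = 1%N) //.
rewrite (_ : (0`! * (2 + 0)`!)%N = 2%N) // invr1.
by have -> : 1 - 2%:R^-1 = 2^-1 :> R by field.
Qed.

Lemma genfun_fj12 : has_genfun 0 fj12 (fun z => jf 1 z - jf 2 z).
Proof. exact: genfunB (genfun_fj 1) (genfun_fj 2). Qed.

Lemma near_S1 : \forall z \near (0:R)^'+, S1 z = 1 - 2 * jf 2 z.
Proof.
apply: filterS2 near_sqrtM (genfun_cvg (@genfun_fj R 2)) => z [z0 _ sz s0] c2.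
rewrite /S1 besselJ_sqrt // sz; field; exact: lt0r_neq0.
Qed.

Lemma near_S2 : \forall z \near (0:R)^'+, S2 z = 2 * (z - 1 + jf 0 z) / z.
Proof.
apply: filterS2 near_sqrtM (genfun_cvg (@genfun_fj R 0)) => z [z0 _ sz s0] c2.
by rewrite /S2 besselJ_sqrt // expr0 mul1r; field; exact: lt0r_neq0.
Qed.

Lemma near_genalpha :
  \forall z \near (0:R)^'+, genalpha z = z * (4^-1 * ((jf 2 z)^-1 * (jf 1 z - jf 2 z)^-1)).
Proof.
apply: filterS3 (filterI near_sqrtM (@near_jf0 R))
  (filterI (genfun_cvg (@genfun_fj R 0)) (genfun_cvg (@genfun_fj R 1)))
  (filterI (genfun_cvg (@genfun_fj R 2)) (filterI (near_genfun_neq0 (@genfun_fj R 2) (fj_head 2))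
    (near_genfun_neq0 genfun_fj12 fj12_head))).
move=> z [[z0 _ sz s0] ej0] [c0 c1] [c2 [n2 n12]].
rewrite /genalpha !besselJ_sqrt // sz expr0 expr1 mul1r ej0.
have zn : z != 0 by exact: lt0r_neq0.
rewrite [_ + _ * _](_ : _ = Num.sqrt z * (z * (jf 1 z - jf 2 z))); last by ring.
rewrite -[in z ^+ 4]sz.
rewrite [4 * _ * _ * _](_ : _ = 4 * (Num.sqrt z) ^+ 2 * z ^+2 * jf 2 z * (jf 1 z - jf 2 z)); last by ring.
rewrite !sz; field; by rewrite n12 n2 zn.
Qed.

(** The terms z + z^2 are the polar part (1 + z)/z of Y_2 after multiplication by the prefactor. *)
Lemma near_genG : \forall z \near (0:R)^'+, genG z =
  (2^-1 * (z ^+ 1 + z ^+ 2 + z ^+ 3 * yf 2 z) - 5 / 4 * (z ^+ 3 * jf 2 z)) * (jf 2 z)^-1.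
Proof.
apply: filterS3 near_sqrtM (genfun_cvg (@genfun_fy R 2))
  (filterI (genfun_cvg (@genfun_fj R 2)) (near_genfun_neq0 (@genfun_fj R 2) (fj_head 2))).
move=> z [z0 _ sz s0] y2 [c2 n2].
have zn : z != 0 by exact: lt0r_neq0.
rewrite /genG -[2 * pi * _]mulrA mulrA -[_ * (_ / _)]mulrA [pi * _]mulrA besselY_sqrt // besselJ_sqrt // sz.
rewrite !big_nat_recr //= big_geq // add0r !factS fact0 /= !expr0 expr1 !mul1n.
by field; rewrite n2 zn.
Qed.

Lemma near_genH : \forall z \near (0:R)^'+, genH z =
  z ^+ 2 * (2^-1 * (3 * z ^+ 1 - 3 * 1 - 2 * yf 0 z + 5 * jf 0 z)) * (1 - z ^+ 1)^-1.
Proof.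
apply: filterS3 near_sqrtM (genfun_cvg (@genfun_fy R 0)) (genfun_cvg (@genfun_fj R 0)).
move=> z [z0 z1 sz s0] y2 c2.
have zn : 1 - z != 0 by rewrite subr_eq0 gt_eqF.
rewrite /genH -[2 * pi * _]mulrA besselY_sqrt // besselJ_sqrt //.
by rewrite big_geq // expr0; field.
Qed.

(** Hence d_q has the closed form [fy 1 q], that is, (-1)^q [hsum q] / (q)^!. *)
Lemma near_genD : \forall z \near (0:R)^'+, genD z = yf 1 z.
Proof.
apply: filterS3 near_sqrtM (genfun_cvg (@genfun_fy R 1)) (genfun_cvg (@genfun_fj R 1)).
move=> z [z0 z1 sz s0] y2 c2.
have zn : z != 0 by exact: lt0r_neq0.
rewrite /genD [pi * _]mulrC -[_ * pi * _]mulrA besselY_sqrt // besselJ_sqrt //.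
rewrite !big_nat_recr //= big_geq // add0r (_ : (1 - 0 - 1)`! = 1%N) // ?fact0 !expr0 expr1.
rewrite [in RHS](_ : yf 1 z = z^-1 * (Num.sqrt z ^+ 2 * yf 1 z)); last by rewrite sz; field.
by field; rewrite zn s0.
Qed.

Lemma genfun_genD : has_genfun 0 (fy 1) (@genD R).
Proof.
by apply: eq_genfun (@genfun_fy R 1) => //; apply: filterS near_genD => z ->.
Qed.

End bessel_near0.

(** * Coefficients of the kernel *)

Section coefficients.
Context {R : realType}.
Implicit Types (z : R).

Definition genS z : R := S2 z / (1 - z).

Lemma genfun_inv1X : has_genfun 0 (inv_seq (fun n => delta_seq 0 n - delta_seq 1 n : R))
  (fun z => (1 - z ^+ 1)^-1).
Proof.
apply: genfunV; first exact: genfunB genfun_delta0 (genfun_delta 1).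
by rewrite /delta_seq /= subr0 oner_neq0.
Qed.

(** The numerator of S^2 vanishes at 0, which removes its factor 1/z; its coefficient of z vanishes
    as well, whence the zero constant term. *)
Lemma genS_series : exists2 s : nat -> R, s 0 = 0 & has_genfun 0 s genS.
Proof.
pose u n : R := 2 * (delta_seq 1 n - delta_seq 0 n + fj 0 n).
have Hu : has_genfun 0 u (fun z => 2 * (z ^+ 1 - 1 + jf 0 z)).
  exact: genfunZ (genfunD (genfunB (genfun_delta 1) genfun_delta0) (genfun_fj 0)).
have u0 : u 0 = 0.
  by rewrite /u /delta_seq /fj /= expr0 divr1 sub0r addNr mulr0.
have H := genfunM (genfun_tail Hu u0) genfun_inv1X.
exists (conv_seq (fun n => u n.+1) (inv_seq (fun n => delta_seq 0 n - delta_seq 1 n))).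
  rewrite /conv_seq big_ord1 /u /fj /delta_seq /= subr0.
  by rewrite expr1 (_ : (1`! * (0 + 1)`!)%N = 1%N) // divr1 subrr mulr0 mul0r.
apply: eq_genfun H => //.
apply: filterS (@near_S2 R) => z; rewrite /genS => ->.
by rewrite [_^-1 * _]mulrC.
Qed.

Lemma genalpha_series : exists2 u : nat -> R, u 0 = 0 & has_genfun 0 u genalpha.
Proof.
have H := genfun_shift 1 (genfunZ 4^-1 (genfunM (genfunV (genfun_fj 2) (@fj_head R 2))
  (genfunV (@genfun_fj12 R) (@fj12_head R)))).
eexists; last first.
  by apply: eq_genfun H => //; apply: filterS (@near_genalpha R) => z ->; rewrite expr1.
by [].
Qed.

Lemma genG_series : exists2 u : nat -> R, u 0 = 0 & has_genfun 0 u genG.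
Proof.
have H := genfunM (genfunB (genfunZ 2^-1 (genfunD (genfunD (genfun_delta 1) (genfun_delta 2))
  (genfun_shift 3 (genfun_fy 2)))) (genfunZ (5 / 4) (genfun_shift 3 (genfun_fj 2))))
  (genfunV (genfun_fj 2) (@fj_head R 2)).
eexists; last first.
  by apply: eq_genfun H => //; apply: filterS (@near_genG R) => z ->.
by rewrite /conv_seq big_ord1 /delta_seq /shift_seq /= !addr0 !mulr0 subr0 mul0r.
Qed.

Lemma genH_series : exists2 u : nat -> R, u 0 = 0 & has_genfun 0 u genH.
Proof.
have H := genfunM (genfun_shift 2 (genfunZ 2^-1 (genfunD (genfunB (genfunB (genfunZ 3 (genfun_delta 1))
  (genfunZ 3 genfun_delta0)) (genfunZ 2 (genfun_fy 0))) (genfunZ 5 (genfun_fj 0))))) genfun_inv1X.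
eexists; last first.
  by apply: eq_genfun H => //; apply: filterS (@near_genH R) => z ->.
by rewrite /conv_seq big_ord1 /shift_seq /= mul0r.
Qed.

(* [al], [g], [et], [s] below are the coefficients of alpha, G, H and
   S^2 / (1 - z); [kappa p] is the factor of A_{1,q} in A_{p,q}. *)
Definition kappa p : R := 2 * (-1) ^+ p.-1 / sfact p.

Definition eps_sum p : R := \sum_(2 <= k < p.+1) ((2 * k + 1)%:R / (k * k.+1)%:R).

(** Each term is 1/k + 1/(k+1), an increment of [hsum], and [hsum 1] is 5/2. *)
Lemma eps_sumE p : (0 < p)%N -> eps_sum p = hsum p - 5 / 2.
Proof.
elim: p => // -[_ _|p IH _].
  by rewrite /eps_sum big_geq // /hsum !harmonic_numberS harmonic_number0; field.
rewrite /eps_sum big_nat_recr //= -/(eps_sum p.+1) IH // (hsumS p.+1) natrD !natrM.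
have h1 : p.+2%:R != 0 :> R by rewrite pnatr_eq0.
have h2 : p.+3%:R != 0 :> R by rewrite pnatr_eq0.
rewrite -(natr1 p.+2) in h2 *; move: (p.+2%:R : R) h1 h2 => x h1 h2.
by field; rewrite h1 h2.
Qed.

(** Near 0 all functions involved become rational in z, j1, j2, y2; the Wronskian eliminates y1.
    Each identity between generating functions is then settled by [field]. *)
Lemma near_base : \forall z \near (0:R)^'+, exists a j1 j2 y1 y2 : R,
  [/\ [/\ z != 0, 1 - z != 0, j2 != 0 & j1 - j2 != 0],
      [/\ jf 1 z = j1, jf 2 z = j2, yf 1 z = y1 & yf 2 z = y2],
      y1 = (j1 - z * j2 + z * j1 + z ^+ 2 * (j1 * y2) - 1) / (z ^+ 2 * j2),
      [/\ genalpha z = z / (4 * j2 * (j1 - j2)),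
        genG z = (2 * (z + z ^+ 2 + z ^+ 3 * y2) - 5 * z ^+ 3 * j2) / (4 * j2) &
        genH z = z ^+ 2 * (3 * z - 3 - 2 * (y1 - z * y2 - 1) + 5 * (j1 - z * j2)) / (2 * (1 - z))] &
      [/\ S1 z = 1 - 2 * j2 & genS z = 2 * (z - 1 + (j1 - z * j2)) / (z * (1 - z))]].
Proof.
apply: filterS3 (filterI (filterI (@near_sqrtM R) (filterI (@near_genalpha R) (@near_genG R)))
    (filterI (@near_genH R) (filterI (@near_S1 R) (@near_S2 R))))
  (filterI (@near_jf0 R) (filterI (@near_yf0 R) (@near_wronskian R)))
  (filterI (near_genfun_neq0 (genfun_fj 2) (@fj_head R 2))
    (near_genfun_neq0 (@genfun_fj12 R) (@fj12_head R))).
move=> z [[[z0 z1 _ _] [ea eg]] [eh [e1 e2]]] [ej0 [ey0 ew]] [n2 n12].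
have zn : z != 0 by exact: lt0r_neq0.
have z1n : 1 - z != 0 by rewrite subr_eq0 gt_eqF.
exists 0, (jf 1 z), (jf 2 z), (yf 1 z), (yf 2 z); split=> //.
- rewrite ej0 in ew; rewrite [in X in X / _](_ : _ - 1 = z ^+ 2 * (jf 2 z * yf 1 z)).
    by field; rewrite n2 zn.
  by rewrite [X in _ - X]ew; ring.
- rewrite ea eg eh ey0 ej0 expr1; split; field; rewrite ?n2 ?n12 ?zn ?z1n //.
- by rewrite /genS e1 e2 ej0; split => //; field; rewrite zn z1n.
Qed.

Variables al g et s : nat -> R.
Hypotheses (al0 : al 0 = 0) (g0 : g 0 = 0) (et0 : et 0 = 0) (s0 : s 0 = 0).
Hypotheses (Hal : has_genfun 0 al genalpha) (Hg : has_genfun 0 g genG)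
  (Het : has_genfun 0 et genH) (Hs : has_genfun 0 s genS).

Definition be n : R := g n - al n.

(* [cA p] and [cB p] are the coefficients of A_{p,q} and B_{p,q} with the factor
   (-z)^q / (q)^!, common to all terms, removed. *)
Definition cA p n : R :=
  if p is p'.+1 then shift_seq p' (fun k => kappa p * al k) n else conv_seq s al n.

(** The extra term of B_{p,q}, stripped of the common factor, is [e0 p] z^(p+2). *)
Definition e0 k : R := (-1) ^+ k / sfact k * eps_sum k.

Definition cB p n : R :=
  if p is p'.+1 then shift_seq p' (fun k => kappa p * be k) n
                     + shift_seq 2 (fun k => (k == p)%:R * e0 p) n
  else conv_seq s be n + et n.

(* The constants c of the differential equations below, with their index raised by
   one: [seqP] for starting points t <= 0, [seqM] for t >= 0. *)
Definition seqP n : R := cA 1 n + 2^-1 * shift_seq 1 (cA 0) n.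
Definition seqM n : R := cB 1 n + 2^-1 * shift_seq 1 (cB 0) n + 3 / 4 * delta_seq 3 n.

Lemma kappa1 : kappa 1 = 1.
Proof. by rewrite /kappa /sfact /= expr0 mulr1 divff // pnatr_eq0. Qed.

Lemma eps_sum0 : eps_sum 0 = 0. Proof. by rewrite /eps_sum big_geq. Qed.
Lemma eps_sum1 : eps_sum 1 = 0. Proof. by rewrite /eps_sum big_geq. Qed.

Lemma be0 : be 0 = 0. Proof. by rewrite /be g0 al0 subr0. Qed.

Lemma cA_gt p n : (n < p)%N -> cA p n = 0.
Proof.
case: p => // p; rewrite ltnS /= /shift_seq => np; case: leqP => // pn.
by rewrite (_ : n - p = 0)%N ?al0 ?mulr0 //; lia.
Qed.

Lemma cA00 : cA 0 0 = 0.
Proof. by rewrite /= /conv_seq big_ord1 s0 mul0r. Qed.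

Lemma cB_gt p n : (n < p)%N -> cB p n = 0.
Proof.
case: p => // p; rewrite ltnS /= /shift_seq => np.
rewrite (_ : (if (2 <= n)%N then _ else _) = 0) ?addr0.
  case: leqP => // pn.
  by rewrite (_ : n - p = 0)%N ?be0 ?mulr0 //; lia.
case: ifP => // n2; case: eqVneq => [|_]; [lia|by rewrite mul0r].
Qed.

Lemma cB00 : cB 0 0 = 0.
Proof. by rewrite /= /conv_seq big_ord1 s0 mul0r add0r et0. Qed.

Lemma genfun_be : has_genfun 0 be (fun z => genG z - genalpha z).
Proof. exact: genfunB. Qed.

Definition genAs p z : R :=
  if p is p'.+1 then z ^+ p' * (kappa p * genalpha z) else genS z * genalpha z.
Definition genBs p z : R :=
  if p is p'.+1 then z ^+ p' * (kappa p * (genG z - genalpha z)) + z ^+ 2 * (e0 p * z ^+ p)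
  else genS z * (genG z - genalpha z) + genH z.

Lemma genfun_cA p : has_genfun 0 (cA p) (genAs p).
Proof. case: p => [|p]; [exact: genfunM|exact: genfun_shift (genfunZ _ Hal)]. Qed.

Lemma genfun_cB p : has_genfun 0 (cB p) (genBs p).
Proof.
case: p => [|p]; first exact: genfunD (genfunM Hs genfun_be) Het.
apply: genfunD (genfun_shift _ (genfunZ _ genfun_be)) _.
apply: genfun_shift; apply: eq_genfun (genfunZ (e0 p.+1) (genfun_delta p.+1)) => [k|].
  by rewrite /delta_seq mulrC.
exact: nearW.
Qed.

Definition genP z : R := genAs 1 z + 2^-1 * (z ^+ 1 * genAs 0 z).
Definition genM z : R := genBs 1 z + 2^-1 * (z ^+ 1 * genBs 0 z) + 3 / 4 * z ^+ 3.

Lemma genfun_seqP : has_genfun 0 seqP genP.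
Proof. exact: genfunD (genfun_cA 1) (genfunZ _ (genfun_shift 1 (genfun_cA 0))). Qed.

Lemma genfun_seqM : has_genfun 0 seqM genM.
Proof.
apply: genfunD (genfunZ _ (genfun_delta 3)).
exact: genfunD (genfun_cB 1) (genfunZ _ (genfun_shift 1 (genfun_cB 0))).
Qed.

(** The factors kappa of all p >= 1, indexed from 0, so that summing A_{p,q} over p becomes a Cauchy
    product. *)
Definition ksum k : R := kappa k.+1.

Lemma genfun_ksum : has_genfun 0 ksum (fun z => z^-1 * (2 * (1 - jf 1 z))).
Proof.
have H := genfunZ 2 (genfunB (genfun_delta0 (R := R)) (genfun_fj 1)).
have := genfun_tail H; rewrite /= /delta_seq fj1E /= expr0 divr1 subrr mulr0 => /(_ erefl).
apply: eq_genfun => [k|]; last exact: nearW.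
by rewrite add0n /ksum /kappa sub0r /= fj1E exprS; ring.
Qed.

Lemma ksum_mul k : k.+1%:R * ksum k = 2 * fj 2 k.
Proof.
rewrite /ksum /kappa /fj /sfact /= addSn add1n (factS k).
have h1 : k.+1%:R != 0 :> R by rewrite pnatr_eq0.
by rewrite !natrM; field; rewrite !factr_neq0 nat1r -natrD !pnatr_eq0.
Qed.

(** The only term of the convolution absent on the left is the last one, which contains u 0. *)
Lemma sum_shift_conv (k u : nat -> R) n : u 0 = 0 ->
  \sum_(p < n) shift_seq p (fun i => k p * u i) n = conv_seq k u n.
Proof.
move=> u0; rewrite /conv_seq big_ord_recr /= subnn u0 mulr0 addr0.
by apply: eq_bigr => p _; rewrite /shift_seq ltnW.
Qed.

Lemma sum_shift_delta (e : nat -> R) n : e 0 = 0 ->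
  \sum_(p < n) shift_seq 2 (fun k => (k == p.+1)%:R * e p.+1) n = shift_seq 2 e n.
Proof.
move=> e00; rewrite /shift_seq; case: ifP => [n2|_]; last by rewrite big1.
case: (posnP (n - 2)%N) => [->|n3].
  by rewrite big1 // => i _; rewrite mul0r.
have n3' : ((n - 2).-1 < n)%N by lia.
rewrite (bigD1 (Ordinal n3')) //= prednK // eqxx mul1r big1 ?addr0 // => i.
move=> /eqP ni; case: eqVneq => [E|_]; last by rewrite mul0r.
by case: ni; apply/val_inj => /=; rewrite E.
Qed.

(** The 3/2 repairs the index 0, where [eps_sum] is 0 but [hsum 0 - 5/2] is -3/2. *)
Lemma genfun_e0 : has_genfun 0 e0 (fun z => yf 1 z - 5 / 2 * jf 1 z + 3 / 2 * 1).
Proof.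
have H := genfunD (genfunB (genfun_fy 1) (genfunZ (5 / 2) (genfun_fj 1)))
  (genfunZ (3 / 2) (genfun_delta0 (R := R))).
apply: eq_genfun H => [k|]; last exact: nearW.
rewrite add0n /e0 fy1E fj1E /delta_seq; case: k => [|k].
  rewrite eps_sum0 /hsum harmonic_numberS harmonic_number0 /sfact /= expr0 invr1 mulr1n; by field.
by rewrite eps_sumE // mulr0 addr0; ring.
Qed.

Lemma genfun_e0_mul : has_genfun 0 (fun k => k%:R * e0 k)
  (fun z => jf 1 z - 1 - z * yf 2 z - 5 / 2 * (- (z * jf 2 z))).
Proof.
have H := genfunB (@genfun_fy1_mul R) (genfunZ (5 / 2) (@genfun_fj1_mul R)).
apply: eq_genfun H => [k|]; last exact: nearW.
rewrite add0n /e0 fy1E fj1E; case: k => [|k]; first by rewrite !mul0r mulr0 subr0.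
by rewrite eps_sumE //; ring.
Qed.

Lemma e00 : e0 0 = 0. Proof. by rewrite /e0 eps_sum0 mulr0. Qed.

Lemma sum_cAE n : \sum_(p < n.+1) cA p n = conv_seq s al n + conv_seq ksum al n.
Proof. by rewrite big_ord_recl -(sum_shift_conv ksum). Qed.

Lemma sum_mul_cAE n : \sum_(p < n.+1) p%:R * cA p n = conv_seq (fun k => 2 * fj 2 k) al n.
Proof.
rewrite big_ord_recl /= mul0r add0r -(sum_shift_conv (fun k => 2 * fj 2 k)) //; apply: eq_bigr => p _.
rewrite /= /shift_seq; case: ifP => _; last by rewrite mulr0.
by rewrite mulrA /bump /= add1n -/(ksum p) ksum_mul.
Qed.

Lemma sum_cBE n : \sum_(p < n.+1) cB p n =
  conv_seq s be n + et n + conv_seq ksum be n + shift_seq 2 e0 n.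
Proof.
rewrite big_ord_recl -(sum_shift_conv ksum) ?be0 // -sum_shift_delta ?e00 //.
by rewrite -[RHS]addrA -big_split.
Qed.

Lemma sum_mul_cBE n : \sum_(p < n.+1) p%:R * cB p n =
  conv_seq (fun k => 2 * fj 2 k) be n + shift_seq 2 (fun k => k%:R * e0 k) n.
Proof.
rewrite big_ord_recl /= mul0r add0r -(sum_shift_conv (fun k => 2 * fj 2 k)) ?be0 //.
rewrite -(@sum_shift_delta (fun k => k%:R * e0 k)) ?mul0r // -big_split; apply: eq_bigr => p _.
rewrite /= mulrDr /bump /= add1n; congr (_ + _).
  rewrite /shift_seq; case: ifP => _; last by rewrite mulr0.
  by rewrite mulrA -/(ksum p) ksum_mul.
by rewrite /shift_seq; case: ifP => _; rewrite ?mulr0 // mulrCA.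
Qed.

(** In the one-step integral of the candidate kernel, the half-line formulas leave, besides the next
    kernel at t, a constant and a multiple of e^{-|t|}, on each side of 0. These four quantities
    vanish precisely if both pieces take the value [seqP + seqM] at 0 and have derivatives of
    opposite sign, [seqP - seqM] for the piece t >= 0. The sums here and in the next three lemmas
    are these values and derivatives, up to sign. *)
Lemma matching_A n : \sum_(p < n.+1) cA p n = seqP n + seqM n.
Proof.
rewrite sum_cAE; apply: (genfun_uniq (genfunD (genfunM Hs Hal) (genfunM genfun_ksum Hal))
  (genfunD genfun_seqP genfun_seqM)).
apply: filterS near_base => z [_ [j1 [j2 [y1 [y2 [[nz nz1 nj nj12] [-> _ _ _] ey [ea eg eh] [_ es]]]]]]].
rewrite /genP /genM /= kappa1 /e0 eps_sum1 ea eg eh es ey.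
by field; rewrite ?nz ?nz1 ?nj ?nj12 ?factr_neq0.
Qed.

Lemma matching_A' n : \sum_(p < n.+1) p%:R * cA p n = seqP n - seqM n.
Proof.
rewrite sum_mul_cAE; apply: (genfun_uniq (genfunM (genfunZ 2 (genfun_fj 2)) Hal)
  (genfunB genfun_seqP genfun_seqM)).
apply: filterS near_base => z [_ [j1 [j2 [y1 [y2 [[nz nz1 nj nj12] [_ -> _ _] ey [ea eg eh] [_ es]]]]]]].
rewrite /genP /genM /= kappa1 /e0 eps_sum1 ea eg eh es ey.
by field; rewrite ?nz ?nz1 ?nj ?nj12 ?factr_neq0.
Qed.

(** The isolated [delta_seq 1] is the value at 0 of the exponential e^x in [phip]. *)
Lemma matching_B n : delta_seq 1 n + \sum_(p < n.+1) cB p n = seqP n + seqM n.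
Proof.
rewrite sum_cBE; apply: (genfun_uniq
  (genfunD (genfun_delta 1) (genfunD (genfunD (genfunD (genfunM Hs genfun_be) Het)
     (genfunM genfun_ksum genfun_be)) (genfun_shift 2 genfun_e0)))
  (genfunD genfun_seqP genfun_seqM)).
apply: filterS near_base => z [_ [j1 [j2 [y1 [y2 [[nz nz1 nj nj12] [-> _ -> _] ey [ea eg eh] [_ es]]]]]]].
rewrite /genP /genM /= kappa1 /e0 eps_sum1 ea eg eh es ey.
by field; rewrite ?nz ?nz1 ?nj ?nj12 ?factr_neq0.
Qed.

(** The term [shift_seq 2 (fj 1)] is the slope at 0 of the linear-times-exponential term of
    [phip]. *)
Lemma matching_B' n : delta_seq 1 n + shift_seq 2 (fj 1) n
   - \sum_(p < n.+1) p%:R * cB p n = seqP n - seqM n.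
Proof.
rewrite sum_mul_cBE; apply: (genfun_uniq
  (genfunB (genfunD (genfun_delta 1) (genfun_shift 2 (genfun_fj 1)))
     (genfunD (genfunM (genfunZ 2 (genfun_fj 2)) genfun_be) (genfun_shift 2 genfun_e0_mul)))
  (genfunB genfun_seqP genfun_seqM)).
apply: filterS near_base => z [_ [j1 [j2 [y1 [y2 [[nz nz1 nj nj12] [-> -> _ ->] ey [ea eg eh] [_ es]]]]]]].
rewrite /genP /genM /= kappa1 /e0 eps_sum1 ea eg eh es ey.
by field; rewrite ?nz ?nz1 ?nj ?nj12 ?factr_neq0.
Qed.

End coefficients.

(** * The coefficients a, b, c and their uniqueness *)

Section kernel_coefs.
Context {R : realType}.
Variables al g et s : nat -> R.
Hypotheses (al0 : al 0 = 0) (g0 : g 0 = 0) (et0 : et 0 = 0) (s0 : s 0 = 0).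
Hypotheses (Hal : has_genfun 0 al genalpha) (Hg : has_genfun 0 g genG)
  (Het : has_genfun 0 et genH) (Hs : has_genfun 0 s (@genS R)).

Definition wq q : R := (-1) ^+ q / sfact q.

Definition ca n p q : R := shift_seq q (fun k => wq q * cA al s p k) n.
Definition cb n p q : R := shift_seq q (fun k => wq q * cB al g et s p k) n.
(* C_{p,q} - B_{p,q} is a single monomial. *)
Definition cdiff p q : R := (-1) ^+ (p + q) * (hsum q - hsum p) / (sfact p * sfact q).
Definition cc n p q : R := cb n p q + cdiff p q * delta_seq (p + q + 2) n.

Lemma exprNz q (z : R) : (- z) ^+ q = (-1) ^+ q * z ^+ q.
Proof. exact: exprNn. Qed.

Lemma genfun_ca p q : has_genfun 0 (fun n => ca n p q) (genA p q).
Proof.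
apply: eq_genfun (genfun_shift q (genfunZ (wq q) (genfun_cA Hal Hs p))) => //.
apply: nearW => z; rewrite /wq /genA /genA1.
case: p => [|[|p]]; rewrite /genAs ?kappa1 /kappa /= !(exprNz _ z).
- rewrite /genS; set x := (1 - z)^-1; field; by rewrite ?factr_neq0.
- field; by rewrite ?factr_neq0.
- rewrite exprS; field; by rewrite ?factr_neq0.
Qed.

Lemma genfun_cb p q : has_genfun 0 (fun n => cb n p q) (genB p q).
Proof.
apply: eq_genfun (genfun_shift q (genfunZ (wq q) (genfun_cB Hal Hg Het Hs p))) => //.
apply: nearW => z; rewrite /wq /genB /genB1 /genA1.
case: p => [|[|p]]; rewrite /genBs ?kappa1 /kappa /e0 ?eps_sum1 /= !(exprNz _ z).
- rewrite /genS; move: ((1 - z)^-1) (genG z) (genH z) (genalpha z) (S2 z) => x G0 H0 A0 S0.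
  by field; rewrite ?factr_neq0.
- rewrite expr0; move: (genG z) (genalpha z) => G0 A0.
  by field; rewrite ?factr_neq0.
- rewrite -/(eps_sum p.+2) !exprD !exprS; move: (genG z) (genalpha z) (eps_sum p.+2) => G0 A0 e.
  by field; rewrite ?factr_neq0.
Qed.

Lemma genfun_cc dq p q : has_genfun 0 dq genD -> has_genfun 0 (fun n => cc n p q) (genC dq p q).
Proof.
move=> Hd; have {Hd} dE k : dq k = fy 1 k.
  by apply: (genfun_uniq Hd (@genfun_genD R)); exact: nearW.
apply: eq_genfun (genfunD (genfun_cb p q) (genfunZ (cdiff p q) (genfun_delta (p + q + 2)))) => //.
(* With d_q = [fy 1 q] the two monomials defining C_{0,q} - B_{0,q} combine into [hsum q - hsum 0],
   since [hsum 0] is 1. *)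
have d0 : genC0 dq q = fun z => genB 0 q z + cdiff 0 q * z ^+ (0 + q + 2).
  apply/funext => z; rewrite /genC0 dE /cdiff fy1E fj1E !add0n sfact0 exprNz exprD.
  have -> : hsum 0 = 1 :> R by rewrite /hsum harmonic_numberS harmonic_number0 invr1 !add0r.
  move: (genB 0 q z) (hsum q) => B h; rewrite !exprD.
  by field; rewrite !factr_neq0.
(* For p = 1 the claim is a genuine identity between Bessel functions and needs the eliminated form
   of [near_base]. *)
have d1 : \forall z \near 0^'+, genC1 dq q z = genB 1 q z + cdiff 1 q * z ^+ (1 + q + 2).
  apply: filterS (@near_base R) => z
    [_ [j1 [j2 [y1 [y2 [[nz nz1 nj nj12] [E1 E2 E3 E4] ey [ea eg eh] [e1 es]]]]]]].
  have es' : S2 z = genS z * (1 - z) by rewrite /genS -mulrA mulVf ?mulr1.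
  rewrite /genC1 d0 /genB /genB1 /genA1 es' e1 eg eh es ea ey /cdiff !(exprNz _ z) !exprD.
  have -> : hsum 1 = 5 / 2 :> R.
    by rewrite /hsum !harmonic_numberS harmonic_number0 invr1 !add0r; field.
  have -> : hsum 0 = 1 :> R by rewrite /hsum harmonic_numberS harmonic_number0 invr1 !add0r.
  rewrite (_ : sfact 1 = 2) // sfact0.
  by field; rewrite ?nz ?nz1 ?nj ?nj12 ?factr_neq0.
case: p => [|[|p]].
- by apply: nearW => z; rewrite /genC d0.
- by apply: filterS d1 => z d1; rewrite /genC d1.
(* For p >= 2 both sides are multiples of the case p = 1 up to monomials; the sum in B_{p,q} changes
   [hsum 1] into [hsum p]. *)
apply: filterS d1 => z d1; rewrite /genC d1 /genB /genB1 -/(eps_sum p.+2) eps_sumE //.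
rewrite /cdiff (_ : sfact 1 = 2) // !(exprNz _ z).
have -> : hsum 1 = 5 / 2 :> R.
  by rewrite /hsum !harmonic_numberS harmonic_number0 invr1 !add0r; field.
rewrite /= !exprD !exprS; field; by rewrite ?factr_neq0.
Qed.

Lemma ca0 p q : ca 0 p q = 0.
Proof.
rewrite /ca /shift_seq; case: ifP => // q0; rewrite sub0n.
by case: p => [|p]; rewrite ?cA00 ?cA_gt ?mulr0.
Qed.

Lemma cb0 p q : cb 0 p q = 0.
Proof.
rewrite /cb /shift_seq; case: ifP => // q0; rewrite sub0n.
by case: p => [|p]; rewrite ?cB00 ?cB_gt ?mulr0.
Qed.

Lemma cc0 p q : cc 0 p q = 0.
Proof. by rewrite /cc cb0 add0r /delta_seq addn2 mulr0. Qed.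

(** A generating function from index 1 says nothing about u 0, so this value is reset to 0 and the
    conclusion is limited to n > 0. *)
Lemma genfun1_uniq (u v : nat -> R) f : has_genfun 1 u f -> has_genfun 0 v f ->
  v 0 = 0 -> forall n, (0 < n)%N -> u n = v n.
Proof.
move=> Hu Hv v0 n n0; pose w k := if k is 0%N then 0 else u k.
have Hw : has_genfun 0 w f.
  by apply/genfun1 => //; apply: eq_genfun Hu => //; exact: nearW.
by rewrite -(genfun_uniq Hw Hv) ?/w; [case: n n0|exact: nearW].
Qed.

Lemma kernel_coefficients_exist :
  kernel_coefficients ca cb cc (fy 1).
Proof.
split; last exact: genfun_genD.
- by move=> p q; apply/genfun1; [exact: ca0|exact: genfun_ca].
- by move=> p q; apply/genfun1; [exact: cb0|exact: genfun_cb].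
- by move=> p q; apply/genfun1; [exact: cc0|apply: genfun_cc; exact: genfun_genD].
Qed.

Lemma kernel_coefficients_uniq a b c dq : kernel_coefficients a b c dq ->
  forall n p q, (0 < n)%N ->
    [/\ a n p q = ca n p q, b n p q = cb n p q & c n p q = cc n p q].
Proof.
move=> [Ha Hb Hc Hd] n p q n0; split.
- exact: (genfun1_uniq (Ha p q) (genfun_ca p q) (ca0 p q)).
- exact: (genfun1_uniq (Hb p q) (genfun_cb p q) (cb0 p q)).
- exact: (genfun1_uniq (Hc p q) (genfun_cc p q Hd) (cc0 p q)).
Qed.

End kernel_coefs.

(** * Half-line integrals against the one-step density *)

Section derivatives.
Context {R : realType}.
Implicit Types (f g : R -> R) (x a b c : R).

Lemma isd_eq f x a b : is_derive x (1 : R) f a -> a = b -> is_derive x (1 : R) f b.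
Proof. by move=> H <-. Qed.

Lemma isdD f g x a b : is_derive x (1 : R) f a -> is_derive x (1 : R) g b ->
  is_derive x (1 : R) (fun y => f y + g y) (a + b).
Proof. exact: is_deriveD. Qed.

Lemma isdB f g x a b : is_derive x (1 : R) f a -> is_derive x (1 : R) g b ->
  is_derive x (1 : R) (fun y => f y - g y) (a - b).
Proof. exact: is_deriveB. Qed.

Lemma isdM f g x a b : is_derive x (1 : R) f a -> is_derive x (1 : R) g b ->
  is_derive x (1 : R) (fun y => f y * g y) (a * g x + f x * b).
Proof.
move=> Hf Hg; apply: isd_eq (is_deriveM Hf Hg) _.
by rewrite -!/(_ * _) addrC; congr (_ + _); exact: mulrC.
Qed.

Lemma isd_id x : is_derive x (1 : R) (fun y : R => y) 1.
Proof. exact: is_derive_id. Qed.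

Lemma isd_cst c x : is_derive x (1 : R) (fun y : R => c) 0.
Proof. exact: is_derive_cst. Qed.

Lemma isdZ c f x a : is_derive x (1 : R) f a ->
  is_derive x (1 : R) (fun y => c * f y) (c * a).
Proof. by move=> H; apply: isd_eq (isdM (isd_cst c x) H) _; rewrite mul0r add0r. Qed.

Lemma isd_exp c x : is_derive x (1 : R) (fun y => expR (c * y)) (c * expR (c * x)).
Proof.
have H := @is_derive1_comp _ expR (fun y => c * y) x _ _ (is_derive_expR (c * x)) (isdZ c (isd_id x)).
by apply: isd_eq H _; rewrite mulr1 mulrC.
Qed.

Lemma isd_sum n (h : 'I_n -> R -> R) x (dh : 'I_n -> R) :
  (forall i, is_derive x (1 : R) (h i) (dh i)) ->
  is_derive x (1 : R) (fun y => \sum_(i < n) h i y) (\sum_(i < n) dh i).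
Proof.
move=> H; have := is_derive_sum H; congr is_derive.
by apply/funext => y; rewrite fct_sumE.
Qed.

Lemma isd_shift f r x a : is_derive (x - r) (1 : R) f a ->
  is_derive x (1 : R) (fun y => f (y - r)) a.
Proof.
move=> Hf; have H := @is_derive1_comp _ f (fun y => y - r) x _ _ Hf (isdB (isd_id x) (isd_cst r x)).
by apply: isd_eq H _; rewrite subr0 mulr1.
Qed.

Lemma isd_continuous f x a : is_derive x (1 : R) f a -> {for x, continuous f}.
Proof. by move=> [/derivable1_diffP/differentiable_continuous]. Qed.

Lemma contM f g : continuous f -> continuous g -> continuous (fun x => f x * g x).
Proof. by move=> cf cg x; exact: (continuousM (cf x) (cg x)). Qed.

Lemma contD f g : continuous f -> continuous g -> continuous (fun x => f x + g x).
Proof. by move=> cf cg x; exact: (continuousD (cf x) (cg x)). Qed.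

Lemma isd_derive1 f x a : is_derive x (1 : R) f a -> f^`()%classic x = a.
Proof. by move=> H; rewrite derive1E; apply: derive_val. Qed.

(** At 0 the difference quotient of the truncated function is either that of f or zero, and the
    former tends to 0. *)
Lemma isd_pos_part f (f1 : R -> R) : f 0 = 0 -> f1 0 = 0 ->
  (forall x, is_derive x (1 : R) f (f1 x)) ->
  forall x, is_derive x (1 : R) (fun y => if 0 < y then f y else 0) (if 0 < x then f1 x else 0).
Proof.
move=> f0 f10 df x; pose F y := if 0 < y then f y else 0.
case: (ltrgtP 0 x) => [x0|x0|<-].
- apply: near_eq_is_derive (df x); rewrite ?oner_eq0 //.
  by near=> y; rewrite ifT //; near: y; exact: lt_nbhsr.
- apply: near_eq_is_derive (isd_cst 0 x); rewrite ?oner_eq0 //.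
  by near=> y; rewrite ifF //; apply/negbTE; rewrite -leNgt ltW //; near: y; exact: lt_nbhsl.
have H : (fun h : R => h^-1 *: ((F \o shift 0) (h *: (1 : R)) - F 0)) @ 0^' --> (0 : R).
  have [d0 e0] := df 0.
  have cf : (fun h : R => h^-1 *: ((f \o shift 0) (h *: (1 : R)) - f 0)) @ 0^' --> (0 : R).
    by rewrite -[X in _ --> X]f10 -[X in _ --> X]e0; exact: d0.
  apply/cvgr0Pnorm_lt => e e00; move/cvgr0Pnorm_lt : cf => /(_ e e00).
  apply: filterS => h; apply: le_lt_trans.
  rewrite /F /= ltxx !subr0 f0 subr0; case: ifP => _ //.
  by rewrite scaler0 normr0.
by split; [apply/cvg_ex; exists 0|apply: cvg_lim].
Unshelve. all: by end_near. Qed.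

End derivatives.

Section half_line.
Context {R : realType}.
Local Notation mu := (@lebesgue_measure R).
Implicit Types (f g : R -> R) (t s a c : R).

Definition step_density t s : R := expR (- s) * Num.min 1 (expR (t - s)).

Lemma step_density_le t s : s <= t -> step_density t s = expR (- s).
Proof.
by move=> st; rewrite /step_density min_l ?mulr1 // -expR0 ler_expR subr_ge0.
Qed.

Lemma step_density_ge t s : t <= s -> step_density t s = expR t * expR (- 2 * s).
Proof.
move=> st; rewrite /step_density min_r; last by rewrite -expR0 ler_expR subr_le0.
by rewrite -!expRD; congr expR; ring.
Qed.

Lemma step_density_ge0 t s : 0 <= step_density t s.
Proof. by rewrite mulr_ge0 ?expR_ge0 // le_min ler01 expR_ge0. Qed.

Lemma measurable_step_density2 d (T : measurableType d) (D : set T) (h k : T -> R) :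
  measurable_fun D h -> measurable_fun D k ->
  measurable_fun D (fun x => step_density (h x) (k x)).
Proof.
move=> mh mk; apply: measurable_funM.
  by apply: measurableT_comp; [exact: measurable_expR|exact: measurableT_comp].
apply: measurable_minr => //.
by apply: measurableT_comp; [exact: measurable_expR|exact: measurable_funB].
Qed.

Lemma measurable_step_density t : measurable_fun [set: R] (step_density t).
Proof. exact: measurable_step_density2. Qed.

Lemma continuous_itv_cvg f a : continuous f -> f x @[x --> a^'+] --> f a.
Proof. by move=> cf; apply: cvg_at_right_filter; exact: cf. Qed.

Lemma continuous_itv_cvgl f a : continuous f -> f x @[x --> a^'-] --> f a.
Proof. by move=> cf; apply: cvg_at_left_filter; exact: cf. Qed.

Lemma integral_segment f (F : R -> R) a b : a <= b -> continuous f ->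
  (forall x, is_derive x (1 : R) F (f x)) ->
  (\int[mu]_(x in `[a, b]) (f x)%:E = (F b - F a)%:E)%E.
Proof.
rewrite le_eqVlt => /predU1P[->|ab] cf dF.
  by rewrite set_itv1 integral_set1 subrr.
have cF : continuous F by move=> x; exact: isd_continuous (dF x).
rewrite (@continuous_FTC2 _ f F) //.
- exact: continuous_subspaceT.
- split; [by move=> x _; case: (dF x)|exact: continuous_itv_cvg|exact: continuous_itv_cvgl].
- by move=> x _; exact: isd_derive1.
Qed.

Lemma integral_ray f (F : R -> R) a (l : R) : continuous f ->
  (forall x, a <= x -> 0 <= f x) ->
  (forall x, is_derive x (1 : R) F (f x)) -> F x @[x --> +oo%R] --> l ->
  (\int[mu]_(x in `[a, +oo[) (f x)%:E = (l - F a)%:E)%E.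
Proof.
move=> cf f0 dF Fl; have cF : continuous F by move=> x; exact: isd_continuous (dF x).
rewrite (@ge0_continuous_FTC2y _ f F a l) //.
- exact: continuous_subspaceT.
- exact: continuous_itv_cvg.
- by move=> x _; exact: isd_derive1.
Qed.

Lemma integral_ray_split (h : R -> \bar R) a t : a <= t ->
  measurable_fun [set: R] h -> (forall x, a <= x -> (0 <= h x)%E) ->
  (\int[mu]_(x in `[a, +oo[) h x =
   \int[mu]_(x in `[a, t]) h x + \int[mu]_(x in `[t, +oo[) h x)%E.
Proof.
move=> at_ mh h0.
rewrite (@itv_bndbnd_setU _ _ _ (BLeft t)) // ge0_integral_setU //=.
- by rewrite integral_itv_bndo_bndc //; exact: measurable_funS mh.
- exact: measurable_funS mh.
- move=> x [|] /=; rewrite in_itv /= => /andP[ax _]; apply: h0 => //.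
  exact: le_trans ax.
- apply/disj_setPS => x [] /=; rewrite !in_itv /= andbT => /andP[_ xt] tx.
  by move: (lt_le_trans xt tx); rewrite ltxx.
Qed.

Lemma cvg_expRN : expR (- x) @[x --> +oo%R] --> (0 : R).
Proof. exact: cvgr_expR. Qed.

Section ode.
Variables (f f1 g : R -> R) (c : R).
Hypotheses (df : forall s, is_derive s (1 : R) f (f1 s))
  (df1 : forall s, is_derive s (1 : R) f1 (f1 s + (2 * c - g s) * expR (- s)))
  (cg : continuous g)
  (lim1 : expR (- s) * f1 s @[s --> +oo%R] --> 0).

(** On this ray the density is e^{t-2s}, and the differential equation turns g e^{-2s} into the
    derivative of - c e^{-2s} - e^{-s} f'. The growth hypothesis kills the value at infinity. *)
Lemma integral_step_density_ge a t : (forall s, a <= s -> 0 <= g s) -> t <= a ->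
  (\int[mu]_(s in `[a, +oo[) (g s * step_density t s)%:E =
   (expR t * (c * expR (- 2 * a) + expR (- a) * f1 a))%:E)%E.
Proof.
move=> g0 ta.
pose h s := g s * (expR t * expR (- 2 * s)).
pose F s := expR t * (- c * expR (- 2 * s) - expR (-1 * s) * f1 s).
rewrite (@eq_integral _ _ _ mu _ (fun s => (h s)%:E)); last first.
  move=> s; rewrite inE /= in_itv /= andbT => as_.
  by rewrite step_density_ge // (le_trans ta).
have ch : continuous h.
  by apply: contM => // s; exact: isd_continuous (isdZ (expR t) (isd_exp (-2) s)).
have h0 s : a <= s -> 0 <= h s.
  by move=> as_; rewrite mulr_ge0 ?mulr_ge0 ?expR_ge0 ?g0.
have dF s : is_derive s (1 : R) F (h s).
  apply: isd_eq (isdZ _ (isdB (isdZ (- c) (isd_exp (-2) s)) (isdM (isd_exp (-1) s) (df1 s)))) _.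
  rewrite /h (_ : -2 * s = - s + - s); last by ring.
  by rewrite expRD !mulN1r; ring.
have Fl : F s @[s --> +oo%R] --> (0 : R).
  rewrite -(mulr0 (expR t)); apply: cvgMr; rewrite -(subr0 0).
  apply: cvgB; last by under eq_fun do rewrite mulN1r.
  rewrite -(mulr0 (- c)); apply: cvgMr.
  have -> : (fun s => expR (-2 * s)) = (fun s => expR (- s) * expR (- s)) :> (R -> R).
    by apply/funext => s; rewrite -expRD; congr expR; ring.
  by rewrite -(mulr0 0); apply: cvgM; exact: cvg_expRN.
by rewrite (integral_ray ch h0 dF Fl); congr (_%:E); rewrite /F sub0r !mulN1r; ring.
Qed.

(** The density changes its form at t. Up to t it is e^{-s}, for which - 2c e^{-s} - f' + f is a
    primitive; the remaining ray is the previous lemma with a = t. *)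
Lemma integral_step_density_le a t : (forall s, a <= s -> 0 <= g s) -> a <= t ->
  (\int[mu]_(s in `[a, +oo[) (g s * step_density t s)%:E =
   (f t - f a + f1 a + 2 * c * expR (- a) - c * expR (- t))%:E)%E.
Proof.
move=> g0 at_; have mh : measurable_fun [set: R] (fun s => (g s * step_density t s)%:E).
  apply/measurable_EFinP; apply: measurable_funM; first exact: continuous_measurable_fun.
  exact: measurable_step_density.
rewrite (integral_ray_split at_ mh); last first.
  by move=> s as_; rewrite lee_fin mulr_ge0 ?g0 ?step_density_ge0.
pose h s := g s * expR (-1 * s).
pose F s := - 2 * c * expR (-1 * s) - f1 s + f s.
rewrite (@eq_integral _ _ _ mu _ (fun s => (h s)%:E)); last first.
  by move=> s; rewrite inE /= in_itv /= => /andP[_ st]; rewrite step_density_le // /h mulN1r.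
have ch : continuous h.
  by apply: contM => // s; exact: isd_continuous (isd_exp (-1) s).
have dF s : is_derive s (1 : R) F (h s).
  apply: isd_eq (isdD (isdB (isdZ (- 2 * c) (isd_exp (-1) s)) (df1 s)) (df s)) _.
  by rewrite /h !mulN1r; ring.
rewrite (integral_segment at_ ch dF).
have g0' s : t <= s -> 0 <= g s by move=> ts; apply: g0; exact: le_trans ts.
rewrite (integral_step_density_ge g0') // -EFinD; congr (_%:E).
rewrite /F !mulN1r (_ : -2 * t = - t + - t); last by ring.
rewrite expRD mulrDr; have e1 : expR t * expR (- t) = 1 by rewrite -expRD subrr expR0.
rewrite (_ : expR t * (c * (expR (- t) * expR (- t))) = (expR t * expR (- t)) * c * expR (- t)); last by ring.
rewrite (_ : expR t * (expR (- t) * f1 t) = (expR t * expR (- t)) * f1 t); last by ring.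
by rewrite e1; ring.
Qed.

End ode.
End half_line.

(** * The kernel and its backward equation *)

Section ode_solutions.
Context {R : realType}.

(* [g] is the kernel before a step and [f] the kernel after it. *)
Definition ode_sol (c : R) (g f f1 : R -> R) : Prop :=
  (forall s, is_derive s (1 : R) f (f1 s)) /\
  (forall s, is_derive s (1 : R) f1 (f1 s + (2 * c - g s) * expR (- s))).

Lemma ode_solZ k c g f f1 : ode_sol c g f f1 ->
  ode_sol (k * c) (fun s => k * g s) (fun s => k * f s) (fun s => k * f1 s).
Proof.
move=> [H1 H2]; split=> s; first exact: isdZ.
by apply: isd_eq (isdZ k (H2 s)) _; ring.
Qed.

Lemma ode_solD c g f f1 c' g' f' f1' : ode_sol c g f f1 -> ode_sol c' g' f' f1' ->
  ode_sol (c + c') (fun s => g s + g' s) (fun s => f s + f' s) (fun s => f1 s + f1' s).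
Proof.
move=> [H1 H2] [H3 H4]; split=> s; first exact: isdD.
by apply: isd_eq (isdD (H2 s) (H4 s)) _; ring.
Qed.

Lemma ode_sol_sum n (c : 'I_n -> R) (g f f1 : 'I_n -> R -> R) :
  (forall i, ode_sol (c i) (g i) (f i) (f1 i)) ->
  ode_sol (\sum_(i < n) c i) (fun s => \sum_(i < n) g i s)
    (fun s => \sum_(i < n) f i s) (fun s => \sum_(i < n) f1 i s).
Proof.
move=> H; split=> s; first by apply: isd_sum => i; case: (H i).
apply: isd_eq (isd_sum (fun i => (H i).2 s)) _.
rewrite big_split /=; congr (_ + _); rewrite mulr_sumr -sumrB mulr_suml.
by [].
Qed.

Lemma isd_exp_sum n (c : nat -> R) s :
  is_derive s (1 : R) (fun s => \sum_(p < n) c p * expR (- p%:R * s))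
    (\sum_(p < n) (- p%:R * c p) * expR (- p%:R * s)).
Proof.
apply: isd_sum => p; apply: isd_eq (isdZ (c p) (isd_exp (- p%:R) s)) _; ring.
Qed.

Lemma isd_lin c k s : is_derive s (1 : R) (fun s => (c + s) * expR (k * s))
   ((1 + k * c + k * s) * expR (k * s)).
Proof.
apply: isd_eq (isdM (isdD (isd_cst c s) (isd_id s)) (isd_exp k s)) _; ring.
Qed.

Variables al g et s : nat -> R.
Hypotheses (al0 : al 0 = 0) (g0 : g 0 = 0) (et0 : et 0 = 0) (s0 : s 0 = 0).
Local Notation cA := (cA al s).
Local Notation cB := (cB al g et s).
Local Notation seqP := (seqP al s).
Local Notation seqM := (seqM al g et s).

(* With weights (-1)^q / (q)^! e^{-(q+2)r}, the sums of [phim (n - q)] and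
   [phip (n - q)] over q give the n-step kernel at (-x, r) and, for 0 <= x <= r,
   at (x, r). *)
Definition phim m x : R := \sum_(p < m.+1) cA p m * expR (- p%:R * x).
Definition phim1 m x : R := \sum_(p < m.+1) (- p%:R * cA p m) * expR (- p%:R * x).

Lemma kappaS p : (p.+2 * p.+3)%:R * kappa p.+2 = - kappa p.+1 :> R.
Proof.
rewrite /kappa (sfactS p.+1) natrM /= exprS.
have h1 : p.+2%:R != 0 :> R by rewrite pnatr_eq0.
have h2 : p.+3%:R != 0 :> R by rewrite pnatr_eq0.
move: (p.+2%:R : R) (p.+3%:R : R) h1 h2 (sfact_neq0 (R := R) p.+1) => x y x0 y0.
by move: (sfact p.+1) => z z0; field; rewrite x0 y0 z0.
Qed.

(** On e^{-px} the operator f'' - f' is multiplication by p(p+1), while the factor e^{-x} moves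
    index p to p + 1. The constant 2c feeds e^{-x} only, whence the condition p = 0. *)
Lemma cAS p m : (p.+1 * p.+2)%:R * cA p.+1 m.+1 = - cA p m + (p == 0%N)%:R * (2 * seqP m.+1).
Proof.
case: p => [|p].
  rewrite /seqP (_ : shift_seq 1 (cA 0) m.+1 = cA 0 m); last by rewrite /shift_seq subSS subn0.
  by rewrite mul1n eqxx; move: (cA 1 m.+1) (cA 0 m) => x y /=; field.
rewrite mul0r addr0 /= /shift_seq ltnS; case: ifP => _; last by rewrite mulr0 oppr0.
by rewrite subSS mulrA kappaS mulNr.
Qed.

Lemma phim_ode m : ode_sol (seqP m.+1) (phim m) (phim m.+1) (phim1 m.+1).
Proof.
split=> x; first exact: (isd_exp_sum m.+2 (fun p => cA p m.+1) x).
apply: isd_eq (isd_exp_sum m.+2 (fun p => - p%:R * cA p m.+1) x) _.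
rewrite /phim1 /phim mulrBl; apply/eqP; rewrite addrC -subr_eq -sumrB; apply/eqP.
rewrite big_ord_recl /= oppr0 !mul0r subr0 add0r mulr_suml.
pose c p : R := - cA p m + (p == 0%N)%:R * (2 * seqP m.+1).
rewrite (eq_bigr (fun p : 'I_m.+1 => c p * expR (- p.+1%:R * x))); last first.
  move=> p _; rewrite -[c p]cAS /bump /= add1n natrM -(natr1 p.+1).
  by move: (p.+1%:R : R) (cA p.+1 m.+1) => a b; ring.
under eq_bigr do rewrite mulrDl.
rewrite big_split /= addrC; congr (_ + _).
  rewrite big_ord_recl /= big1 ?addr0 ?mul1r ?mulN1r // => p _.
  by rewrite /bump /= mul0r mul0r.
rewrite -sumrN; apply: eq_bigr => p _.
rewrite [LHS]mulNr; congr (- _); rewrite -mulrA -expRD; congr (_ * expR _).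
by rewrite -natr1; ring.
Qed.

(** This is the coefficient of x e^{-(m-2)x}; its convolution yields the terms of the kernel with
    the factor r'. *)
Definition plin m : R := shift_seq 2 (fj 1) m.

Definition phip m x : R := delta_seq 1 m * expR (1 * x) +
  plin m * ((0 + x) * expR (- (m - 2)%:R * x)) + \sum_(p < m.+1) cB p m * expR (- p%:R * x).

Definition phip1 m x : R := delta_seq 1 m * (1 * expR (1 * x)) +
  plin m * ((1 + - (m - 2)%:R * 0 + - (m - 2)%:R * x) * expR (- (m - 2)%:R * x))
  + \sum_(p < m.+1) (- p%:R * cB p m) * expR (- p%:R * x).

(** Compared with [cAS] there is a defect: f'' - f' applied to x e^{-kx} leaves -(2k+1) e^{-kx}
    besides its linear part. Compensating it at k = p + 1 produces the sum of (2k+1)/(k(k+1)) in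
    B_{p,q}. *)
Lemma cBS p m : (p.+1 * p.+2)%:R * cB p.+1 m.+1 =
  - cB p m + (p == 0%N)%:R * (2 * seqM m.+1)
  + (m == p.+2)%:R * ((2 * p + 3)%:R * fj 1 p.+1).
Proof.
case: p => [|p].
  rewrite /seqM (_ : shift_seq 1 (cB 0) m.+1 = cB 0 m); last by rewrite /shift_seq subSS subn0.
  (* For p = 0 and m = 2 the defect is 3 * (-1/2); the 3/4 in [seqM] is there to cancel it. *)
  rewrite (_ : fj 1 1 = - 2^-1 :> R); last by rewrite fj1E expr1 mulN1r.
  rewrite /delta_seq eqSS; move: (cB 1 m.+1) (cB 0 m) ((m == 2)%:R : R) => x y z.
  by rewrite eqxx mul1n muln0 add0n /=; field.
rewrite mul0r addr0 /= mulrDr opprD -addrA; congr (_ + _).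
  rewrite /shift_seq ltnS subSS; case: ifP => _; last by rewrite mulr0 oppr0.
  by rewrite mulrA kappaS mulNr.
rewrite /shift_seq; case: (eqVneq m p.+3) => [->|mp].
  rewrite !subSS !subn0 !eqxx !mul1r /= /e0 /eps_sum big_nat_recr //= -/(eps_sum p.+1) (sfactS p.+1).
  rewrite fj1E (sfactS p.+1) !natrM natrD natrM natrD natrM exprS.
  have h1 : p.+2%:R != 0 :> R by rewrite pnatr_eq0.
  have h2 : p.+3%:R != 0 :> R by rewrite pnatr_eq0.
  have -> : 2 * p.+1%:R + 3 = 2 * p.+2%:R + 1 :> R by rewrite -(natr1 p.+1); ring.
  move: (p.+2%:R : R) (p.+3%:R : R) (eps_sum p.+1 : R) h1 h2 (sfact_neq0 (R := R) p.+1) => x y e x0 y0.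
  by move: (sfact p.+1) => z z0; field; rewrite x0 y0 z0.
rewrite mul0r addr0; case: ifP => m1; case: ifP => m2.
- rewrite (_ : (m.+1 - 2 == p.+2)%N = false); last by apply/eqP => /eqP; lia.
  rewrite (_ : (m - 2 == p.+1)%N = false); last by apply/eqP => /eqP; lia.
  by rewrite !mul0r mulr0 oppr0.
- rewrite (_ : (m.+1 - 2 == p.+2)%N = false); last by apply/eqP => /eqP; lia.
  by rewrite !mul0r mulr0 oppr0.
- by lia.
- by rewrite mulr0 oppr0.
Qed.

Lemma phip_ode m : ode_sol (seqM m.+1) (phip m) (phip m.+1) (phip1 m.+1).
Proof.
split=> x.
  apply: isdD; last exact: (isd_exp_sum m.+2 (fun p => cB p m.+1) x).
  by apply: isdD; apply: isdZ; [exact: isd_exp|exact: isd_lin].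
have H3 := isd_exp_sum m.+2 (fun p => - p%:R * cB p m.+1) x.
pose k : R := (m.+1 - 2)%:R.
have H2 : is_derive x (1 : R) (fun x => plin m.+1 * ((1 + - k * 0 + - k * x) * expR (- k * x)))
   (plin m.+1 * ((- k - k - k * - k * x) * expR (- k * x))).
  apply: isdZ; apply: isd_eq (isdM (isdD (isd_cst _ x) (isdZ (- k) (isd_id x))) (isd_exp (- k) x)) _.
  by ring.
have H1 := isdZ (delta_seq 1 m.+1) (isdZ 1 (isd_exp 1 x)).
apply: isd_eq (isdD (isdD H1 H2) H3) _.
rewrite /phip1 -/k.
set S2 := \sum_(p < m.+2) (- p%:R * (- p%:R * _)) * _.
set S1 := \sum_(p < m.+2) (- p%:R * _) * _.
have ES : S2 - S1 = (2 * seqM m.+1 - \sum_(p < m.+1) cB p m * expR (- p%:R * x)) * expR (- x)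
     + \sum_(p < m.+1) (m == p.+2)%:R * ((2 * p + 3)%:R * fj 1 p.+1) * expR (- p.+1%:R * x).
  rewrite /S2 /S1 -sumrB mulrBl big_ord_recl /= oppr0 !mul0r subr0 add0r mulr_suml.
  pose c p : R := - cB p m + (p == 0%N)%:R * (2 * seqM m.+1)
    + (m == p.+2)%:R * ((2 * p + 3)%:R * fj 1 p.+1).
  rewrite (eq_bigr (fun p : 'I_m.+1 => c p * expR (- p.+1%:R * x))); last first.
    move=> p _; rewrite -[c p]cBS /bump /= add1n natrM -(natr1 p.+1).
    by move: (p.+1%:R : R) (cB p.+1 m.+1) => a b; ring.
  under eq_bigr do rewrite 2!mulrDl.
  rewrite !big_split /=; congr (_ + _); rewrite addrC; congr (_ + _).
    rewrite big_ord_recl /= big1 ?addr0 ?mul1r ?mulN1r // => p _.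
    by rewrite /bump /= mul0r mul0r.
  rewrite -sumrN; apply: eq_bigr => p _.
  rewrite [LHS]mulNr; congr (- _); rewrite -mulrA -expRD; congr (_ * expR _).
  by rewrite -natr1; ring.
have -> : S2 = S1 + (S2 - S1) by ring.
rewrite ES /phip; set T := \sum_(p < m.+1) (m == _)%:R * _ * _.
set B := \sum_(p < m.+1) cB p m * _.
(* The linear and exponential parts satisfy the equation up to the defect T. For m = 1 the source is
   e^x e^{-x} = 1, which creates the first linear term. *)
have KEY : plin m.+1 * ((- 2 * k - 1 + (k * k + k) * x) * expR (- k * x)) + T =
   - (delta_seq 1 m * expR (1 * x) + plin m * ((0 + x) * expR (- (m - 2)%:R * x))) * expR (- x).
  rewrite /plin /k /T; clear; case: m => [|[|m]].
  - rewrite big1 => [|p _]; last by rewrite !mul0r.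
    by rewrite /shift_seq /delta_seq /= !mul0r !addr0 oppr0 mul0r.
  - rewrite big1 => [|p _]; last by rewrite !mul0r.
    rewrite /shift_seq /delta_seq /= fj1E sfact0 subnn expr0 !oppr0 !mul0r expR0 !mul1r !addr0.
    by rewrite mulr0 mulNr -expRD subrr expR0 invr1; ring.
  have -> : \sum_(p < m.+3) (m.+2 == p.+2)%:R * ((2 * p + 3)%:R * fj 1 p.+1) *
      expR (- p.+1%:R * x) = (2 * m + 3)%:R * fj 1 m.+1 * expR (- m.+1%:R * x) :> R.
    have mm : (m < m.+3)%N by lia.
    rewrite (bigD1 (Ordinal mm)) //= eqxx mul1r big1 ?addr0 // => i /eqP ni.
    case: eqP => [[E]|]; last by rewrite !mul0r.
    by case: ni; apply/val_inj.
  rewrite /shift_seq /delta_seq /= !subSS !subn0 mul0r add0r add0r.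
  rewrite !fj1E sfactS exprS (_ : - m.+1%:R * x = - m%:R * x + - x); last first.
    by rewrite -natr1; ring.
  rewrite expRD; have h1 : m.+1%:R != 0 :> R by rewrite pnatr_eq0.
  have h2 : m.+2%:R != 0 :> R by rewrite pnatr_eq0.
  have -> : (2 * m + 3)%:R = 2 * m.+1%:R + 1 :> R by rewrite natrD natrM -(natr1 m); ring.
  rewrite -(natr1 m.+1) in h2 *.
  move: (m.+1%:R : R) h1 h2 (sfact_neq0 (R := R) m) (expR (- m%:R * x)) (expR (- x)) => y y1 y2.
  by move: (sfact m : R) => z z0 e1 e2; field; rewrite y1 y2 z0.
have -> : T = - (delta_seq 1 m * expR (1 * x) + plin m * ((0 + x) * expR (- (m - 2)%:R * x))) * expR (- x)
     - plin m.+1 * ((- 2 * k - 1 + (k * k + k) * x) * expR (- k * x)).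
  by rewrite -KEY; ring.
rewrite -/k; move: (expR (- k * x)) (plin m.+1) (plin m) (expR (1 * x)) (expR (- (m - 2)%:R * x)).
move: (delta_seq 1 m.+1) (delta_seq 1 m) (seqM m.+1) (expR (- x)) => d1 d2 M e a1 a2 a3 a4 a5.
ring.
Qed.

Hypotheses (Hal : has_genfun 0 al genalpha) (Hg : has_genfun 0 g genG)
  (Het : has_genfun 0 et genH) (Hs : has_genfun 0 s (@genS R)).

Lemma phim_at0 m : phim m.+1 0 = seqP m.+1 + seqM m.+1.
Proof.
rewrite /phim -(matching_A al0 Hal Hg Het Hs m.+1).
by apply: eq_bigr => p _; rewrite mulr0 expR0 mulr1.
Qed.

Lemma phim1_at0 m : phim1 m.+1 0 = seqM m.+1 - seqP m.+1.
Proof.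
rewrite -opprB /phim1 -(matching_A' al0 Hal Hg Het Hs m.+1) -sumrN.
by apply: eq_bigr => p _; rewrite mulr0 expR0 mulr1 mulNr.
Qed.

Lemma phip_at0 m : phip m.+1 0 = seqP m.+1 + seqM m.+1.
Proof.
rewrite -(matching_B al0 g0 Hal Hg Het Hs m.+1) /phip mulr0 expR0 mulr1 add0r mul0r mulr0 addr0.
by congr (_ + _); apply: eq_bigr => p _; rewrite mulr0 expR0 mulr1.
Qed.

Lemma phip1_at0 m : phip1 m.+1 0 = seqP m.+1 - seqM m.+1.
Proof.
rewrite -(matching_B' al0 g0 Hal Hg Het Hs m.+1) /phip1 !mulr0 !addr0 expR0 !mulr1 -sumrN.
by congr (_ + _); apply: eq_bigr => p _; rewrite mulr0 expR0 mulr1 mulNr.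
Qed.

End ode_solutions.

(** * The correction above the diagonal *)

Section diagonal_part.
Context {R : realType}.

(* [e^{-nr} rhoS n.-1 (x - r)] is the difference of the expressions of the kernel
   at (x, r) for x > r and for x <= r; it vanishes to second order on the
   diagonal, so it may be cut off there. *)
Definition rho_coef m p : R := (-1) ^+ m.+1 / (sfact p * sfact (m.-1 - p)).

Definition rhoS m (x : R) : R :=
  \sum_(p < m) rho_coef m p * ((hsum (m.-1 - p) - hsum p - x) * expR (- p%:R * x))
  + (-1) ^+ m / sfact m * (expR (- m%:R * x) - expR (1 * x)).

Definition rhoS1 m (x : R) : R :=
  \sum_(p < m) rho_coef m p *
    ((-1 - p%:R * (hsum (m.-1 - p) - hsum p - x)) * expR (- p%:R * x))
  + (-1) ^+ m / sfact m * (- m%:R * expR (- m%:R * x) - 1 * expR (1 * x)).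

Lemma isd_affine_exp (c k x : R) :
  is_derive x (1 : R) (fun y => (c - y) * expR (k * y)) ((-1 + k * (c - x)) * expR (k * x)).
Proof.
by apply: isd_eq (isdM (isdB (isd_cst c x) (isd_id x)) (isd_exp k x)) _; ring.
Qed.

Lemma rhoS_derive m x : is_derive x (1 : R) (rhoS m) (rhoS1 m x).
Proof.
apply: isdD; last by apply: isdZ; apply: isdB; exact: isd_exp.
apply: isd_sum => p; apply: isdZ; apply: isd_eq (isd_affine_exp _ _ _) _; ring.
Qed.

Lemma rhoS_ode m : ode_sol 0 (rhoS m) (rhoS m.+1) (rhoS1 m.+1).
Proof.
split=> x; first exact: rhoS_derive.
have D : is_derive x (1 : R) (rhoS1 m.+1)
   (\sum_(p < m.+1) rho_coef m.+1 p *
     ((2 * p%:R + p%:R * p%:R * (hsum (m - p) - hsum p - x)) * expR (- p%:R * x))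
    + (-1) ^+ m.+1 / sfact m.+1 *
     (- m.+1%:R * (- m.+1%:R * expR (- m.+1%:R * x)) - 1 * (1 * expR (1 * x)))).
  apply: isdD; last first.
    by apply: isdZ; apply: isdB; apply: isdZ; exact: isd_exp.
  apply: isd_sum => p; apply: isdZ.
  have H := isdB (isd_cst (hsum (m - p) - hsum p : R) x) (isd_id x).
  by apply: isd_eq (isdM (isdB (isd_cst (-1) x) (isdZ p%:R H)) (isd_exp (- p%:R) x)) _; ring.
apply: isd_eq D _; rewrite /rhoS1 /=.
pose S1 := \sum_(p < m.+1) rho_coef m.+1 p *
    ((-1 - p%:R * (hsum (m - p) - hsum p - x)) * expR (- p%:R * x)).
set S2 := \sum_(p < m.+1) rho_coef m.+1 p * ((2 * p%:R + _) * _).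
(* The summand p = 0 gives the constant, matching e^x e^{-x} in the last term of [rhoS m]; the
   others shift to p - 1, with increments of [hsum] absorbing the linear defect. *)
have ES : S2 - S1 = (-1) ^+ m / sfact m - expR (- x) * \sum_(p < m)
    rho_coef m p * ((hsum (m.-1 - p) - hsum p - x) * expR (- p%:R * x)).
  rewrite /S2 /S1 -sumrB big_ord_recl /= -[_ / sfact m]addr0; congr (_ + _).
    by rewrite /rho_coef sfact0 /= subn0 !exprS oppr0 !mul0r expR0; field; rewrite ?factr_neq0.
  rewrite mulr_sumr -sumrN; apply: eq_bigr => p _; rewrite /bump /= add1n /rho_coef /=.
  rewrite (_ : (m - p.+1 = m.-1 - p)%N); last by have := ltn_ord p; clear; lia.
  rewrite (hsumS p) (sfactS p) (_ : - p.+1%:R * x = - p%:R * x + - x); last first.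
    by rewrite -natr1; ring.
  rewrite expRD (exprS _ m.+1).
  have h1 : p.+1%:R != 0 :> R by rewrite pnatr_eq0.
  have h2 : p.+2%:R != 0 :> R by rewrite pnatr_eq0.
  rewrite -(natr1 p.+1) in h2 *.
  move: (sfact_neq0 (R := R) p) (sfact_neq0 (R := R) (m.-1 - p)).
  move: (hsum (m.-1 - p) : R) (hsum p : R) (sfact p : R) (sfact (m.-1 - p) : R) => a b c d c0 d0.
  move: (p.+1%:R : R) h1 h2 (expR (- p%:R * x)) (expR (- x)) => y y0 y1 e1 e2.
  by field; rewrite y0 y1 c0 d0.
have -> : S2 = S1 + (S2 - S1) by ring.
rewrite ES /rhoS -/S1 mulr0 sub0r (sfactS m) exprS.
have e1 : expR (1 * x) * expR (- x) = 1 by rewrite -expRD mul1r subrr expR0.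
have e2 : expR (- m%:R * x) * expR (- x) = expR (- m.+1%:R * x).
  by rewrite -expRD -natr1; congr expR; ring.
rewrite -e2 -!addrA; congr (_ + _).
set T := \sum_(p < m) _.
have h1 : m.+1%:R != 0 :> R by rewrite pnatr_eq0.
have h2 : m.+2%:R != 0 :> R by rewrite pnatr_eq0.
rewrite -(natr1 m.+1) in h2 *.
have -> : - (T + (-1) ^+ m / sfact m * (expR (- m%:R * x) - expR (1 * x))) * expR (- x) =
   - expR (- x) * T - (-1) ^+ m / sfact m * (expR (- m%:R * x) * expR (- x)
     - expR (1 * x) * expR (- x)) by ring.
rewrite e1.
move: T (m.+1%:R : R) h1 h2 (expR (- m%:R * x)) (expR (- x)) (expR (1 * x)) => T y y0 y1 a b c.
move: (sfact m : R) (sfact_neq0 (R := R) m) => z z0.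
by field; rewrite y0 y1 z0.
Qed.

(** The differences of [hsum] are antisymmetric under p -> m - 1 - p. *)
Lemma rhoS_at0 m : rhoS m 0 = 0.
Proof.
rewrite /rhoS !mulr0 !expR0 subrr mulr0 addr0; case: m => [|m]; first by rewrite big_ord0.
have := @big_antisym R (fun p q => (-1) ^+ m.+2 / (sfact p * sfact q) * (hsum q - hsum p)) m.
move=> /= H; rewrite -[RHS]H.
  by apply: eq_bigr => p _; rewrite /rho_coef mulr0 expR0 mulr1 subr0.
by move=> p q; rewrite (mulrC (sfact q)) -mulrN opprB.
Qed.

(** First-order vanishing on the diagonal is the sum that also expresses the Wronskian. *)
Lemma rhoS1_at0 m : rhoS1 m.+1 0 = 0.
Proof.
rewrite /rhoS1 !mulr0 !expR0 !mulr1.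
have -> : \sum_(p < m.+1) rho_coef m.+1 p * ((-1 - p%:R * (hsum (m.+1.-1 - p) - hsum p - 0)) * expR (- p%:R * 0))
   = - (-1) ^+ m * (m.+1`!%:R ^+ 2)^-1 :> R.
  rewrite -wronskian_sum mulr_sumr; apply: eq_bigr => p _.
  by rewrite /rho_coef mulr0 expR0 mulr1 subr0 /= !exprS; ring.
rewrite /sfact (factS m.+1) (natrM _ m.+1`! (m.+2 * _)) (natrM _ m.+2) (exprS _ m).
have h1 : m.+1`!%:R != 0 :> R by exact: factr_neq0.
have h2 : m.+2%:R != 0 :> R by rewrite pnatr_eq0.
rewrite -(natr1 m.+1) in h2 *.
move: (m.+1`!%:R : R) (m.+1%:R : R) h1 h2 => x y x0 y0.
by field; rewrite x0 y0.
Qed.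

Definition rho_plus m r x : R := if 0 < x - r then rhoS m (x - r) else 0.
Definition rho_plus1 m r x : R := if 0 < x - r then rhoS1 m (x - r) else 0.

Lemma rho_plus_ode m r : ode_sol 0
  (fun x => expR (- m.+1%:R * r) * rho_plus m r x)
  (fun x => expR (- m.+2%:R * r) * rho_plus m.+1 r x)
  (fun x => expR (- m.+2%:R * r) * rho_plus1 m.+1 r x).
Proof.
have [H1 H2] := rhoS_ode m; split=> x.
  apply: isdZ; apply: (isd_shift (f := fun y => if 0 < y then rhoS m.+1 y else 0)).
  exact: (isd_pos_part (rhoS_at0 m.+1) (rhoS1_at0 m) H1).
(* The second derivative vanishes on the diagonal too, so the first derivative may also be cut off
   there. *)
have z2 : rhoS1 m.+1 0 + (2 * 0 - rhoS m 0) * expR (- 0) = 0.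
  by rewrite rhoS1_at0 rhoS_at0 !mulr0 subrr mul0r addr0.
have H := isd_shift (isd_pos_part (f1 := fun y => _) (rhoS1_at0 m) z2 H2 (x - r)).
apply: isd_eq (isdZ (expR (- m.+2%:R * r)) H) _.
rewrite /rho_plus1 /rho_plus; case: ifP => _; last by rewrite !mulr0 subrr mul0r addr0.
(* This is where the weight e^{-nr} comes from: it converts the shifted e^{-(x-r)} into e^{-x}. *)
have E : expR (- m.+2%:R * r) * expR (- (x - r)) = expR (- m.+1%:R * r) * expR (- x).
  by rewrite -!expRD; congr expR; rewrite -(natr1 m.+1); ring.
rewrite mulrDr; congr (_ + _).
have -> : (2 * 0 - expR (- m.+1%:R * r) * rhoS m (x - r)) * expR (- x) =
  - rhoS m (x - r) * (expR (- m.+1%:R * r) * expR (- x)) by ring.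
by rewrite -E; ring.
Qed.

Lemma rho_plus_continuous m r : continuous (rho_plus m r).
Proof.
have -> : rho_plus m r = (fun x => rhoS m (Num.max 0 (x - r))).
  apply/funext => x; rewrite /rho_plus; case: (ltP 0 (x - r)) => // _.
  by rewrite rhoS_at0.
move=> x; apply: (@continuous_comp _ _ _ (fun x => Num.max 0 (x - r)) (rhoS m)).
  apply: continuous_max; first exact: cst_continuous.
  exact: isd_continuous (isdB (isd_id x) (isd_cst r x)).
exact: isd_continuous (rhoS_derive m _).
Qed.

End diagonal_part.

(** * Growth of the pieces at infinity *)

Section limits_at_infinity.
Context {R : realType}.

Lemma expRN_le1 (k : nat) (x : R) : 0 <= x -> expR (- k%:R * x) <= 1.
Proof. by move=> x0; rewrite -expR0 ler_expR mulNr oppr_le0 mulr_ge0. Qed.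

Lemma lim_exp_exp k : expR (- x) * expR (- k%:R * x) @[x --> +oo%R] --> (0 : R).
Proof.
apply/cvgr0Pnorm_lt => e e0; have /cvgr0Pnorm_lt/(_ e e0) := cvg_expRN (R := R).
apply: filterS2 (nbhs_pinfty_ge (num_real 0)) => x x0; apply: le_lt_trans.
rewrite normrM -[leRHS]mulr1; apply: ler_wpM2l => //.
by rewrite ger0_norm ?expR_ge0 // expRN_le1.
Qed.

Lemma lim_exp_id k : expR (- x) * (x * expR (- k%:R * x)) @[x --> +oo%R] --> (0 : R).
Proof.
apply/cvgr0Pnorm_lt => e e0.
near=> x.
have x0 : 0 < x by near: x; exact: nbhs_pinfty_gt.
have xe : 4 / e < x by near: x; apply: nbhs_pinfty_gt; exact: num_real.
rewrite ger0_norm; last by rewrite !mulr_ge0 ?expR_ge0 // ltW.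
apply: (@le_lt_trans _ _ (expR (- x) * x)).
  apply: ler_wpM2l; first exact: expR_ge0.
  by rewrite -[leRHS]mulr1; apply: ler_wpM2l; [exact: ltW|exact: expRN_le1 (ltW x0)].
rewrite expRN mulrC ltr_pdivrMr ?expR_gt0 //.
(* Squaring this gives x^2/4 <= e^x, hence x e^{-x} <= 4/x, which is below e as soon as x > 4/e. *)
have h := expR_ge1Dx (x / 2).
have h2 : x ^+ 2 / 4 <= expR x.
  rewrite (_ : expR x = expR (x / 2) ^+ 2); last by rewrite expr2 -expRD; congr expR; field.
  rewrite (_ : x ^+ 2 / 4 = (x / 2) ^+ 2); last by field.
  by apply: lerXn2r; rewrite ?nnegrE ?expR_ge0 //; lra.
apply: (@lt_le_trans _ _ (e * (x ^+ 2 / 4))); last by rewrite ler_wpM2l // ltW.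
rewrite (_ : e * (x ^+ 2 / 4) = x * (e * x / 4)); last by ring.
rewrite -[ltLHS]mulr1 ltr_pM2l // ltr_pdivlMr // mul1r.
by move: xe; rewrite ltr_pdivrMr // mulrC.
Unshelve. all: by end_near. Qed.

Lemma lim_sum n (f : 'I_n -> R -> R) (l : 'I_n -> R) :
  (forall i, f i x @[x --> +oo%R] --> l i) ->
  \sum_(i < n) f i x @[x --> +oo%R] --> \sum_(i < n) l i.
Proof.
elim: n f l => [|n IH] f l H.
  by rewrite big_ord0; under eq_fun do rewrite big_ord0; exact: cvg_cst.
rewrite big_ord_recr /=; under eq_fun do rewrite big_ord_recr /=.
by apply: cvgD; [exact: IH|exact: H].
Qed.

Lemma lim_ext (g f : R -> R) (l' l : R) : (forall x, f x = g x) -> l = l' ->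
  g x @[x --> +oo%R] --> l' -> f x @[x --> +oo%R] --> l.
Proof. by move=> /funext -> ->. Qed.

Lemma lim_sum0 n (f : 'I_n -> R -> R) : (forall i, f i x @[x --> +oo%R] --> (0 : R)) ->
  \sum_(i < n) f i x @[x --> +oo%R] --> (0 : R).
Proof.
by move=> H; apply: lim_ext (lim_sum H) => //; rewrite big1.
Qed.

Lemma limZ0 (c : R) (f : R -> R) : f x @[x --> +oo%R] --> (0 : R) ->
  c * f x @[x --> +oo%R] --> (0 : R).
Proof. by move=> H; apply: lim_ext (cvgMr H) => //; rewrite mulr0. Qed.

Lemma lim_shift (f : R -> R) (r l : R) : f x @[x --> +oo%R] --> l ->
  f (x - r) @[x --> +oo%R] --> l.
Proof.
apply: cvg_comp => A [M [Mr HM]]; exists (M + r); split; first exact: num_real.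
by move=> x Mx /=; apply: HM; rewrite ltrBrDr.
Qed.

End limits_at_infinity.

(** * Assembly of the kernel and its backward equation *)

Section kernel.
Context {R : realType}.
Local Notation mu := (@lebesgue_measure R).

Variables al g et s : nat -> R.
Hypotheses (al0 : al 0 = 0) (g0 : g 0 = 0) (et0 : et 0 = 0) (s0 : s 0 = 0).
Hypotheses (Hal : has_genfun 0 al genalpha) (Hg : has_genfun 0 g genG)
  (Het : has_genfun 0 et genH) (Hs : has_genfun 0 s (@genS R)).
Local Notation cA := (cA al s).
Local Notation cB := (cB al g et s).
Local Notation seqP := (seqP al s).
Local Notation seqM := (seqM al g et s).
Local Notation phim := (phim al s).
Local Notation phim1 := (phim1 al s).
Local Notation phip := (phip al g et s).
Local Notation phip1 := (phip1 al g et s).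

Definition wexp r q : R := wq q * expR (- (q + 2)%:R * r).

Definition wconv r (F : nat -> R) n : R := \sum_(q < n.+1) wexp r q * F (n - q)%N.

Lemma wconvS r (F : nat -> R) n : F 0 = 0 ->
  wconv r F n.+1 = \sum_(q < n.+1) wexp r q * F (n - q).+1.
Proof.
move=> F0; rewrite /wconv big_ord_recr /= subnn F0 mulr0 addr0.
by apply: eq_bigr => q _; rewrite subSn // -ltnS.
Qed.

(** For x >= 0 and r >= 0, [kapm n r x] and [kapp n r x] are the candidate kernel at (-x, r) and (x,
    r). *)
Definition kapm n r x : R := wconv r (phim^~ x) n.
Definition kapm1 n r x : R := wconv r (phim1^~ x) n.
Definition kapp n r x : R := wconv r (phip^~ x) n + expR (- n%:R * r) * rho_plus n.-1 r x.
Definition kapp1 n r x : R := wconv r (phip1^~ x) n + expR (- n%:R * r) * rho_plus1 n.-1 r x.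
Definition cP n r : R := \sum_(q < n.+1) wexp r q * seqP (n - q).+1.
Definition cM n r : R := \sum_(q < n.+1) wexp r q * seqM (n - q).+1.

Lemma phim0 x : phim 0 x = 0.
Proof. by rewrite /phim big_ord1 cA00 // mul0r. Qed.

Lemma phim10 x : phim1 0 x = 0.
Proof. by rewrite /phim1 big_ord1 cA00 // mulr0 mul0r. Qed.

Lemma phip0 x : phip 0 x = 0.
Proof. by rewrite /phip big_ord1 cB00 // /delta_seq /plin /shift_seq /= !mul0r !addr0. Qed.

Lemma phip10 x : phip1 0 x = 0.
Proof. by rewrite /phip1 big_ord1 cB00 // /delta_seq /plin /shift_seq /= mulr0 !mul0r !addr0. Qed.

Lemma kapm_ode n r : ode_sol (cP n r) (kapm n r) (kapm n.+1 r) (kapm1 n.+1 r).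
Proof.
have := ode_sol_sum (fun q : 'I_n.+1 => ode_solZ (wexp r q) (phim_ode al s (n - q)%N)).
congr ode_sol; apply/funext => x; rewrite /kapm /kapm1 ?wconvS ?phim0 ?phim10 //.
Qed.

(** The correction in [kapp n] is [rhoS] of index n - 1, so it is in phase with the convolution only
    from n = 1 on; the first kernel is treated in [kap1E]. *)
Lemma kapp_ode n r : ode_sol (cM n.+1 r) (kapp n.+1 r) (kapp n.+2 r) (kapp1 n.+2 r).
Proof.
have H := ode_sol_sum (fun q : 'I_n.+2 => ode_solZ (wexp r q) (phip_ode al g et s (n.+1 - q)%N)).
have := ode_solD H (rho_plus_ode n r); rewrite addr0.
congr ode_sol; apply/funext => x; rewrite /kapp /kapp1 ?wconvS ?phip0 ?phip10 //.
Qed.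

Lemma kapm_at0 n r : kapm n.+1 r 0 = cP n r + cM n r.
Proof.
rewrite /kapm wconvS ?phim0 // /cP /cM -big_split /=; apply: eq_bigr => q _.
by rewrite (phim_at0 al0 Hal Hg Het Hs) mulrDr.
Qed.

Lemma kapm1_at0 n r : kapm1 n.+1 r 0 = cM n r - cP n r.
Proof.
rewrite /kapm1 wconvS ?phim10 // /cP /cM -sumrB /=; apply: eq_bigr => q _.
by rewrite (phim1_at0 al0 Hal Hg Het Hs) mulrBr.
Qed.

Lemma kapp_at0 n r : 0 <= r -> kapp n.+1 r 0 = cP n r + cM n r.
Proof.
move=> r0; rewrite /kapp /rho_plus sub0r ltNge oppr_le0 r0 /= mulr0 addr0.
rewrite wconvS ?phip0 // /cP /cM -big_split /=; apply: eq_bigr => q _.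
by rewrite phip_at0 // mulrDr.
Qed.

Lemma kapp1_at0 n r : 0 <= r -> kapp1 n.+1 r 0 = cP n r - cM n r.
Proof.
move=> r0; rewrite /kapp1 /rho_plus1 sub0r ltNge oppr_le0 r0 /= mulr0 addr0.
rewrite wconvS ?phip10 // /cP /cM -sumrB /=; apply: eq_bigr => q _.
by rewrite phip1_at0 // mulrBr.
Qed.

Lemma kapm_continuous n r : continuous (kapm n.+1 r).
Proof. by move=> x; exact: isd_continuous ((kapm_ode n r).1 x). Qed.

Lemma kapp_continuous n r : continuous (kapp n.+1 r).
Proof.
have H := ode_sol_sum (fun q : 'I_n.+1 => ode_solZ (wexp r q) (phip_ode al g et s (n - q)%N)).
have H1 : continuous (fun x => wconv r (phip^~ x) n.+1).
  rewrite (_ : (fun x => _) = (fun x => \sum_(q < n.+1) wexp r q * phip (n - q).+1 x)).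
    by move=> x; exact: isd_continuous (H.1 x).
  by apply/funext => y; rewrite wconvS ?phip0.
have H2 : continuous (fun x => expR (- n.+1%:R * r) * rho_plus n r x).
  by apply: contM; [move=> x; exact: cst_continuous|exact: rho_plus_continuous].
exact: (contD H1 H2).
Qed.

Lemma kapm1_lim n r : expR (- x) * kapm1 n r x @[x --> +oo%R] --> (0 : R).
Proof.
pose F q p x : R := wexp r q * ((- p%:R * cA p (n - q)) * (expR (- x) * expR (- p%:R * x))).
apply: (lim_ext (g := fun x => \sum_(q < n.+1) \sum_(p < (n - q).+1) F q p x)) => //.
  move=> x; rewrite mulr_sumr; apply: eq_bigr => q _.
  rewrite mulrCA -mulr_sumr; congr (_ * _); rewrite mulr_sumr.
  by apply: eq_bigr => p _; rewrite mulrCA.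
apply: lim_sum0 => q; apply: lim_sum0 => p; do 2!apply: limZ0.
exact: lim_exp_exp.
Qed.

Lemma phip1_lim m : expR (- x) * phip1 m x @[x --> +oo%R] --> (delta_seq 1 m : R).
Proof.
apply: (lim_ext (g := fun x : R => delta_seq 1 m +
   plin m * (expR (- x) * expR (- (m - 2)%:R * x)
     + (- (m - 2)%:R) * (expR (- x) * (x * expR (- (m - 2)%:R * x)))) +
   \sum_(p < m.+1) (- p%:R * cB p m) * (expR (- x) * expR (- p%:R * x)))) => //.
  move=> x; rewrite /phip1 !mulrDr mulr_sumr; congr (_ + _ + _).
  - rewrite mulrCA; have -> : expR (- x) * (1 * expR (1 * x)) = 1 :> R.
      by rewrite !mul1r -expRD addNr expR0.
    by rewrite mulr1.
  - by ring.
  - by apply: eq_bigr => p _; rewrite mulrCA.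
rewrite -[X in _ --> X]addr0 -[X in _ --> X + _]addr0; apply: cvgD; first apply: cvgD.
- exact: cvg_cst.
- apply: limZ0; rewrite -(addr0 0); apply: cvgD; first exact: lim_exp_exp.
  by apply: limZ0; exact: lim_exp_id.
- by apply: lim_sum0 => p; apply: limZ0; exact: lim_exp_exp.
Qed.

Lemma rhoS1_lim m : expR (- x) * rhoS1 m x @[x --> +oo%R] --> (- (wq m) : R).
Proof.
apply: (lim_ext (g := fun x : R => \sum_(p < m) rho_coef m p *
    ((-1 - p%:R * (hsum (m.-1 - p) - hsum p)) * (expR (- x) * expR (- p%:R * x))
     + p%:R * (expR (- x) * (x * expR (- p%:R * x))))
  + wq m * (- m%:R * (expR (- x) * expR (- m%:R * x)) - 1))) => //.
  move=> x; rewrite /rhoS1 mulrDr mulr_sumr; congr (_ + _).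
    by apply: eq_bigr => p _; ring.
  have e1 : expR (- x) * expR (1 * x) = 1 :> R by rewrite mul1r -expRD addNr expR0.
  have -> : expR (- x) * ((-1) ^+ m / sfact m * (- m%:R * expR (- m%:R * x) - 1 * expR (1 * x))) =
    wq m * (- m%:R * (expR (- x) * expR (- m%:R * x)) - expR (- x) * expR (1 * x)) by rewrite /wq; ring.
  by rewrite e1.
rewrite -[X in _ --> X]add0r; apply: cvgD.
  apply: lim_sum0 => p; apply: limZ0; rewrite -(addr0 0); apply: cvgD; apply: limZ0.
    exact: lim_exp_exp.
  exact: lim_exp_id.
rewrite -[X in _ --> X]mulrN1; apply: cvgMr; rewrite -[X in _ --> X]sub0r; apply: cvgB; last exact: cvg_cst.
by apply: limZ0; exact: lim_exp_exp.
Qed.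

Lemma rho_plus1_lim m r : expR (- x) * rho_plus1 m r x @[x --> +oo%R] --> (- (wq m) * expR (- r) : R).
Proof.
have H : expR (- r) * (expR (- (x - r)) * rhoS1 m (x - r)) @[x --> +oo%R] -->
    (expR (- r) * (- (wq m))).
  exact: cvgMr (lim_shift (f := fun x => expR (- x) * rhoS1 m x) r (@rhoS1_lim m)).
rewrite mulrC; apply: cvg_trans H; apply: near_eq_cvg; near=> x.
rewrite /rho_plus1 ifT; last first.
  by rewrite subr_gt0; near: x; apply: nbhs_pinfty_gt; exact: num_real.
by rewrite mulrA -expRD; congr (expR _ * _); ring.
Unshelve. all: by end_near. Qed.

(** Both parts grow like e^x: the convolution through [phip 1], reached at q = n, and the correction
    with the opposite coefficient. Their leading terms cancel. *)
Lemma kapp1_lim n r : expR (- x) * kapp1 n.+1 r x @[x --> +oo%R] --> (0 : R).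
Proof.
have E : \sum_(q < n.+2) wexp r q * delta_seq 1 (n.+1 - q)
    + expR (- n.+1%:R * r) * (- (wq n) * expR (- r)) = 0.
  have nn : (n < n.+2)%N by lia.
  rewrite (bigD1 (Ordinal nn)) //= big1 ?addr0; last first.
    move=> q /eqP qn; rewrite /delta_seq; case: eqP => [E|]; last by rewrite mulr0.
    by case: qn; apply/val_inj => /=; have := ltn_ord q; lia.
  rewrite subSnn /delta_seq eqxx mulr1 /wexp.
  have -> : expR (- (n + 2)%:R * r) = expR (- n.+1%:R * r) * expR (- r).
    by rewrite -expRD; congr expR; rewrite natrD -natr1; ring.
  by ring.
apply: (lim_ext (g := fun x => \sum_(q < n.+2) wexp r q * (expR (- x) * phip1 (n.+1 - q) x)
   + expR (- n.+1%:R * r) * (expR (- x) * rho_plus1 n r x)) _ (esym E)).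
  move=> x; rewrite /kapp1 /wconv mulrDr mulr_sumr [in RHS]mulrCA; congr (_ + _).
  by apply: eq_bigr => q _; rewrite mulrCA.
apply: cvgD; last by apply: cvgMr; exact: rho_plus1_lim.
by apply: lim_sum => q; apply: cvgMr; exact: phip1_lim.
Qed.

Definition kap n (t r : R) : R := if t <= 0 then kapm n r (- t) else kapp n r t.

Lemma kapP n (t r : R) : 0 <= r -> 0 <= t -> kap n.+1 t r = kapp n.+1 r t.
Proof.
move=> r0 t0; rewrite /kap; case: ifP => // t0'.
have -> : t = 0 by apply/eqP; rewrite eq_le t0 t0'.
by rewrite oppr0 kapm_at0 kapp_at0.
Qed.

Lemma kapN n (t r : R) : 0 <= t -> kap n.+1 (- t) r = kapm n.+1 r t.
Proof. by move=> t0; rewrite /kap oppr_le0 t0 opprK. Qed.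

(** At n = 1 the four matching identities form a linear system that determines these values, so no
    Bessel coefficient has to be computed. *)
Lemma low_coefs : [/\ cA 0 1 = 0, cA 1 1 = 1, cB 0 1 = 0 & cB 1 1 = 0].
Proof.
have A0 : cA 0 1 = 0 by rewrite /= /conv_seq big_ord_recr big_ord1 /= s0 al0 mul0r mulr0 addr0.
have B0 : cB 0 0 = 0 by rewrite cB00.
have H1 := matching_A al0 Hal Hg Het Hs 1; have H2 := matching_A' al0 Hal Hg Het Hs 1.
have H3 := matching_B al0 g0 Hal Hg Het Hs 1; have H4 := matching_B' al0 g0 Hal Hg Het Hs 1.
have eM : seqM 1 = cB 1 1.
  by rewrite /seqM /shift_seq subnn B0 /delta_seq /= mulr0 addr0 mulr0 addr0.
move: H1 H2 H3 H4; rewrite !big_ord_recr !big_ord0 eM.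
rewrite -[nat_of_ord _]/0%N -[nat_of_ord (ord_max : 'I_2)]/1%N /= -/(cA 1 1) -/(cB 1 1) -/(cB 0 1).
rewrite -/(cA 0 1) A0 /delta_seq /shift_seq /= => H1 H2 H3 H4.
split => //; lra.
Qed.

Lemma phip_1 x : phip 1 x = expR x.
Proof.
have [_ _ b0 b1] := low_coefs; rewrite /phip big_ord_recr big_ord1.
rewrite -[cB (widen_ord _ _) 1]/(cB 0 1) -[cB ord_max 1]/(cB 1 1) b0 b1.
by rewrite /delta_seq /plin /shift_seq /= !mul0r !addr0 !mul1r.
Qed.

Lemma phim_1 x : phim 1 x = expR (- x).
Proof.
have [a0 a1 _ _] := low_coefs; rewrite /phim big_ord_recr big_ord1.
rewrite -[cA (widen_ord _ _) 1]/(cA 0 1) -[cA ord_max 1]/(cA 1 1) a0 a1.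
by rewrite /= mul0r add0r mul1r mulN1r.
Qed.

Lemma wconv1 r (F : nat -> R) : F 0 = 0 -> wconv r F 1 = expR (- 2 * r) * F 1.
Proof.
by move=> F0; rewrite wconvS // big_ord1 /wexp /wq expr0 sfact0 divr1 mul1r.
Qed.

(** Above the diagonal the correction is e^{-r} (1 - e^{t-r}); it replaces e^{t-2r} by e^{-r}. *)
Lemma kap1E t r : 0 <= r -> kap 1 t r = step_density t r.
Proof.
move=> r0; have [t0|t0] := leP 0 t; last first.
  rewrite -[t]opprK kapN ?oppr_ge0 ?(ltW t0) // opprK step_density_ge ?(le_trans (ltW t0)) //.
  by rewrite /kapm wconv1 ?phim0 // phim_1 opprK mulrC.
rewrite kapP // /kapp wconv1 ?phip0 // phip_1 /rho_plus subr_gt0.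
case: ltP => [rt|tr]; last by rewrite step_density_ge // mulr0 addr0 mulrC.
rewrite step_density_le ?(ltW rt) // /rhoS big_ord0 add0r expr0 sfact0 divr1 mul1r oppr0 mul0r expR0.
have e : expR (-1 * r) * expR (1 * (t - r)) = expR (-2 * r) * expR t.
  by rewrite -!expRD; congr expR; ring.
by rewrite mulrBr e mulr1 addrCA subrr addr0 mulN1r.
Qed.

Lemma kap_backward n t r : 0 <= r -> (forall x, 0 <= kap n.+1 x r) ->
  (\int[mu]_(x in `[0%R, +oo[) (kap n.+1 x r * step_density t x)%:E +
   \int[mu]_(x in `[0%R, +oo[) (kap n.+1 (- x) r * step_density (- t) x)%:E
   = (kap n.+2 t r)%:E)%E.
Proof.
move=> r0 k0.
have I1 : forall u, (\int[mu]_(x in `[0%R, +oo[) (kap n.+1 x r * step_density u x)%:E =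
   \int[mu]_(x in `[0%R, +oo[) (kapp n.+1 r x * step_density u x)%:E)%E.
  move=> u; apply: eq_integral => x; rewrite inE /= in_itv /= andbT => x0.
  by rewrite kapP.
have I2 : forall u, (\int[mu]_(x in `[0%R, +oo[) (kap n.+1 (- x) r * step_density u x)%:E =
   \int[mu]_(x in `[0%R, +oo[) (kapm n.+1 r x * step_density u x)%:E)%E.
  move=> u; apply: eq_integral => x; rewrite inE /= in_itv /= andbT => x0.
  by rewrite kapN.
have p0 x : 0 <= x -> 0 <= kapp n.+1 r x by move=> x0; rewrite -kapP.
have m0 x : 0 <= x -> 0 <= kapm n.+1 r x by move=> x0; rewrite -kapN.
have [P1 P2] := kapp_ode n r; have [M1 M2] := kapm_ode n.+1 r.
have cp := @kapp_continuous n r; have cm := @kapm_continuous n r.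
rewrite I1 I2; have [t0|t0] := leP 0 t.
  rewrite (integral_step_density_le P1 P2 cp (@kapp1_lim n.+1 r) p0 t0).
  rewrite (integral_step_density_ge M2 cm (@kapm1_lim n.+2 r) m0) ?oppr_le0 //.
  rewrite kapp_at0 // kapp1_at0 // kapm1_at0 mulr0 oppr0 expR0 kapP // -EFinD; congr (_%:E); ring.
have t0' : 0 <= - t by rewrite oppr_ge0 ltW.
rewrite (integral_step_density_le M1 M2 cm (@kapm1_lim n.+2 r) m0 t0').
rewrite (integral_step_density_ge P2 cp (@kapp1_lim n.+1 r) p0) ?(ltW t0) //.
rewrite -[t in RHS]opprK kapN // kapm_at0 kapp1_at0 // kapm1_at0 mulr0 oppr0 expR0 opprK -EFinD.
by congr (_%:E); ring.
Qed.

(** [kap_backward] requires nonnegativity at n and exhibits the next kernel as a sum of integrals of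
    nonnegative functions. *)
Lemma kap_ge0 n t r : 0 <= r -> 0 <= kap n.+1 t r.
Proof.
move=> r0; elim: n t => [|n IH] t; first by rewrite kap1E // step_density_ge0.
rewrite -lee_fin -kap_backward //; apply: adde_ge0; apply: integral_ge0 => x _;
  by rewrite lee_fin mulr_ge0 // step_density_ge0.
Qed.

End kernel.

(** * Agreement with the closed formula *)

Section kernel_formula.
Context {R : realType}.
Variables al g et s : nat -> R.
Hypotheses (al0 : al 0 = 0) (g0 : g 0 = 0) (et0 : et 0 = 0) (s0 : s 0 = 0).
Local Notation cA := (cA al s).
Local Notation cB := (cB al g et s).

Lemma sum_widen0 (F : nat -> R) m n : (m <= n)%N -> (forall p, (m < p)%N -> F p = 0) ->
  \sum_(p < n.+1) F p = \sum_(p < m.+1) F p.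
Proof.
move=> mn F0; rewrite -(big_mkord xpredT F) (big_cat_nat (n := m.+1)) //= big_mkord.
rewrite [X in _ + X]big_nat_cond [X in _ + X]big1 ?addr0 // => p.
by rewrite andbT => /andP[mp _]; exact: F0.
Qed.

(** The square of indices up to n contains exactly the convolution: terms with q > n are absent, and
    those with p > n - q vanish by hypothesis. *)
Lemma shift_coefs_sum (F : nat -> nat -> R) (f : nat -> R) n r :
  (forall p m, (m < p)%N -> F p m = 0) ->
  \sum_(p < n.+1) \sum_(q < n.+1)
     shift_seq q (fun k => wq q * F p k) n * (f p * expR (- (q + 2)%:R * r)) =
  wconv r (fun m => \sum_(p < m.+1) F p m * f p) n.
Proof.
move=> F0; rewrite exchange_big /=; apply: eq_bigr => q _.
rewrite -(@sum_widen0 (fun p => F p (n - q)%N * f p) _ n) ?leq_subr //; last first.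
  by move=> p qp; rewrite F0 ?mul0r.
rewrite mulr_sumr; apply: eq_bigr => p _.
by rewrite /shift_seq -ltnS ltn_ord /wexp; ring.
Qed.

Lemma region1E n x r :
  \sum_(p < n.+1) \sum_(q < n.+1)
      ca al s n p q * expR (p%:R * (- x) - (q + 2)%:R * r) = kapm al s n r x.
Proof.
rewrite /kapm -(@shift_coefs_sum cA (fun p => expR (- p%:R * x))); last exact: cA_gt.
apply: eq_bigr => p _; apply: eq_bigr => q _; rewrite -expRD /ca.
by congr (_ * expR _); ring.
Qed.

Lemma sum_cbE n x r :
  \sum_(p < n.+1) \sum_(q < n.+1)
      cb al g et s n p q * expR (- p%:R * x - (q + 2)%:R * r) =
  wconv r (fun m => \sum_(p < m.+1) cB p m * expR (- p%:R * x)) n.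
Proof.
rewrite -(@shift_coefs_sum cB (fun p => expR (- p%:R * x))); last first.
  by move=> p m; exact: cB_gt.
apply: eq_bigr => p _; apply: eq_bigr => q _; rewrite -expRD /cb.
by congr (_ * expR _); ring.
Qed.

(** This is the formula for 0 < r' <= r, continued to all x so that it can be compared with the
    third case. *)
Definition smooth_part n (x r : R) : R :=
  (-1) ^+ n.-1 * expR (x - n.+1%:R * r) / sfact n.-1
    + \sum_(p < n.-1)
        (-1) ^+ n * x * expR (- p%:R * (x - r) - n%:R * r)
        / (sfact p * sfact (n - p - 2))
    + \sum_(p < n.+1) \sum_(q < n.+1)
        cb al g et s n p q * expR (- p%:R * x - (q + 2)%:R * r).

(** The three summands of [phip] give the three terms of the formula: e^x contributes only through q
    = n, and the linear terms appear with their index reversed. *)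
Lemma region2E n x r : smooth_part n.+1 x r = wconv r (fun m => phip al g et s m x) n.+1.
Proof.
rewrite /smooth_part sum_cbE /wconv /phip.
under [RHS]eq_bigr do rewrite !mulrDr.
rewrite !big_split /=; congr (_ + _ + _).
  have nn : (n < n.+2)%N by lia.
  rewrite (bigD1 (Ordinal nn)) //= big1 ?addr0; last first.
    move=> q /eqP qn; rewrite /delta_seq; case: eqP => [E|]; last by rewrite mul0r mulr0.
    by case: qn; apply/val_inj => /=; have := ltn_ord q; lia.
  rewrite subSnn /delta_seq eqxx !mul1r /wexp /wq expRD addn2.
  by rewrite (_ : - n.+2%:R * r = - (n.+2%:R * r)) ?mulNr //; ring.
rewrite big_ord_recr big_ord_recr /= subnn subSnn {2 3}/plin /shift_seq /= !mul0r !mulr0 !addr0.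
rewrite (reindex_inj rev_ord_inj) /=; apply: eq_bigr => q _.
have qn := ltn_ord q.
rewrite /plin /shift_seq (_ : 2 <= n.+1 - q)%N; last by lia.
rewrite fj1E add0r /wexp /wq.
have e1 : (n.+1 - q - 2 = n - q.+1)%N by lia.
have e2 : (n.+1 - (n - q.+1) - 2 = q)%N by lia.
rewrite e1 e2.
rewrite (_ : (-1) ^+ n.+1 = (-1) ^+ q * (-1) ^+ (n - q.+1)); last first.
  rewrite -exprD (_ : n.+1 = (q + (n - q.+1)).+2)%N; last by lia.
  by rewrite !exprS mulrA mulrNN !mul1r.
rewrite (_ : expR (- (n - q.+1)%:R * (x - r) - n.+1%:R * r) =
   expR (- (q + 2)%:R * r) * expR (- (n - q.+1)%:R * x)); last first.
  rewrite -expRD; congr expR; have -> : n.+1 = ((n - q.+1) + (q + 2))%N by lia.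
  by rewrite (natrD _ (n - q.+1)); ring.
by field; rewrite !factr_neq0.
Qed.

Lemma sum_diag (F : nat -> nat -> R) n :
  \sum_(p < n.+2) \sum_(q < n.+2) delta_seq (p + q + 2) n.+1 * F p q =
  \sum_(p < n) F p (n.-1 - p)%N.
Proof.
rewrite big_ord_recr big_ord_recr /=.
rewrite [X in _ + X + _]big1 ?addr0; last first.
  by move=> q _; rewrite /delta_seq; case: eqP => [|_]; [lia|rewrite mul0r].
rewrite [X in _ + X]big1 ?addr0; last first.
  by move=> q _; rewrite /delta_seq; case: eqP => [|_]; [lia|rewrite mul0r].
apply: eq_bigr => p _; have pn := ltn_ord p.
have qn : (n.-1 - p < n.+2)%N by lia.
rewrite (bigD1 (Ordinal qn)) //= big1 ?addr0; last first.
  move=> q /eqP nq; rewrite /delta_seq; case: eqP => [E|]; last by rewrite mul0r.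
  by case: nq; apply/val_inj => /=; lia.
by rewrite /delta_seq (_ : n.+1 == _) ?mul1r //; apply/eqP; lia.
Qed.

(** Passing from the second case to the third replaces the factor x by r, that is, adds -(x - r),
    while the monomials C_{p,q} - B_{p,q} with p + q + 2 = n + 1 add the differences of [hsum].
    Together with the change of the leading term this is [rhoS]. *)
Lemma region3E n x r :
  (-1) ^+ n * expR (- n%:R * x - r) / sfact n
    + \sum_(p < n)
        (-1) ^+ n.+1 * r * expR (- p%:R * (x - r) - n.+1%:R * r)
        / (sfact p * sfact (n.+1 - p - 2))
    + \sum_(p < n.+2) \sum_(q < n.+2)
        cc al g et s n.+1 p q * expR (- p%:R * x - (q + 2)%:R * r)
  = smooth_part n.+1 x r + expR (- n.+1%:R * r) * rhoS n (x - r).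
Proof.
have -> : \sum_(p < n.+2) \sum_(q < n.+2)
     cc al g et s n.+1 p q * expR (- p%:R * x - (q + 2)%:R * r) =
   \sum_(p < n.+2) \sum_(q < n.+2)
     cb al g et s n.+1 p q * expR (- p%:R * x - (q + 2)%:R * r) +
   \sum_(p < n) cdiff p (n.-1 - p) * expR (- p%:R * x - ((n.-1 - p)%N + 2)%:R * r).
  rewrite -(@sum_diag (fun p q => cdiff p q * expR (- p%:R * x - (q + 2)%:R * r))).
  rewrite -big_split; apply: eq_bigr => p _; rewrite -big_split; apply: eq_bigr => q _ /=.
  by rewrite /cc; ring.
rewrite /smooth_part /= /rhoS mulrDr.
set B := \sum_(p < n.+2) _.
have E1 : (-1) ^+ n * expR (- n%:R * x - r) / sfact n =
   (-1) ^+ n * expR (x - n.+2%:R * r) / sfact n +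
   expR (- n.+1%:R * r) * ((-1) ^+ n / sfact n * (expR (- n%:R * (x - r)) - expR (1 * (x - r)))).
  have -> : expR (- n%:R * x - r) = expR (- n.+1%:R * r) * expR (- n%:R * (x - r)).
    by rewrite -expRD; congr expR; rewrite -natr1; ring.
  have -> : expR (x - n.+2%:R * r) = expR (- n.+1%:R * r) * expR (1 * (x - r)).
    by rewrite -expRD; congr expR; rewrite -(natr1 n.+1); ring.
  by ring.
have E2 : \sum_(p < n) (-1) ^+ n.+1 * r * expR (- p%:R * (x - r) - n.+1%:R * r)
        / (sfact p * sfact (n.+1 - p - 2)) +
   \sum_(p < n) cdiff p (n.-1 - p) * expR (- p%:R * x - ((n.-1 - p)%N + 2)%:R * r) =
   \sum_(p < n) (-1) ^+ n.+1 * x * expR (- p%:R * (x - r) - n.+1%:R * r)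
        / (sfact p * sfact (n.+1 - p - 2)) +
   expR (- n.+1%:R * r) * \sum_(p < n) rho_coef n p *
      ((hsum (n.-1 - p) - hsum p - (x - r)) * expR (- p%:R * (x - r))).
  rewrite mulr_sumr -!big_split; apply: eq_bigr => p _ /=; have pn := ltn_ord p.
  rewrite /rho_coef /cdiff (_ : n.+1 - p - 2 = n.-1 - p)%N; last by lia.
  have -> : (-1) ^+ (p + (n.-1 - p)) = (-1) ^+ n.+1 :> R.
    rewrite (_ : n.+1 = (p + (n.-1 - p)).+2); last by lia.
    by rewrite !exprS mulrA mulrNN !mul1r.
  have -> : expR (- p%:R * x - ((n.-1 - p) + 2)%:R * r) =
      expR (- n.+1%:R * r) * expR (- p%:R * (x - r)).
    rewrite -expRD; congr expR; rewrite (_ : n.+1 = (p + (n.-1 - p + 2)))%N; last by lia.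
    by rewrite (natrD _ p); ring.
  have -> : expR (- p%:R * (x - r) - n.+1%:R * r) = expR (- n.+1%:R * r) * expR (- p%:R * (x - r)).
    by rewrite -expRD; congr expR; ring.
  by ring.
rewrite [X in _ + X]addrC addrA -(addrA _ _ (\sum_(p < n) cdiff _ _ * _)) E2 E1.
by ring.
Qed.

Hypotheses (Hal : has_genfun 0 al genalpha) (Hg : has_genfun 0 g genG)
  (Het : has_genfun 0 et genH) (Hs : has_genfun 0 s (@genS R)).

Lemma kernel_formulaE n x r : (0 < n)%N ->
  kernel_formula (ca al s) (cb al g et s) (cc al g et s) n x r = kap al g et s n x r.
Proof.
case: n => // n _; rewrite /kernel_formula /kap; case: ifP => x0.
  by rewrite -[x in LHS]opprK region1E.
case: ifP => xr.
  rewrite -/(smooth_part n.+1 x r) region2E /kapp /rho_plus ifF ?mulr0 ?addr0 //.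
  by rewrite subr_gt0 ltNge xr.
rewrite region3E region2E /kapp /rho_plus ifT //.
by rewrite subr_gt0 ltNge xr.
Qed.

End kernel_formula.

(** * Independence and the law of one step *)

Section measure_facts.
Context {R : realType}.
Local Notation mu := (@lebesgue_measure R).

(** f and the Radon-Nikodym derivative of nu have the same integral over every measurable set, so
    they agree almost everywhere and are interchangeable under the integral. *)
Lemma integral_density d (T : measurableType d) (nu : {finite_measure set T -> \bar R})
    (la : {sigma_finite_measure set T -> \bar R}) (f g : T -> \bar R) :
  measurable_fun [set: T] f -> (forall x, (0 <= f x)%E) ->
  (forall A, measurable A -> nu A = (\int[la]_(x in A) f x)%E) ->
  measurable_fun [set: T] g -> (forall x, (0 <= g x)%E) ->
  (\int[nu]_x g x = \int[la]_x (g x * f x))%E.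
Proof.
move=> mf f0 nuE mg gg0.
have numu : nu `<< la.
  move=> N N0 B mB BN; rewrite nuE // null_set_integral //; last exact: N0.
  exact: measurable_funTS.
pose h := Radon_Nikodym_SigmaFinite.f nu la.
have mh : measurable_fun [set: T] h.
  exact: measurable_int (Radon_Nikodym_SigmaFinite.f_integrable numu).
have h0 x : (0 <= h x)%E by exact: Radon_Nikodym_SigmaFinite.f_ge0.
rewrite -(Radon_Nikodym_SigmaFinite.change_of_variables numu) //.
apply: ae_eq_integral => //; [exact: emeasurable_funM|exact: emeasurable_funM|].
have : ae_eq la setT h f.
  apply: integral_ae_eq => //.
    exact: Radon_Nikodym_SigmaFinite.f_integrable.
  by move=> E _ mE; rewrite -nuE // (Radon_Nikodym_SigmaFinite.f_integral numu).
by apply: filterS => x /= H _; rewrite -/h H.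
Qed.

Lemma integral_split_opp (f : R -> \bar R) : measurable_fun [set: R] f ->
  (forall x, (0 <= f x)%E) ->
  (\int[mu]_x f x = \int[mu]_(x in `[0%R, +oo[) f x + \int[mu]_(x in `[0%R, +oo[) f (- x)%R)%E.
Proof.
move=> mf f0.
have mfN : measurable_fun [set: R] (fun x => f (- x)%R).
  by apply: measurableT_comp => //; exact: oppr_measurable.
have E : [set: R] = `]-oo, 0%R[ `|` `[0%R, +oo[.
  by apply/seteqP; split => x //= _; rewrite !in_itv /= andbT; case: (ltP x 0); [left|right].
rewrite {1}E ge0_integral_setU //=; first last.
- by apply/disj_setPS => x [] /=; rewrite !in_itv /= andbT => x0 x1; move: (lt_le_trans x0 x1); rewrite ltxx.
- by rewrite -E.
rewrite addeC integral_itv_bndo_bndc; last exact: measurable_funTS.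
congr (_ + _)%E; rewrite (@ge0_integration_by_substitution0 _ (fun x => f (- x)%R)) //.
by apply: eq_integral => x _; rewrite opprK.
Qed.

Lemma ae_opp (Q : R -> Prop) : {ae mu, forall x, Q x} -> {ae mu, forall x, Q (- x)}.
Proof.
move=> [N [mN N0 NQ]]; exists (-%R @^-1` N); split.
- rewrite -[X in measurable X]setTI; exact: oppr_measurable.
- by rewrite -[LHS]/(pushforward mu (-%R : _ -> measurableTypeR R) N) lebesgue_measureN.
- by move=> x /= nQ; apply: NQ.
Qed.

End measure_facts.

Section independence.
Context {R : realType} {d : measure_display} {T : measurableType d}.
Variable P : probability T R.
Variables (I : eqType) (W : I -> {RV P >-> R}).
Hypothesis hW : mutually_independent W.

Definition cylinder (s : seq I) (A : I -> set R) : set T :=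
  \bigcap_(i in [set` s]) (W i @^-1` A i).

Lemma cylinder_cons i s A : cylinder (i :: s) A = W i @^-1` A i `&` cylinder s A.
Proof.
apply/seteqP; split=> x.
  by move=> H; split=> [|j /= js]; apply: H; rewrite /= inE ?eqxx // js orbT.
by move=> [h1 h2] j /=; rewrite inE => /orP[/eqP ->//|js]; exact: h2.
Qed.

Lemma cylinder_nil A : cylinder [::] A = setT.
Proof. by apply/seteqP; split=> x // _ j. Qed.

Lemma eq_cylinder s A A' : {in s, A =1 A'} -> cylinder s A = cylinder s A'.
Proof. by move=> AA'; apply: eq_bigcapr => i /= /AA' ->. Qed.

Lemma measurable_RV (U : {RV P >-> R}) (B : set R) : measurable B -> measurable (U @^-1` B).
Proof. by move=> mB; rewrite -[X in measurable X]setTI; exact: measurable_funP. Qed.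

Lemma measurable_cylinder s A : (forall i, measurable (A i)) -> measurable (cylinder s A).
Proof.
move=> mA; elim: s => [|i s IH]; first by rewrite cylinder_nil.
by rewrite cylinder_cons; apply: measurableI => //; exact: measurable_RV.
Qed.

Lemma cylinder_prob_cons i s A : uniq (i :: s) -> (forall i, measurable (A i)) ->
  P (cylinder (i :: s) A) = (P (W i @^-1` A i) * P (cylinder s A))%E.
Proof.
move=> us mA; rewrite /cylinder hW // big_cons hW //.
by move: us => /= /andP[].
Qed.

(** This is independence of U from the family of the W i with i in S. Testing finite cylinders
    suffices to let U absorb one W i at a time, as [indep_combine] does. *)
Definition indep_from (S : pred I) (U : T -> R) : Prop :=
  forall (s : seq I) (A : I -> set R) (B : set R), uniq s -> all S s ->
    (forall i, measurable (A i)) -> measurable B ->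
    P (U @^-1` B `&` cylinder s A) = (P (U @^-1` B) * P (cylinder s A))%E.

Lemma indep_from_sub (S S' : pred I) U : subpred S' S -> indep_from S U -> indep_from S' U.
Proof. by move=> SS' H s A B us sS; apply: H => //; exact: sub_all sS. Qed.

Lemma indep_from_cst S c : indep_from S (fun _ : T => c).
Proof.
move=> s A B _ _ mA mB; rewrite preimage_cst; case: ifP => _.
  by rewrite setTI probability_setT mul1e.
by rewrite set0I measure0 mul0e.
Qed.

Lemma indep_from_W i0 : indep_from [pred i | i != i0] (W i0).
Proof.
move=> s A B us si mA mB.
pose A' i := if i == i0 then B else A i.
have i0s : i0 \notin s by apply/negP => /(allP si); rewrite /= eqxx.
have mA' i : measurable (A' i) by rewrite /A'; case: ifP.
have := @cylinder_prob_cons i0 s A' _ mA'; rewrite /= i0s us cylinder_cons => /(_ erefl).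
rewrite {1 3}/A' eqxx (@eq_cylinder s A' A) // => i is_.
by rewrite /A'; case: eqP => // ii; rewrite ii (negbTE i0s) in is_.
Qed.

Section combine.
Variables (S : pred I) (U : T -> R) (i0 : I) (phi : R * R -> R).
Hypotheses (mU : measurable_fun [set: T] U) (mphi : measurable_fun [set: R * R] phi)
  (Si0 : S i0) (hU : indep_from S U).

Let Uf : {RV P >-> R} := HB.pack U (isMeasurableFun.Build _ _ _ _ _ mU).

Let pr (w : T) : R * R := (U w, W i0 w).

Let mpr : measurable_fun [set: T] pr.
Proof. by apply: measurable_fun_pair; [exact: mU|exact: measurable_funP]. Qed.

Lemma joint_law (Y : set (R * R)) : measurable Y ->
  (distribution P Uf \x distribution P (W i0))%E Y = P (pr @^-1` Y).
Proof.
move: Y; apply: (@product_measure_unique _ _ _ _ _ (distribution P Uf) (distribution P (W i0)) (pushforward P pr)).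
  move=> B1 B2 mB1 mB2.
  have := hU (s := [:: i0]) (A := fun=> B2) erefl; rewrite /= Si0 => /(_ B1 erefl (fun=> mB2) mB1).
  rewrite cylinder_cons cylinder_nil setIT => <-.
  by rewrite /pushforward; congr (P _); apply/seteqP; split.
Qed.

(** Conditioned on the cylinder, the law of the pair is the same product measure on rectangles,
    hence on all measurable sets. A cylinder of probability zero is treated apart, since
    conditioning divides by its probability. *)
Lemma joint_law_cylinder s A : uniq s -> all [pred i | S i && (i != i0)] s ->
  (forall i, measurable (A i)) -> forall X, measurable X ->
  P (pr @^-1` X `&` cylinder s A) = (P (pr @^-1` X) * P (cylinder s A))%E.
Proof.
move=> us sS mA X mX.
have mE : measurable (cylinder s A) by exact: measurable_cylinder.
have i0s : i0 \notin s by apply/negP => /(allP sS); rewrite /= eqxx andbF.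
have sS' : all S s by apply: sub_all sS => i /andP[].
have rect (B1 B2 : set R) : measurable B1 -> measurable B2 ->
   P (pr @^-1` (B1 `*` B2) `&` cylinder s A) =
   (P (U @^-1` B1) * P (cylinder s A) * P (W i0 @^-1` B2))%E.
  move=> mB1 mB2; pose A' i := if i == i0 then B2 else A i.
  have mA' i : measurable (A' i) by rewrite /A'; case: ifP.
  have E : cylinder (i0 :: s) A' = W i0 @^-1` B2 `&` cylinder s A.
    rewrite cylinder_cons {1}/A' eqxx (@eq_cylinder s A' A) // => i is_.
    by rewrite /A'; case: eqP => // ii; rewrite ii (negbTE i0s) in is_.
  have us' : uniq (i0 :: s) by rewrite /= i0s us.
  rewrite (_ : _ `&` _ = U @^-1` B1 `&` cylinder (i0 :: s) A'); last first.
    by rewrite E setIA; congr (_ `&` _); apply/seteqP; split.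
  rewrite hU //=; last by rewrite Si0 sS'.
  rewrite cylinder_prob_cons // {1}/A' eqxx (@eq_cylinder s A' A); last first.
    by move=> i is_; rewrite /A'; case: eqP => // ii; rewrite ii (negbTE i0s) in is_.
  by rewrite -muleA; congr (_ * _)%E; rewrite muleC.
rewrite -joint_law //.
have [E0|E0] := eqVneq (P (cylinder s A)) 0%E.
  rewrite E0 mule0; apply/eqP; rewrite eq_le measure_ge0 andbT -E0.
  apply: le_measure; rewrite ?inE //.
  apply: measurableI => //; rewrite -[X in measurable X]setTI; exact: mpr.
have Efin : P (cylinder s A) \is a fin_num by exact: fin_num_measure.
have PE0 : 0 < fine (P (cylinder s A)).
  by rewrite fine_gt0 // lt0e E0 measure_ge0 /= ltey_eq Efin.
have c0 : 0 <= (fine (P (cylinder s A)))^-1 by rewrite invr_ge0 ltW.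
pose c : {nonneg R} := NngNum c0.
have cE : (c%:num%:E * P (cylinder s A) = 1)%E.
  by rewrite /c /= -[X in (_ * X)%E](fineK Efin) -EFinM mulVf // gt_eqF.
pose m' : {measure set (R * R)%type -> \bar R} := mscale c (pushforward (mrestr P mE) pr).
have := @product_measure_unique _ _ _ _ _ (distribution P Uf) (distribution P (W i0)) (m' mpr) _ X mX.
move=> -> //.
  by rewrite -[X in _ = (X * _)%E]/(c%:num%:E * P (pr @^-1` X `&` cylinder s A))%E muleAC cE mul1e.
move=> B1 B2 mB1 mB2.
rewrite -[LHS]/(c%:num%:E * P (pr @^-1` (B1 `*` B2) `&` cylinder s A))%E rect //.
by rewrite [(P (U @^-1` B1) * P (cylinder s A))%E]muleC !muleA cE mul1e.
Qed.

Lemma indep_combine :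
  indep_from [pred i | S i && (i != i0)] (fun w => phi (U w, W i0 w)).
Proof.
move=> s A B us sS mA mB.
rewrite -[_ @^-1` B]/(pr @^-1` (phi @^-1` B)) joint_law_cylinder //.
by rewrite -[X in measurable X]setTI; exact: mphi.
Qed.

(** Tonelli for the product law; the independent copy of W i0 is realized on the same space by a
    second integration variable. *)
Lemma integral_combine (g : R -> \bar R) : measurable_fun [set: R] g ->
  (forall x, (0 <= g x)%E) ->
  (\int[P]_w g (phi (U w, W i0 w)) = \int[P]_w \int[P]_w' g (phi (U w, W i0 w')))%E.
Proof.
move=> mg g0.
have mgphi : measurable_fun [set: R * R] (g \o phi) by exact: measurableT_comp.
transitivity (\int[pushforward P pr]_z (g \o phi) z)%E.
  by rewrite (ge0_integral_pushforward mpr) // => y _; exact: g0.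
transitivity (\int[(distribution P Uf \x distribution P (W i0))%E]_z (g \o phi) z)%E.
  by apply: eq_measure_integral => A mA _; apply/esym; exact: joint_law.
rewrite fubini_tonelli1 //; last by move=> z; exact: g0.
have gphi0 z : (0 <= (g \o phi) z)%E by exact: g0.
have mF : measurable_fun [set: R] (fubini_F (distribution P (W i0)) (g \o phi)).
  exact: measurable_fun_fubini_tonelli_F.
have F0 x : (0 <= fubini_F (distribution P (W i0)) (g \o phi) x)%E.
  by apply: integral_ge0 => y _; exact: g0.
rewrite (ge0_integral_distribution Uf mF F0).
apply: eq_integral => w _ /=; rewrite /fubini_F.
rewrite ge0_integral_distribution //.
exact: measurableT_comp.
Qed.

End combine.
End independence.

(** * One step of the chain and its Markov property *)

Section one_step.
Context {R : realType} {d : measure_display} {T : measurableType d}.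
Variable P : probability T R.
Variables X Y Z : nat -> {RV P >-> R}.
Hypothesis hW : iid_exponential_weights X Y Z.
Local Notation W := (edge_weight X Y Z).
Local Notation mu := (@lebesgue_measure R).

Definition edge_index (e : nat + (nat + nat)) : nat :=
  match e with inl i | inr (inl i) | inr (inr i) => i end.

Definition one_step n (u : R) (w : T) : R :=
  Num.min (u + Y n w) (X n w + Z n w) - Num.min (u + Y n w + Z n w) (X n w).

(** For z >= 0 this sends (a, z) to a clamped to [-z, z]. *)
Definition clampp (x : R * R) : R := Num.min x.1 x.2 - Num.min (x.1 + x.2) 0.

Lemma one_stepE n u w : one_step n u w = clampp (u + Y n w - X n w, Z n w).
Proof.
rewrite /one_step /clampp /=; move: (u + Y n w) (X n w) (Z n w) => a b c.
case: (leP a (b + c)) => ?; case: (leP (a + c) b) => ?; case: (leP (a - b) c) => ?;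
  case: (leP (a - b + c) 0) => ?; lra.
Qed.

Lemma measurable_clampp : measurable_fun [set: R * R] clampp.
Proof.
apply: measurable_funB; apply: measurable_minr => //.
by apply: measurable_funD.
Qed.

Lemma measurable_param (F : R * T -> \bar R) : measurable_fun [set: R * T] F ->
  (forall z, (0 <= F z)%E) -> measurable_fun [set: R] (fun u => \int[P]_w F (u, w))%E.
Proof.
move=> mF F0; have : measurable_fun [set: R] (fubini_F P F).
  exact: measurable_fun_fubini_tonelli_F.
by [].
Qed.

Lemma measurable_param_RV (g : R -> \bar R) (phi : R * R -> R) (V : {RV P >-> R}) :
  measurable_fun [set: R] g -> (forall x, (0 <= g x)%E) -> measurable_fun [set: R * R] phi ->
  measurable_fun [set: R] (fun u => \int[P]_w g (phi (u, V w)))%E.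
Proof.
move=> mg g0 mphi; apply: (@measurable_param (fun z => g (phi (z.1, V z.2)))) => //.
apply: measurableT_comp => //; apply: measurableT_comp => //.
apply: measurable_fun_pair => //; exact: measurableT_comp.
Qed.

Definition one_step_integral n (g : R -> \bar R) (u : R) : \bar R :=
  (\int[P]_w g (one_step n u w))%E.

(** The weights Y n, X n, Z n are absorbed one after another. Each absorption removes one index from
    the family of which the state is independent and adds one inner integral. *)
Lemma step_chain n (U : T -> R) (S : pred (nat + (nat + nat))) (g : R -> \bar R) :
  measurable_fun [set: T] U -> indep_from W S U ->
  S (inl n) -> S (inr (inl n)) -> S (inr (inr n)) ->
  measurable_fun [set: R] g -> (forall x, (0 <= g x)%E) ->
  indep_from W [pred e | [&& S e, e != inl n, e != inr (inl n) & e != inr (inr n)]]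
     (fun w => one_step n (U w) w) /\
  (\int[P]_w g (one_step n (U w) w) =
   \int[P]_w \int[P]_y \int[P]_x \int[P]_z g (clampp ((U w + Y n y - X n x)%R, Z n z)))%E.
Proof.
move=> mU iU Sx Sy Sz mg g0; have [hI _] := hW.
have mD : measurable_fun [set: R * R] (fun p : R * R => p.1 + p.2) by exact: measurable_funD.
have mB : measurable_fun [set: R * R] (fun p : R * R => p.1 - p.2) by exact: measurable_funB.
pose V1 w := U w + Y n w; pose V2 w := V1 w - X n w.
have mV1 : measurable_fun [set: T] V1 by exact: measurable_funD.
have mV2 : measurable_fun [set: T] V2 by exact: measurable_funB.
have i1 := indep_combine hI mU mD Sy iU.
have S1 : [pred i | S i & i != inr (inl n)] (inl n) by rewrite /= Sx.
have i2 := indep_combine hI mV1 mB S1 i1.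
set S2 := [pred i | _ & i != inl n] in i2.
have S2z : S2 (inr (inr n)) by rewrite /= Sz.
have i3 := indep_combine hI mV2 measurable_clampp S2z i2.
have E w : one_step n (U w) w = clampp (V2 w, Z n w) by rewrite one_stepE.
split.
  rewrite (_ : (fun w => one_step n (U w) w) = (fun w => clampp (V2 w, W (inr (inr n)) w))).
    apply: indep_from_sub i3 => i /=; rewrite /S2 /=.
    by move=> /and4P[-> -> -> ->].
  by apply/funext => w; rewrite E.
under eq_integral do rewrite E.
rewrite (integral_combine mV2 measurable_clampp S2z i2 mg g0).
have mg1 : measurable_fun [set: R] (fun u => \int[P]_w g (clampp (u, Z n w)))%E.
  exact: measurable_param_RV measurable_clampp.
have g10 u : (0 <= \int[P]_w g (clampp (u, Z n w)))%E by apply: integral_ge0 => w _; exact: g0.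
rewrite [LHS](integral_combine mV1 mB S1 i1 mg1 g10).
have mg2 : measurable_fun [set: R] (fun u => \int[P]_x \int[P]_w g (clampp ((u - X n x)%R, Z n w)))%E.
  exact: (measurable_param_RV (phi := fun p => p.1 - p.2) (X n) mg1 g10).
have g20 u : (0 <= \int[P]_x \int[P]_w g (clampp ((u - X n x)%R, Z n w)))%E.
  by apply: integral_ge0 => w _; exact: g10.
by rewrite [LHS](integral_combine mU mD Sy iU mg2 g20).
Qed.

Lemma step_integral n (U : T -> R) (S : pred (nat + (nat + nat))) (g : R -> \bar R) :
  measurable_fun [set: T] U -> indep_from W S U ->
  S (inl n) -> S (inr (inl n)) -> S (inr (inr n)) ->
  measurable_fun [set: R] g -> (forall x, (0 <= g x)%E) ->
  (\int[P]_w g (one_step n (U w) w) = \int[P]_w one_step_integral n g (U w))%E.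
Proof.
move=> mU iU Sx Sy Sz mg g0; rewrite (step_chain mU iU Sx Sy Sz mg g0).2.
apply: eq_integral => w _; rewrite /one_step_integral.
(* The same expansion for the constant state U w computes the right-hand side, whose outer integral
   is then over a constant. *)
have ic := @indep_from_cst _ _ _ P _ W predT (U w).
rewrite (step_chain (measurable_cst _) ic erefl erefl erefl mg g0).2.
set K := (\int[P]_y _)%E.
by rewrite -[RHS]/(\int[P]_w0 (cst K) w0)%E integral_cst //= [X in (_ * X)%E]probability_setT mule1.
Qed.

Lemma Delta_indep r' n : measurable_fun [set: T] (Delta X Y Z r' n) /\
  indep_from W [pred e | (n <= edge_index e)%N] (Delta X Y Z r' n).
Proof.
elim: n => [|n [mD iD]].
  by split; [exact: measurable_cst|exact: indep_from_cst].
split.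
  have mX := measurable_funP (X n); have mY := measurable_funP (Y n).
  have mZ := measurable_funP (Z n).
  apply: measurable_funB; apply: measurable_minr => //; do ?apply: measurable_funD => //.
have := (step_chain mD iD (leqnn n) (leqnn n) (leqnn n) (measurable_cst 0%E) (fun=> lexx _)).1.
apply: indep_from_sub => e /= ne; rewrite (ltnW ne) /=.
by apply/and3P; split; apply: contraTneq ne => -> /=; rewrite ltnn.
Qed.

Lemma Delta_step r' n (g : R -> \bar R) : measurable_fun [set: R] g -> (forall x, (0 <= g x)%E) ->
  (\int[P]_w g (Delta X Y Z r' n.+1 w) =
   \int[P]_w one_step_integral n g (Delta X Y Z r' n w))%E.
Proof.
move=> mg g0; have [mD iD] := Delta_indep r' n.
exact: (step_integral mD iD (leqnn n) (leqnn n) (leqnn n) mg g0).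
Qed.

End one_step.

(** * The one-step density as a probability law on the line *)

Section step_density_mass.
Context {R : realType}.
Local Notation mu := (@lebesgue_measure R).

Lemma integral_step_density a t :
  (\int[mu]_(x in `[a, +oo[) (step_density t x)%:E =
   (if a <= t then expR (- a) - expR (- t) / 2 else expR t * expR (- 2 * a) / 2)%:E)%E.
Proof.
(* The half-line formulas apply with g = 1, c = 1/2 and f = 0, for which 2c - g vanishes. *)
have d0 (x : R) : is_derive x (1 : R) (fun=> 0 : R) 0 by exact: isd_cst.
have d1 (x : R) : is_derive x (1 : R) (fun=> 0 : R) (0 + (2 * 2^-1 - 1) * expR (- x)).
  by apply: isd_eq (isd_cst 0 x) _; rewrite mulfV ?pnatr_eq0 // subrr mul0r addr0.
have cg : continuous (fun _ : R => 1 : R) by move=> x; exact: isd_continuous (isd_cst 1 x).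
have lim1 : expR (- x) * 0 @[x --> +oo%R] --> (0 : R).
  by under eq_fun do rewrite mulr0; exact: cvg_cst.
have g0 : forall x, a <= x -> 0 <= (1 : R) by [].
rewrite (@eq_integral _ _ _ mu _ (fun x => (1 * step_density t x)%:E)); last first.
  by move=> x _; rewrite mul1r.
case: ifP => [at_|/negbT]; last rewrite -ltNge => /ltW ta.
  by rewrite (integral_step_density_le d0 d1 cg lim1 g0 at_); congr (_%:E); field.
by rewrite (integral_step_density_ge d1 cg lim1 g0 ta); congr (_%:E); field.
Qed.

(** The right side is the factored tail P(t + Y - X > r) P(Z > r) for r >= 0; the equation
    recognizes it as the tail of the density. *)
Lemma integral_step_density_shift r t :
  (\int[mu]_(x in `[r, +oo[) (step_density t x)%:E =
   (\int[mu]_(x in `[0%R, +oo[) (step_density (t - r) x)%:E) * (expR (- r))%:E)%E.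
Proof.
rewrite !integral_step_density subr_ge0 -EFinM; congr (_%:E).
rewrite oppr0 mulr0 expR0 mulr1; case: ifP => _.
  have e : expR (- (t - r)) * expR (- r) = expR (- t).
    by rewrite -expRD; congr expR; ring.
  by rewrite mulrBl mul1r [X in _ = _ - X]mulrAC e.
have e : expR (t - r) * expR (- r) = expR t * expR (-2 * r).
  by rewrite -!expRD; congr expR; ring.
by rewrite [RHS]mulrAC e.
Qed.

Lemma step_density_mass t :
  (\int[mu]_(x in `[0%R, +oo[) (step_density t x)%:E +
   \int[mu]_(x in `[0%R, +oo[) (step_density (- t) x)%:E = 1)%E.
Proof.
rewrite !integral_step_density -EFinD oppr0 mulr0 expR0 !mulr1 oppr_ge0 opprK.
have [t0|t0] := leP 0 t; last by rewrite (ltW t0); congr (_%:E); ring.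
case: ifP => t0'; last by congr (_%:E); ring.
have -> : t = 0 by apply/eqP; rewrite eq_le t0 t0'.
by rewrite oppr0 expR0; congr (_%:E); field.
Qed.

(** Interchanging X and Y reflects the step, which defines the density at negative points. *)
Definition full_density t x : R :=
  if 0 <= x then step_density t x else step_density (- t) (- x).

Lemma full_density_ge0 t x : 0 <= full_density t x.
Proof. by rewrite /full_density; case: ifP => _; exact: step_density_ge0. Qed.

Lemma measurable_full_density2 d (T : measurableType d) (h k : T -> R) :
  measurable_fun [set: T] h -> measurable_fun [set: T] k ->
  measurable_fun [set: T] (fun x => full_density (h x) (k x)).
Proof.
move=> mh mk; apply: measurable_fun_ifT.
- exact: measurable_fun_ler.
- exact: measurable_step_density2.
- by apply: measurable_step_density2; exact: measurableT_comp.
Qed.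

Lemma measurable_full_density t : measurable_fun [set: R] (full_density t).
Proof. exact: measurable_full_density2. Qed.

Definition density_law t (A : set R) : \bar R := (\int[mu]_(x in A) (full_density t x)%:E)%E.

Section density_law_measure.
Variable t : R.

Let density_law0 : density_law t set0 = 0%E.
Proof. by rewrite /density_law integral_set0. Qed.

Let density_law_ge0 A : (0 <= density_law t A)%E.
Proof. by apply: integral_ge0 => x _; rewrite lee_fin full_density_ge0. Qed.

Let density_law_sigma_additive : semi_sigma_additive (density_law t).
Proof.
move=> /= F mF tF mUF; rewrite /density_law; apply: cvg_toP.
  apply: ereal_nondecreasing_is_cvgn => m n mn.
  apply: lee_sum_nneg_natr => // k _ _; apply: integral_ge0 => /= x Fkx.
  by rewrite lee_fin full_density_ge0.
rewrite ge0_integral_bigcup//=.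
- by apply/measurable_funTS/measurable_EFinP; exact: measurable_full_density.
- by move=> x _; rewrite lee_fin full_density_ge0.
Qed.

HB.instance Definition _ := isMeasure.Build _ _ _
  (density_law t) density_law0 density_law_ge0 density_law_sigma_additive.

End density_law_measure.

Lemma density_law_setT t : density_law t setT = 1%E.
Proof.
rewrite /density_law integral_split_opp; last by move=> x; rewrite lee_fin full_density_ge0.
  rewrite -[RHS](step_density_mass t); congr (_ + _)%E.
    by apply: eq_integral => x; rewrite inE /= in_itv /= andbT /full_density => ->.
  rewrite -integral_itv_obnd_cbnd; last first.
    apply/measurable_funTS/measurable_EFinP.
    by apply: measurable_full_density2 => //; exact: measurable_cst.
  rewrite -[RHS]integral_itv_obnd_cbnd; last first.
    by apply/measurable_funTS/measurable_EFinP; exact: measurable_step_density.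
  apply: eq_integral => x; rewrite inE /= in_itv /= andbT /full_density oppr_ge0 opprK => x0.
  by rewrite leNgt x0.
by apply/measurable_EFinP; exact: measurable_full_density.
Qed.

Lemma density_law_ray t r : 0 <= r -> density_law t `]r, +oo[ =
  ((\int[mu]_(x in `[0%R, +oo[) (step_density (t - r) x)%:E) * (expR (- r))%:E)%E.
Proof.
move=> r0; rewrite -integral_step_density_shift -integral_itv_obnd_cbnd; last first.
  by apply/measurable_funTS/measurable_EFinP; exact: measurable_step_density.
apply: eq_integral => x; rewrite inE /= in_itv /= andbT /full_density => rx.
by rewrite (le_trans r0 (ltW rx)).
Qed.

Lemma continuous_step_density (t : R) : continuous (step_density t).
Proof.
have H1 : continuous (fun x : R => expR (- x)).
  by move=> x; apply: continuous_comp; [exact: oppr_continuous|exact: continuous_expR].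
have H2 : continuous (fun x : R => Num.min 1 (expR (t - x))).
  move=> x; have h1 : {for x, continuous (fun _ : R => 1 : R)} by exact: isd_continuous (isd_cst 1 x).
  have h2 : {for x, continuous (fun x => expR (t - x))}.
    apply: (@continuous_comp _ _ _ (fun x => t - x) expR); last exact: continuous_expR.
    exact: isd_continuous (isdB (isd_cst t x) (isd_id x)).
  exact: (continuous_min h1 h2).
exact: contM H1 H2.
Qed.

Lemma density_law_rayN t r : r < 0 -> density_law t `]-oo, r] =
  ((\int[mu]_(x in `[0%R, +oo[) (step_density (r - t) x)%:E) * (expR r)%:E)%E.
Proof.
move=> r0; have S := integral_step_density_shift (- r) (- t).
rewrite opprK [- t + r]addrC in S; rewrite -S.
pose G (x : R) : R := step_density (- t) (- x).
transitivity (\int[mu]_(x in `]-oo, (- - r)%R]) (G x)%:E)%E.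
  rewrite opprK; apply: eq_integral => x; rewrite inE /= in_itv /= /full_density => xr.
  by rewrite leNgt (le_lt_trans xr r0).
rewrite ge0_integration_by_substitutionNy.
- by apply: eq_integral => x _ /=; rewrite /G opprK.
- apply: continuous_subspaceT => x.
  apply: (@continuous_comp _ _ _ (fun x => - x) (step_density (- t))); first exact: oppr_continuous.
  exact: continuous_step_density.
- by move=> x _; exact: step_density_ge0.
Qed.

End step_density_mass.

Lemma integral_law_density {R : realType} d (T : measurableType d) (P : probability T R)
    (U : T -> R) (f g : R -> \bar R) :
  measurable_fun [set: T] U ->
  measurable_fun [set: R] f -> (forall x, (0 <= f x)%E) ->
  (forall A, measurable A -> P (U @^-1` A) = (\int[lebesgue_measure]_(x in A) f x)%E) ->
  measurable_fun [set: R] g -> (forall x, (0 <= g x)%E) ->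
  (\int[P]_w g (U w) = \int[lebesgue_measure]_x (g x * f x))%E.
Proof.
move=> mU mf f0 UE mg g0.
pose V : {RV P >-> measurableTypeR R} :=
  HB.pack (U : T -> measurableTypeR R) (isMeasurableFun.Build _ _ T (measurableTypeR R) U mU).
have := @integral_density R _ (measurableTypeR R) (distribution P V) (@lebesgue_measure R) f g
  mf f0 UE mg g0.
by rewrite (ge0_integral_distribution V mg g0).
Qed.

Section one_step_law.
Context {R : realType} {d : measure_display} {T : measurableType d}.
Variable P : probability T R.
Variables X Y Z : nat -> {RV P >-> R}.
Hypothesis hW : iid_exponential_weights X Y Z.
Local Notation W := (edge_weight X Y Z).
Local Notation mu := (@lebesgue_measure R).

(** The ray is closed for [true] and open for [false]; both occur, because > r is used for r >= 0
    and <= r for r < 0. *)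
Definition ray b (y : R) : set R := [set` Interval (BSide b y) +oo%O].

Lemma measurable_ray b y : measurable (ray b y).
Proof. exact: measurable_itv. Qed.

Lemma weight_law e A : measurable A -> P (W e @^-1` A) = exponential_prob 1 A.
Proof. by have [_ hE] := hW => mA; exact: (hE e A mA). Qed.

Lemma weight_ray_ge0 e b y : 0 <= y -> P (W e @^-1` ray b y) = (expR (- y))%:E.
Proof.
move=> y0; rewrite weight_law; last exact: measurable_ray.
rewrite /exponential_prob /ray.
have mp : measurable_fun [set: R] (fun x => (exponential_pdf 1 x)%:E).
  by apply/measurable_EFinP; exact: measurable_exponential_pdf.
have -> : (\int[mu]_(x in [set` Interval (BSide b y) +oo%O]) (exponential_pdf 1 x)%:E =
    \int[mu]_(x in `[y, +oo[) (exponential_pdf 1 x)%:E)%E.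
  by case: b => //; rewrite integral_itv_obnd_cbnd //; exact: measurable_funTS.
have cf : continuous (fun x : R => expR (- x)).
  by move=> x; apply: continuous_comp; [exact: oppr_continuous|exact: continuous_expR].
have f0 x : y <= x -> 0 <= expR (- x) by rewrite expR_ge0.
have dF (x : R) : is_derive x (1 : R) (fun x => - 1 * expR (- 1 * x)) (expR (- x)).
  by apply: isd_eq (isdZ _ (isd_exp _ _)) _; rewrite !mulN1r opprK.
have lF : - 1 * expR (- 1 * x) @[x --> +oo%R] --> (0 : R).
  by apply: limZ0; under eq_fun do rewrite mulN1r; exact: cvg_expRN.
rewrite -[RHS]/((expR (- y))%:E) (_ : expR (- y) = 0 - - 1 * expR (- 1 * y)); last by rewrite !mulN1r sub0r opprK.
rewrite -(integral_ray cf f0 dF lF); apply: eq_integral => x; rewrite inE /= in_itv /= andbT => yx.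
by rewrite exponential_pdfE ?(le_trans y0) // mul1r mulN1r.
Qed.

Lemma weight_ray e b y : P (W e @^-1` ray b y) = (Num.min 1 (expR (- y)))%:E.
Proof.
have [y0|y0] := leP 0 y.
  by rewrite weight_ray_ge0 // min_r // -expR0 ler_expR oppr_le0.
rewrite min_l; last by rewrite -expR0 ler_expR oppr_ge0 ltW.
apply/eqP; rewrite eq_le probability_le1 /=; last exact: measurable_RV (measurable_ray b y).
have := @weight_ray_ge0 e true 0 (lexx 0); rewrite oppr0 expR0 => <-.
apply: le_measure; rewrite ?inE; [exact: measurable_RV (measurable_ray _ _)
  |exact: measurable_RV (measurable_ray _ _)|].
by move=> w /=; rewrite /ray /= !in_itv /= !andbT => w0; case: b => /=; [apply: ltW|]; exact: lt_le_trans w0.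
Qed.

(** Given W e2 = x, the probability is min(1, e^{-y-x}); integrating against e^{-x} gives the total
    of [step_density (- y)]. *)
Lemma weight_diff_ray e1 e2 b y : e1 != e2 ->
  P ((fun w => W e1 w - W e2 w) @^-1` ray b y) =
  (\int[mu]_(x in `[0%R, +oo[) (step_density (- y) x)%:E)%E.
Proof.
move=> e12; have [hI _] := hW.
have mray := measurable_ray b y.
have mphi : measurable_fun [set: R * R] (fun p : R * R => p.2 - p.1) by exact: measurable_funB.
have S1 : [pred i | i != e2] e1 by [].
have mU : measurable_fun [set: T] (W e2) by exact: measurable_funP.
pose g x : \bar R := (\1_(ray b y) x)%:E.
have mg : measurable_fun [set: R] g by apply/measurable_EFinP; exact: measurable_indic.
have g0 x : (0 <= g x)%E by rewrite lee_fin.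
have mD : measurable ((fun w => W e1 w - W e2 w) @^-1` ray b y).
  rewrite -[X in measurable X]setTI.
  by apply: measurable_funB => //; exact: measurable_funP.
have := integral_combine mU mphi S1 (indep_from_W hI (i0 := e2)) mg g0.
rewrite /= (_ : (\int[P]_w g (W e1 w - W e2 w)%R)%E =
   P ((fun w => W e1 w - W e2 w) @^-1` ray b y)); last first.
  by have := integral_indic P measurableT mD; rewrite setIT => <-.
move=> ->.
transitivity (\int[P]_w (Num.min 1 (expR (- y - W e2 w)%R))%:E)%E.
  apply: eq_integral => w _.
  rewrite [LHS](_ : _ = P (W e1 @^-1` ray b (y + W e2 w))); last first.
    have := integral_indic P measurableT (measurable_RV (W e1) (measurable_ray b (y + W e2 w))).
    rewrite setIT => <-; apply: eq_integral => w' _; rewrite /g /indic; congr ((_ : bool)%:R%:E).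
    apply/idP/idP; rewrite !inE /ray /= !in_itv /= !andbT; case: (b) => /=;
      by rewrite ?lerBrDr ?ltrBrDr.
  by rewrite weight_ray opprD.
pose h x : \bar R := (Num.min 1 (expR (- y - x)))%:E.
have mh : measurable_fun [set: R] h.
  apply/measurable_EFinP; apply: measurable_minr => //.
  by apply: measurableT_comp; [exact: measurable_expR|exact: measurable_funB].
have h0 x : (0 <= h x)%E by rewrite lee_fin le_min ler01 expR_ge0.
transitivity (\int[mu]_x (h x * (exponential_pdf 1 x)%:E))%E; last first.
  rewrite [RHS]integral_mkcond; apply: eq_integral => x _.
  rewrite /h /exponential_pdf !patchE /=; case: ifP => _; last by rewrite mule0.
  by rewrite -EFinM /step_density mul1r mulN1r mulrC.
apply: (@integral_law_density _ _ _ P (W e2) (fun x => (exponential_pdf 1 x)%:E) h) => //.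
- by apply/measurable_EFinP; exact: measurable_exponential_pdf.
- by move=> x; rewrite lee_fin exponential_pdf_ge0.
- by move=> A mA; exact: (hW.2 e2 A mA).
Qed.

Lemma prob_setI_full (A B : set T) : measurable A -> measurable B -> P B = 1%E ->
  P (A `&` B) = P A.
Proof.
move=> mA mB PB; rewrite [RHS](measureDI P mA mB) [X in (X + _)%E](_ : _ = 0%E) ?add0e //.
apply/eqP; rewrite eq_le measure_ge0 andbT.
have := probability_setC P mB; rewrite PB subee // => <-.
apply: le_measure; rewrite ?inE; [exact: measurableD|exact: measurableC|by move=> w []].
Qed.

Section step.
Variables (n : nat) (t : R).

Let D w := t + Y n w - X n w.

Let mD : measurable_fun [set: T] D.
Proof.
apply: measurable_funB; last exact: measurable_funP.
by apply: measurable_funD; [exact: measurable_cst|exact: measurable_funP].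
Qed.

Let mB : measurable_fun [set: R * R] (fun p : R * R => p.1 - p.2).
Proof. exact: measurable_funB. Qed.

Let indepYXZ : indep_from W [pred e | e == inr (inr n)] D.
Proof.
have [hI _] := hW.
have mphi : measurable_fun [set: R * R] (fun p : R * R => t + p.2 - p.1).
  by apply: measurable_funB => //; apply: measurable_funD.
have S1 : [pred i | i != inl n] (inr (inl n) : nat + (nat + nat)) by [].
have mU : measurable_fun [set: T] (W (inl n)) by exact: measurable_funP.
have := indep_combine hI mU mphi S1 (indep_from_W hI (i0 := inl n)).
by apply: indep_from_sub => e /= /eqP ->.
Qed.

Let preimage_measurable (U : T -> R) A : measurable_fun [set: T] U -> measurable A ->
  measurable (U @^-1` A).
Proof. by move=> mU mA; rewrite -[X in measurable X]setTI; exact: mU. Qed.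

Let prob_DZ A B : measurable A -> measurable B ->
  P (D @^-1` A `&` Z n @^-1` B) = (P (D @^-1` A) * P (Z n @^-1` B))%E.
Proof.
move=> mA mB'.
have := indepYXZ (s := [:: inr (inr n)]) (A := fun=> B) erefl.
rewrite /= eqxx => /(_ A erefl (fun=> mB') mA).
by rewrite cylinder_cons cylinder_nil setIT.
Qed.

Let mV : measurable_fun [set: T] (one_step X Y Z n t).
Proof.
rewrite (_ : one_step _ _ _ _ _ = fun w => clampp (D w, Z n w)).
  apply: measurableT_comp measurable_clampp _.
  by apply: measurable_fun_pair => //; exact: measurable_funP.
by apply/funext => w; rewrite one_stepE.
Qed.

Let Z_ge0 : P (Z n @^-1` ray true 0) = 1%E.
Proof. by have /= -> := @weight_ray_ge0 (inr (inr n)) true 0 (lexx 0); rewrite oppr0 expR0. Qed.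

Let mZ (B : set R) : measurable B -> measurable (Z n @^-1` B).
Proof. exact: measurable_RV. Qed.

(** On the almost sure event Z >= 0, the clamped value exceeds r >= 0 exactly when both t + Y - X
    and Z do, and these are independent. *)
Lemma one_step_gt r : 0 <= r -> P (one_step X Y Z n t @^-1` `]r, +oo[) =
  ((\int[mu]_(x in `[0%R, +oo[) (step_density (t - r) x)%:E) * (expR (- r))%:E)%E.
Proof.
move=> r0; rewrite -(prob_setI_full _ (mZ (measurable_ray true 0)) Z_ge0); last exact: preimage_measurable.
rewrite (_ : _ `&` _ = D @^-1` ray false r `&` Z n @^-1` ray false r); last first.
  apply/seteqP; split => w; rewrite /ray /= one_stepE /clampp /D /= !in_itv /= !andbT.
    move: (t + Y n w - X n w) (Z n w) => a b [].
    by case: (leP a b) => ?; case: (leP (a + b) 0) => ? ? ?; lra.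
  move: (t + Y n w - X n w) (Z n w) => a b [].
  by case: (leP a b) => ?; case: (leP (a + b) 0) => ? ? ?; split; lra.
rewrite prob_DZ; [|exact: measurable_ray|exact: measurable_ray].
congr (_ * _)%E; last exact: (@weight_ray_ge0 (inr (inr n))).
have := @weight_diff_ray (inr (inl n)) (inl n) false (r - t) erefl; rewrite opprB => <-.
congr (P _); apply/seteqP; split => w; rewrite /ray /D /= !in_itv /= !andbT; lra.
Qed.

Lemma one_step_le r : r < 0 -> P (one_step X Y Z n t @^-1` `]-oo, r]) =
  ((\int[mu]_(x in `[0%R, +oo[) (step_density (r - t) x)%:E) * (expR r)%:E)%E.
Proof.
move=> r0; rewrite -(prob_setI_full _ (mZ (measurable_ray true 0)) Z_ge0); last exact: preimage_measurable.
rewrite (_ : _ `&` _ = D @^-1` `]-oo, r] `&` Z n @^-1` ray true (- r)); last first.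
  apply/seteqP; split => w; rewrite /ray /= one_stepE /clampp /D /= !in_itv /= !andbT.
    move: (t + Y n w - X n w) (Z n w) => a b [].
    by case: (leP a b) => ?; case: (leP (a + b) 0) => ? ? ?; lra.
  move: (t + Y n w - X n w) (Z n w) => a b [].
  by case: (leP a b) => ?; case: (leP (a + b) 0) => ? ? ?; split; lra.
rewrite prob_DZ; [|exact: measurable_itv|exact: measurable_ray].
congr (_ * _)%E; last first.
  by rewrite -[r in RHS]opprK; apply: (@weight_ray_ge0 (inr (inr n))); rewrite oppr_ge0 ltW.
have := @weight_diff_ray (inl n) (inr (inl n)) true (t - r) erefl; rewrite opprB => <-.
congr (P _); apply/seteqP; split => w; rewrite /ray /D /= !in_itv /= !andbT; lra.
Qed.

Let V : {RV P >-> R} := HB.pack (one_step X Y Z n t) (isMeasurableFun.Build _ _ _ _ _ mV).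

(** Open upper rays are stable under intersection and generate the Borel sets. For r < 0 the ray is
    reached through its complement, using total mass 1 on both sides. *)
Lemma one_step_law A : measurable A -> P (one_step X Y Z n t @^-1` A) = density_law t A.
Proof.
move=> mA; rewrite -[LHS]/(distribution P V A).
have rays r : distribution P V `]r, +oo[ = density_law t `]r, +oo[.
  have [r0|r0] := leP 0 r; first by rewrite density_law_ray // -one_step_gt.
  have E : `]r, +oo[%classic = ~` `]-oo, r]%classic :> set R by rewrite setCitvl.
  rewrite E probability_setC; last exact: measurable_itv.
  rewrite [X in (_ - X)%E](one_step_le r0) -(density_law_rayN t r0).
  pose Q : {measure set R -> \bar R} := density_law t.
  have mI : measurable (`]-oo, r]%classic : set R) by exact: measurable_itv.
  have H : (Q `]-oo, r]%classic + Q (~` `]-oo, r]%classic) = 1)%E.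
    by rewrite -measureU ?setUv ?setICr //; [exact: density_law_setT|exact: measurableC].
  have fI : Q `]-oo, r]%classic \is a fin_num.
    rewrite ge0_fin_numE ?measure_ge0 //; apply: le_lt_trans (ltry 1).
    by rewrite -H; apply: leeDl; exact: measure_ge0.
  by rewrite -H addeAC subee ?add0e.
apply: (measure_unique (@RGenOInfty.G R) (fun k => `]- k%:R, +oo[%classic) _ _ _ _ (distribution P V) (density_law t)) mA => //.
- exact: RGenOInfty.measurableE.
- move=> _ _ [x ->] [y ->]; exists (Num.max x y).
  apply/seteqP; split=> z /=; rewrite !in_itv /= !andbT gt_max; first by case=> -> ->.
  by move/andP.
- by move=> k; exists (- k%:R).
- apply/seteqP; split=> // x _; exists (Num.bound `|x|) => //=.
  rewrite in_itv /= andbT ltrNl; apply: le_lt_trans (ler_norm _) _; rewrite normrN.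
  by apply: archi_boundP; exact: normr_ge0.
- by move=> _ [x ->]; exact: rays.
- by move=> k; rewrite (le_lt_trans (probability_le1 _ (measurable_itv _))) ?ltry.
Qed.

Lemma one_step_integralE (g : R -> \bar R) : measurable_fun [set: R] g ->
  (forall x, (0 <= g x)%E) ->
  one_step_integral X Y Z n g t = (\int[mu]_x (g x * (full_density t x)%:E))%E.
Proof.
move=> mg g0.
apply: (@integral_law_density _ _ _ P (one_step X Y Z n t) (fun x => (full_density t x)%:E) g) => //.
- by apply/measurable_EFinP; exact: measurable_full_density.
- by move=> x; rewrite lee_fin full_density_ge0.
- exact: one_step_law.
Qed.

End step.
End one_step_law.

(** * The n-step law *)

Section transition_operator.
Context {R : realType}.
Local Notation mu := (@lebesgue_measure R).
Local Notation rT := (measurableTypeR R).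

Lemma integral_full_density (F : R -> R) t : measurable_fun [set: R] F ->
  (forall x, 0 <= F x) ->
  (\int[mu]_x (F x * full_density t x)%:E =
   \int[mu]_(x in `[0%R, +oo[) (F x * step_density t x)%:E +
   \int[mu]_(x in `[0%R, +oo[) (F (- x) * step_density (- t) x)%:E)%E.
Proof.
move=> mF F0.
have mN : measurable_fun [set: R] (fun x => F (- x)) by exact: measurableT_comp.
rewrite (@integral_split_opp _ (fun x => (F x * full_density t x)%:E)); first last.
- by move=> x; rewrite lee_fin mulr_ge0 ?full_density_ge0.
- by apply/measurable_EFinP; apply: measurable_funM => //; exact: measurable_full_density.
congr (_ + _)%E.
  by apply: eq_integral => x; rewrite inE /= in_itv /= andbT /full_density => ->.
rewrite -[LHS]integral_itv_obnd_cbnd; last first.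
  apply/measurable_funTS/measurable_EFinP; apply: measurable_funM => //.
  by apply: measurable_full_density2 => //; exact: measurable_cst.
rewrite -[RHS]integral_itv_obnd_cbnd; last first.
  apply/measurable_funTS/measurable_EFinP; apply: measurable_funM => //.
  exact: measurable_step_density.
apply: eq_integral => x; rewrite inE /= in_itv /= andbT /full_density oppr_ge0 opprK => x0.
by rewrite leNgt x0.
Qed.

Definition transition (f : R -> \bar R) (t : R) : \bar R :=
  (\int[mu]_x (f x * (full_density t x)%:E))%E.

Lemma transition_ge0 f t : (forall x, (0 <= f x)%E) -> (0 <= transition f t)%E.
Proof.
move=> f0; apply: integral_ge0 => x _; apply: mule_ge0 => //.
by rewrite lee_fin full_density_ge0.
Qed.

Lemma measurable_transition f : measurable_fun [set: R] f -> (forall x, (0 <= f x)%E) ->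
  measurable_fun [set: R] (transition f).
Proof.
move=> mf f0.
pose F (z : rT * rT) : \bar R := (f z.2 * (full_density z.1 z.2)%:E)%E.
have mF : measurable_fun [set: rT * rT] F.
  apply: emeasurable_funM; first by apply: (measurableT_comp mf); exact: measurable_snd.
  apply/measurable_EFinP; apply: measurable_full_density2; [exact: measurable_fst|exact: measurable_snd].
have F0 z : (0 <= F z)%E by apply: mule_ge0 => //; rewrite lee_fin full_density_ge0.
exact: (measurable_fun_fubini_tonelli_F (m2 := mu) F mF F0).
Qed.

Lemma measurable_kernel_formula2 d (T : measurableType d) (a b c : nat -> nat -> nat -> R) n
    (h k : T -> R) : measurable_fun [set: T] h -> measurable_fun [set: T] k ->
  measurable_fun [set: T] (fun x => kernel_formula a b c n (h x) (k x)).
Proof.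
move=> mh mk.
have mexp (F : T -> R) : measurable_fun [set: T] F -> measurable_fun [set: T] (fun x => expR (F x)).
  by move=> mF; apply: measurableT_comp => //; exact: measurable_expR.
have mc (r : R) (F : T -> R) : measurable_fun [set: T] F -> measurable_fun [set: T] (fun x => r * F x).
  by move=> mF; apply: measurable_funM => //; exact: measurable_cst.
have mcr (r : R) (F : T -> R) : measurable_fun [set: T] F -> measurable_fun [set: T] (fun x => F x * r).
  by move=> mF; apply: measurable_funM => //; exact: measurable_cst.
have mle (F G : T -> R) : measurable_fun [set: T] F -> measurable_fun [set: T] G ->
    measurable_fun [set: T] (fun x => F x <= G x).
  exact: measurable_fun_ler.
apply: measurable_fun_ifT.
- by apply/mle => //; exact: measurable_cst.
- apply: measurable_sum => p; apply: measurable_sum => q; apply/mc; apply/mexp.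
  by apply: measurable_funB; apply/mc.
apply: measurable_fun_ifT => //.
- exact: mle.
- apply: measurable_funD; last first.
    apply: measurable_sum => p; apply: measurable_sum => q; apply/mc; apply/mexp.
    by apply: measurable_funB; apply/mc.
  apply: measurable_funD.
    by apply/mcr; apply/mc; apply/mexp; apply: measurable_funB => //; apply/mc.
  apply: measurable_sum => p; apply/mcr; apply: measurable_funM; first exact: mc.
  by apply/mexp; apply: measurable_funB; apply/mc => //; apply: measurable_funB.
- apply: measurable_funD; last first.
    apply: measurable_sum => p; apply: measurable_sum => q; apply/mc; apply/mexp.
    by apply: measurable_funB; apply/mc.
  apply: measurable_funD.
    by apply/mcr; apply/mc; apply/mexp; apply: measurable_funB => //; apply/mc.
  apply: measurable_sum => p; apply/mcr; apply: measurable_funM; first exact: mc.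
  by apply/mexp; apply: measurable_funB; apply/mc => //; apply: measurable_funB.
Qed.

Variables al g et s : nat -> R.
Hypotheses (al0 : al 0 = 0) (g0 : g 0 = 0) (et0 : et 0 = 0) (s0 : s 0 = 0).
Hypotheses (Hal : has_genfun 0 al genalpha) (Hg : has_genfun 0 g genG)
  (Het : has_genfun 0 et genH) (Hs : has_genfun 0 s (@genS R)).
Local Notation kap := (kap al g et s).

Definition full_kap n (t r : R) : R := if 0 <= r then kap n t r else kap n (- t) (- r).

Lemma full_kap_ge0 n t r : 0 <= full_kap n.+1 t r.
Proof.
rewrite /full_kap; case: ifPn => [r0|]; first exact: kap_ge0.
by rewrite -ltNge => r0; apply: kap_ge0 => //; rewrite oppr_ge0 ltW.
Qed.

(** Joint measurability is read off the closed formula, a piecewise combination of exponentials. *)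
Lemma measurable_full_kap2 d (T : measurableType d) n (h k : T -> R) :
  measurable_fun [set: T] h -> measurable_fun [set: T] k ->
  measurable_fun [set: T] (fun x => full_kap n.+1 (h x) (k x)).
Proof.
move=> mh mk; apply: measurable_fun_ifT; first exact: measurable_fun_ler.
  under eq_fun do rewrite -(kernel_formulaE et s al0 g0) //.
  exact: measurable_kernel_formula2.
under eq_fun do rewrite -(kernel_formulaE et s al0 g0) //.
by apply: measurable_kernel_formula2; exact: measurableT_comp.
Qed.

Lemma full_kap1 t r : full_kap 1 t r = full_density t r.
Proof.
rewrite /full_kap /full_density; case: ifPn => [r0|]; first exact: kap1E.
by rewrite -ltNge => r0; apply: kap1E => //; rewrite oppr_ge0 ltW.
Qed.

(** For r < 0 this is the equation at (-t, -r) with the two half-line integrals exchanged. *)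
Lemma full_kap_backward n t r :
  (\int[mu]_x (full_kap n.+1 x r * full_density t x)%:E = (full_kap n.+2 t r)%:E)%E.
Proof.
rewrite integral_full_density; first last.
- by move=> x; exact: full_kap_ge0.
- by apply: measurable_full_kap2 => //; exact: measurable_cst.
rewrite /full_kap; case: ifPn => [r0|].
  by apply: kap_backward => // x; exact: kap_ge0.
rewrite -ltNge => r0; have r0' : 0 <= - r by rewrite oppr_ge0 ltW.
rewrite -(kap_backward al0 g0 et0 s0 Hal Hg Het Hs (- t) r0'); last by move=> x; exact: kap_ge0.
rewrite addeC opprK; congr (_ + _)%E.
by apply: eq_integral => x _; rewrite opprK.
Qed.

(** [iterS] prepends a first step; Tonelli brings it next to the kernel, where the backward equation
    yields the following kernel. *)
Lemma iter_transitionE f n t : measurable_fun [set: R] f -> (forall x, (0 <= f x)%E) ->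
  iter n.+1 transition f t = (\int[mu]_r (f r * (full_kap n.+1 t r)%:E))%E.
Proof.
move=> mf f0; elim: n t => [|n IH] t.
  by apply: eq_integral => x _; rewrite full_kap1.
rewrite iterS /transition.
pose F (z : rT * rT) : \bar R :=
  (f z.2 * (full_kap n.+1 z.1 z.2)%:E * (full_density t z.1)%:E)%E.
have k0 x y : (0 <= (full_kap n.+1 x y)%:E)%E by rewrite lee_fin full_kap_ge0.
have d0 x : (0 <= (full_density t x)%:E)%E by rewrite lee_fin full_density_ge0.
have mF : measurable_fun [set: rT * rT] F.
  apply: emeasurable_funM.
    apply: emeasurable_funM; first by apply: (measurableT_comp mf); exact: measurable_snd.
    by apply/measurable_EFinP; apply: measurable_full_kap2; [exact: measurable_fst|exact: measurable_snd].
  apply/measurable_EFinP; apply: measurable_full_density2; [exact: measurable_cst|exact: measurable_fst].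
have F0 z : (0 <= F z)%E by rewrite /F !mule_ge0.
have mfk x : measurable_fun [set: R] (fun y => (f y * (full_kap n.+1 x y)%:E)%E).
  apply: emeasurable_funM => //; apply/measurable_EFinP.
  by apply: measurable_full_kap2 => //; exact: measurable_cst.
transitivity (\int[mu]_x \int[mu]_y F (x, y))%E.
  apply: eq_integral => x _; rewrite IH -ge0_integralZr //; first exact: mfk.
  by move=> y _; rewrite mule_ge0.
rewrite (@fubini_tonelli _ _ rT rT R mu mu F mF F0).
apply: eq_integral => y _; rewrite -full_kap_backward -ge0_integralZl //.
- by apply: eq_integral => x _; rewrite /F /= -muleA -EFinM.
- apply/measurable_EFinP; apply: measurable_funM; last exact: measurable_full_density.
  by apply: measurable_full_kap2 => //; exact: measurable_cst.
- by move=> x _; rewrite EFinM mule_ge0.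
Qed.

End transition_operator.

Section transition_kernel.
Context {R : realType} {d : measure_display} {T : measurableType d}.
Variable P : probability T R.
Variables X Y Z : nat -> {RV P >-> R}.
Hypothesis hW : iid_exponential_weights X Y Z.
Local Notation mu := (@lebesgue_measure R).

(** The recursion of the chain peels off the last step, hence [iterSr] and a change of test function
    from f to [transition f]. *)
Lemma Delta_integral r' n (f : R -> \bar R) : measurable_fun [set: R] f ->
  (forall x, (0 <= f x)%E) ->
  (\int[P]_w f (Delta X Y Z r' n w) = iter n transition f r')%E.
Proof.
move=> mf f0; elim: n f mf f0 => [|n IH] f mf f0.
  rewrite /= -[LHS]/(\int[P]_w (cst (f r')) w)%E integral_cst //=.
  by rewrite [X in (_ * X)%E]probability_setT mule1.
rewrite (Delta_step hW) // iterSr -IH.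
- by apply: eq_integral => w _; rewrite one_step_integralE.
- exact: measurable_transition.
- by move=> x; exact: transition_ge0.
Qed.

Variables al g et s : nat -> R.
Hypotheses (al0 : al 0 = 0) (g0 : g 0 = 0) (et0 : et 0 = 0) (s0 : s 0 = 0).
Hypotheses (Hal : has_genfun 0 al genalpha) (Hg : has_genfun 0 g genG)
  (Het : has_genfun 0 et genH) (Hs : has_genfun 0 s (@genS R)).
Local Notation full_kap := (full_kap al g et s).

Lemma full_kap_transition_kernel n : is_transition_kernel X Y Z n.+1 (full_kap n.+1).
Proof.
move=> r'; split.
- by apply: measurable_full_kap2 => //; exact: measurable_cst.
- by move=> r; exact: full_kap_ge0.
move=> A mA.
have [mD _] := Delta_indep hW r' n.+1.
have mDA : measurable (Delta X Y Z r' n.+1 @^-1` A).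
  by rewrite -[X in measurable X]setTI; exact: mD.
have := integral_indic P measurableT mDA; rewrite setIT => <-.
pose f (x : R) : \bar R := (\1_A x)%:E.
have mf : measurable_fun [set: R] f by apply/measurable_EFinP; exact: measurable_indic.
have f0 x : (0 <= f x)%E by rewrite lee_fin.
rewrite -[LHS]/(\int[P]_w f (Delta X Y Z r' n.+1 w))%E Delta_integral //.
rewrite (iter_transitionE al0 g0 et0 s0 Hal Hg Het Hs) // [RHS]integral_mkcond.
apply: eq_integral => x _; rewrite /f patchE indicE.
by case: (x \in A); rewrite ?mul1e ?mul0e.
Qed.

(** Both are densities of the same law, integrable because its total mass is finite. *)
Lemma transition_kernel_ae n (K K' : R -> R -> R) r' :
  is_transition_kernel X Y Z n K -> is_transition_kernel X Y Z n K' ->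
  {ae mu, forall r, K r' r = K' r' r}.
Proof.
move=> /(_ r')[mK K0 KE] /(_ r')[mK' K'0 K'E].
have : ae_eq mu setT (fun r => (K r' r)%:E) (fun r => (K' r' r)%:E).
  apply: integral_ae_eq => //.
  - apply/integrableP; split; first by apply/measurable_EFinP.
    under eq_integral do rewrite gee0_abs ?lee_fin //.
    rewrite -KE //; apply: le_lt_trans (ltry 1); apply: probability_le1.
    by rewrite preimage_setT.
  - by apply/measurable_EFinP.
  - by move=> E _ mE; rewrite -KE // -K'E.
by apply: filterS => x /(_ I) [].
Qed.

End transition_kernel.

Theorem theorem2 (R : realType) (d : measure_display) (T : measurableType d)
    (P : probability T R) (X Y Z : nat -> {RV P >-> R})
    (hW : iid_exponential_weights X Y Z) :
  (exists (a b c : nat -> nat -> nat -> R) (dq : nat -> R),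
      kernel_coefficients a b c dq) /\
  (forall (a b c : nat -> nat -> nat -> R) (dq : nat -> R),
    kernel_coefficients a b c dq ->
    forall n : nat, (1 <= n)%N ->
      (exists K : R -> R -> R, is_transition_kernel X Y Z n K) /\
      (forall K : R -> R -> R, is_transition_kernel X Y Z n K ->
        forall r' : R,
          {ae lebesgue_measure, forall r : R, K r' r = K (- r') (- r)} /\
          {ae lebesgue_measure, forall r : R, 0 <= r ->
             K r' r = kernel_formula a b c n r' r})).
Proof.
have [al al0 Hal] := @genalpha_series R.
have [g g0 Hg] := @genG_series R.
have [et et0 Het] := @genH_series R.
have [s s0 Hs] := @genS_series R.
split; first by do 4!eexists; exact: (kernel_coefficients_exist al0 g0 et0 s0 Hal Hg Het Hs).
move=> a b c dq Habc [//|n] _.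
have H := full_kap_transition_kernel hW al0 g0 et0 s0 Hal Hg Het Hs n.
split; first by eexists; exact: H.
move=> K HK r'.
have aeF := ae_filter_ringOfSetsType (@lebesgue_measure R).
split.
  (* [full_kap] counts r = 0 among the nonnegative points, so reflection holds by construction only
     off this null set. *)
  have ae_nz : {ae lebesgue_measure, forall r : R, r != 0}.
    exists [set 0]; split; [exact: measurable_set1|exact: lebesgue_measure_set1|].
    by move=> x /= /negP; rewrite negbK => /eqP.
  move: (transition_kernel_ae r' HK H) (ae_opp (transition_kernel_ae (- r') HK H)) ae_nz.
  apply: (@filterS3 _ _ aeF) => r -> -> r0; rewrite /full_kap oppr_ge0 !opprK.
  by case: ltgtP r0 => // r0 _; rewrite ltW.
move: (transition_kernel_ae r' HK H); apply: (@filterS _ _ aeF) => r -> r0.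
rewrite /full_kap r0 -(kernel_formulaE et s al0 g0) // /kernel_formula.
(* The given coefficients coincide with the constructed ones for every n >= 1, so the formula may be
   evaluated with the latter. *)
have E p q := kernel_coefficients_uniq al0 g0 et0 s0 Hal Hg Het Hs Habc p q (ltn0Sn n).
case: ifP => _; last case: ifP => _; [|congr (_ + _)|congr (_ + _)];
  apply: eq_bigr => p _; apply: eq_bigr => q _; by have [Ea Eb Ec] := E p q; rewrite ?Ea ?Eb ?Ec.
Qed.
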